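(* Let $1/n_0\ll 1/C\ll\varepsilon\ll 1$, and let $n\geq n_0$. Let $\{V_1,V_2,C_1,C_2\}$ be an equitable partition of $[4n-1]$ with $|C_1|=n-1$ (so $|V_1|=|V_2|=|C_2|=n$), and let $G$ be the graph on $V_1\cup V_2\cup C_1\cup C_2$ whose edges are all pairs $xy$ with $x\in V_1\cup V_2$ (and $y\neq x$ arbitrary). Let $C_2'\subseteq C_2$ be any subset of size $\lfloor\varepsilon n\rfloor$. If $p\geq C\log n/n$, then with probability at least $1-1/n$ there exists a collection $\mathcal{T}\subseteq\mathcal{G}^{(3)}(G,p)$ of edge-disjoint triangles such that $H:=G-\bigcup_{T\in\mathcal{T}}E(T)$ is a tripartite graph with parts $V_1,V_2,C_1\cup C_2$ satisfying: (a) $d_H(c)=0$ for every $c\in C_1\cup C_2'$, and $N_H(c)=V_1\cup V_2$ for every $c\in C_2\setminus C_2'$; (b) $H[V_1\cup V_2]$ is $(|C_2|-|C_2'|)$-regular.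
   Context: Hierarchy notation: a statement beginning ''Let $a\ll b\ll c$'' means there exist non-decreasing functions $f,g:(0,1]\to(0,1]$ such that the statement holds for all $a,b,c\in(0,1]$ with $a\le f(b)$ and $b\le g(c)$ (here $a=1/n_0$, $b=1/C$, $c=\varepsilon$). A partition is equitable if its part sizes differ by at most $1$. $\mathcal{G}^{(3)}(G,p)$ is a random set of triangles of $G$, each included independently with probability $p$. *)

(* Defs.v *)
From mathcomp Require Import reals.
From mathcomp Require Import all_boot all_order all_algebra.

Set Implicit Arguments.
Unset Strict Implicit.
Unset Printing Implicit Defensive.

Import Order.TTheory GRing.Theory Num.Theory.

(** A graph on the vertex type [V] is given by its set of edges, an edge being
    a two-element set of vertices; a triangle is given by its three-element
    vertex set. *)

Section Graphs.
Variable V : finType.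
Implicit Types (E : {set {set V}}) (A T : {set V}) (x : V).

Definition neighbours E x : {set V} := [set y | [set x; y] \in E].

Definition degree E x : nat := #|neighbours E x|.

Definition induced E A : {set {set V}} := [set e in E | e \subset A].

(* Regularity of a graph whose vertex set is [A]. *)
Definition regular_on A E (d : nat) : bool := [forall x in A, degree E x == d].

Definition independent E A : bool := [forall e in E, ~~ (e \subset A)].

Definition tripartite E (A1 A2 A3 : {set V}) : bool :=
  [&& A1 :|: A2 :|: A3 == [set: V],
      [&& [disjoint A1 & A2], [disjoint A1 & A3] & [disjoint A2 & A3]] &
      [&& independent E A1, independent E A2 & independent E A3]].

Definition triangle_edges T : {set {set V}} :=
  [set e : {set V} | (e \subset T) && (#|e| == 2)].

Definition triangles E : {set {set V}} :=
  [set T : {set V} | (#|T| == 3) && (triangle_edges T \subset E)].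

Definition edge_disjoint (TT : {set {set V}}) : bool :=
  [forall T1 in TT, forall T2 in TT,
     (T1 != T2) ==> [disjoint triangle_edges T1 & triangle_edges T2]].

Definition remove_triangles E (TT : {set {set V}}) : {set {set V}} :=
  E :\: \bigcup_(T in TT) triangle_edges T.

Definition edges_meeting A : {set {set V}} :=
  [set [set x; y] | x in A, y in [set: V] & y != x].

Definition equitable_partition (P : {set {set V}}) : bool :=
  partition P [set: V] && [forall A in P, forall B in P, #|A| <= #|B| + 1].

End Graphs.

Local Open Scope ring_scope.

(** [Pr_triangles p E Q] is the probability that the random set of triangles
    of [E], each included independently with probability [p], satisfies [Q]. *)
Definition Pr_triangles (R : realType) (V : finType) (p : R)
    (E : {set {set V}}) (Q : pred {set {set V}}) : R :=
  \sum_(S in powerset (triangles E) | Q S)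
    \prod_(T in triangles E) (if T \in S then p else 1 - p).

(** Non-decreasing functions from (0,1] to (0,1], as used in hierarchies of
    constants; values outside (0,1] are irrelevant. *)
Definition hierarchy_fun (R : realType) (f : R -> R) : Prop :=
  (forall x, 0 < x <= 1 -> 0 < f x <= 1) /\
  (forall x y, 0 < x -> x <= y -> y <= 1 -> f x <= f y).

(* Main.v *)
Require Import Defs.
From mathcomp Require Import reals sequences exp boolp.
From mathcomp Require Import all_boot all_order all_algebra.
From mathcomp Require Import zify ring lra.

(** The triangles used must all have the form [xyc] with [x, y] in [V1 :|: V2] and [c] in
    [C1 :|: C2'], so we have to properly colour, by the colours in [C1 :|: C2'] taken from random
    lists, all edges inside [V1] and [V2] and some edges between [V1] and [V2], such that every
    colour class is a perfect matching of [V1 :|: V2].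

    Split [V1] and [V2] into a large constant number of blocks indexed by an elementary abelian
    2-group [K], the block of index 0 being small and padded with dummies.  Each nonzero [g] in [K]
    gives a round in which block [u] is paired with block [u + g].  Most colours ("main" colours)
    receive a round for [V1] and a round for [V2], and one colour after another we choose a perfect
    matching in the unused part of the round, which is a regular bipartite graph of linear degree:
    its random sparsification still has a perfect matching, because Hall violators with small
    boundary are determined by few vertices.  Vertices matched with dummies are left for cross
    edges.

    The unused matchings of all rounds, and a 1-factorisation of the blocks, leave an inner graph of
    small degree.  It is cut into matchings of linear size, each of which is coloured bijectively by
    a fixed set of the remaining ("reserve") colours.  Hence the number of edges of each colour is
    prescribed, and is the same in [V1] as in [V2], so that each colour leaves equally many vertices
    uncovered in [V1] and in [V2].  Finally these are matched across, colour by colour; the rounds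
    are distributed so that few earlier cross edges get in the way. *)

Set Implicit Arguments.
Unset Strict Implicit.
Unset Printing Implicit Defensive.

Import Order.TTheory GRing.Theory Num.Theory.
Local Open Scope ring_scope.

(** * Random subsets *)

(** Every random step inspects only triangles that no earlier step has inspected: those of a new
    colour, of a new piece, or across the parts. So failure probabilities simply add up and no
    conditional probabilities are needed.

    Each step is a perfect matching found by a union bound over Hall violators. With [p] only of
    order [log n / n], a violator with boundary [j * d], [d] linear in [n], survives with
    probability [n^(-c j)], so at most [n^(O(j))] violators may have this boundary. For nearly
    complete graphs this is immediate.

    Block 0 is nearly empty on purpose: each main colour then leaves about a whole block of vertices
    uncovered, enough for a random matching across. If only few were uncovered, the cross matching
    could not be found with high probability. *)

Lemma set_ind (T : finType) (P : {set T} -> Prop) :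
  P set0 -> (forall (D : {set T}) x, x \notin D -> P D -> P (x |: D)) -> forall D, P D.
Proof.
move=> P0 PU D; move: {2}#|D| (eqxx #|D|) => n.
elim: n D => [|n IH] D; first by rewrite cards_eq0 => /eqP ->.
move=> cD; have /card_gt0P[x xD] : (0 < #|D|)%N by rewrite (eqP cD).
rewrite -(setD1K xD); apply: PU; first by rewrite setD11.
by apply: IH; move: cD; rewrite (cardsD1 x) xD add1n eqSS.
Qed.

Section RandomSubset.
Variables (R : realFieldType) (T : finType) (p : R).
Hypothesis p01 : 0 <= p <= 1.
Implicit Types (D S J : {set T}) (Q : pred {set T}).

(** The formula of [Pr_triangles] over an arbitrary finite ground set [D], so that the two are
    convertible; ground sets can then be split and exposed piece by piece. *)
Definition pr D Q : R :=
  \sum_(S in powerset D | Q S) \prod_(x in D) (if x \in S then p else 1 - p).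

Lemma eq_pr D Q1 Q2 : (forall S, S \subset D -> Q1 S = Q2 S) -> pr D Q1 = pr D Q2.
Proof.
move=> eqQ; apply: eq_bigl => S; rewrite powersetE.
by case: (boolP (S \subset D)) => //= /eqQ.
Qed.

Lemma pr_ge0 D Q : 0 <= pr D Q.
Proof.
have /andP[p0 p1] := p01.
by apply: sumr_ge0 => S _; apply: prodr_ge0 => x _; case: ifP; rewrite ?subr_ge0.
Qed.

Lemma pr_set0 Q : pr set0 Q = (Q set0)%:R.
Proof.
rewrite /pr big_mkcondr (big_pred1 set0) => [|S]; last first.
  by rewrite powersetE subset0.
by rewrite big_set0; case: (Q set0).
Qed.

Lemma pr_setU1 x D Q : x \notin D ->
  pr (x |: D) Q = p * pr D (fun S => Q (x |: S)) + (1 - p) * pr D Q.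
Proof.
move=> xD; rewrite {1}/pr (bigID (fun S : {set T} => x \in S)) /=; congr (_ + _).
  rewrite (reindex_onto (fun S => x |: S) (fun S => S :\ x)) /=; last first.
    by move=> S /andP[_ xS]; rewrite setD1K.
  rewrite /pr mulr_sumr; apply: eq_big => S.
    rewrite !powersetE setU11 andbT; apply/idP/idP.
      case/andP=> /andP[/subsetP sSD ->] /eqP eqS; rewrite andbT.
      apply/subsetP=> y yS; have := sSD y; rewrite !inE yS orbT => /(_ isT).
      by case/predU1P=> // yx; move: yS; rewrite -eqS yx setD11.
    case/andP=> sSD ->; rewrite setUS // setU1K ?eqxx //.
    by apply: contra xD; apply: (subsetP sSD).
  move=> _; rewrite big_setU1 //= setU11; congr (_ * _).
  apply: eq_bigr => y yD; rewrite in_setU1.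
  by case: eqP => // yx; rewrite yx (negPf xD) in yD.
rewrite /pr mulr_sumr; apply: eq_big => S.
  rewrite !powersetE; apply/idP/idP.
    case/andP=> /andP[/subsetP sSD ->] xS; rewrite andbT; apply/subsetP=> y yS.
    by have /setU1P[yx|//] := sSD y yS; rewrite -yx yS in xS.
  case/andP=> sSD ->; rewrite andbT; apply/andP; split.
    by apply: subset_trans sSD (subsetUr _ _).
  by apply: contra xD; apply: (subsetP sSD).
by move=> /andP[_ xS]; rewrite big_setU1 //= (negPf xS).
Qed.

Lemma pr_predT D : pr D predT = 1.
Proof.
elim/set_ind: D => [|D x xD IH]; first by rewrite pr_set0.
rewrite pr_setU1 // -[LHS]/(p * pr D predT + (1 - p) * pr D predT) IH; ring.
Qed.

Lemma le_pr D Q1 Q2 : (forall S, S \subset D -> Q1 S -> Q2 S) -> pr D Q1 <= pr D Q2.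
Proof.
have /andP[p0 p1] := p01 => sQ; rewrite /pr big_mkcondr [leRHS]big_mkcondr.
apply: ler_sum => S; rewrite powersetE => /sQ {}sQ.
case: (boolP (Q1 S)) => [/sQ ->//|_]; case: ifP => // _.
by apply: prodr_ge0 => x _; case: ifP; rewrite ?subr_ge0.
Qed.

Lemma prC D Q : pr D Q = 1 - pr D (predC Q).
Proof.
apply/eqP; rewrite -(pr_predT D) eq_sym subr_eq; apply/eqP.
rewrite {1}/pr (bigID Q) /=.
by congr (_ + _); apply: eq_bigl => S; rewrite andbT.
Qed.

Lemma pr_exists (I : finType) (A : pred I) D (B : I -> pred {set T}) :
  pr D (fun S => [exists (i | A i), B i S]) <= \sum_(i | A i) pr D (B i).
Proof.
have /andP[p0 p1] := p01.
rewrite /pr; under [leRHS]eq_bigr => i _ do rewrite big_mkcondr.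
rewrite exchange_big big_mkcondr /=; apply: ler_sum => S _.
set W := \prod_(_ in _) _.
have W0 : 0 <= W by apply: prodr_ge0 => x _; case: ifP; rewrite ?subr_ge0.
case: ifP => [/exists_inP[i Ai Bi]|_]; last by apply: sumr_ge0 => i _; case: ifP.
by rewrite (bigD1 i) //= Bi lerDl; apply: sumr_ge0 => j _; case: ifP.
Qed.

Lemma pr_disjoint D J : J \subset D ->
  pr D (fun S => [disjoint J & S]) = (1 - p) ^+ #|J|.
Proof.
elim/set_ind: D J => [|D x xD IH] J.
  by rewrite subset0 => /eqP ->; rewrite pr_set0 disjoints_subset sub0set cards0.
move=> sJD; rewrite pr_setU1 //; have [xJ|xJ] := boolP (x \in J).
  rewrite (_ : pr D _ = 0) ?mulr0 ?add0r; last first.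
    rewrite /pr big_pred0 // => S; apply/negP=> /andP[_].
    by rewrite disjoint_sym => /disjoint_setI0/setP/(_ x); rewrite !inE xJ eqxx.
  rewrite (cardsD1 x) xJ exprS -IH; last by rewrite subDset.
  congr (_ * _); apply: eq_pr => S sSD.
  apply/pred0P/pred0P => dJS y /=; apply/negP=> /andP[yJ yS].
    by have := dJS y; rewrite /= yS andbT; case/setD1P: yJ => _ ->.
  have := dJS y; rewrite /= yS andbT !inE yJ andbT => /negbFE/eqP yx.
  by move: xD; rewrite -yx (subsetP sSD).
have sJD' : J \subset D.
  apply/subsetP=> y yJ; have /setU1P[yx|//] := subsetP sJD y yJ.
  by rewrite -yx yJ in xJ.
rewrite (@eq_pr _ _ (fun S => [disjoint J & S])) ?(IH J) //; first by ring.
move=> S _; apply/pred0P/pred0P => dJS y /=; apply/negP=> /andP[yJ yS].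
  by have := dJS y; rewrite /= yJ inE yS orbT.
have := dJS y; rewrite /= yJ /=; move: yS; rewrite !inE => /predU1P[yx|->//].
by rewrite -yx yJ in xJ.
Qed.

(** Independence in the form used throughout: [D1] is exposed before [D2], and [c] bounds from below
    the conditional probability of [Q] given any outcome satisfying [A]. The elements of [D1] are
    exposed one at a time and absorbed into [Q]. *)
Lemma pr_step D1 D2 (A Q : pred {set T}) (c : R) : [disjoint D1 & D2] ->
  (forall S1, S1 \subset D1 -> A S1 -> c <= pr D2 (fun S2 => Q (S1 :|: S2))) ->
  c * pr D1 A <= pr (D1 :|: D2) Q.
Proof.
have /andP[p0 p1] := p01.
elim/set_ind: D1 A Q => [|D x xD IH] A Q.
  move=> _ cQ; rewrite pr_set0 set0U; have [A0|_] := boolP (A set0); last first.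
    by rewrite mulr0 pr_ge0.
  rewrite mulr1; apply: le_trans (cQ _ (sub0set _) A0) _.
  by apply: le_pr => S _; rewrite set0U.
rewrite disjoints_subset subUset sub1set inE -disjoints_subset => /andP[xD2 dD] cQ.
rewrite -setUA !pr_setU1 // ?inE ?negb_or ?xD //.
rewrite mulrDr !(mulrCA c); apply: lerD; apply: ler_wpM2l; rewrite ?subr_ge0 //.
  apply: IH => // S1 sS1 AS1.
  apply: le_trans (cQ _ (setUS _ sS1) AS1) _.
  by apply: le_pr => S2 _; rewrite setUA.
by apply: IH => // S1 sS1 AS1; apply: cQ => //; apply: subset_trans sS1 (subsetUr _ _).
Qed.

(** Follows from [(1 - a) * (1 - b) >= 1 - a - b]; iterating it makes the failure probabilities of
    successive steps add up. For [b > 1] the bound is negative. *)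
Lemma pr_step_subr D1 D2 (A Q : pred {set T}) (a b : R) :
  [disjoint D1 & D2] -> 0 <= a -> 0 <= b -> 1 - a <= pr D1 A ->
  (forall S1, S1 \subset D1 -> A S1 -> 1 - b <= pr D2 (fun S2 => Q (S1 :|: S2))) ->
  1 - a - b <= pr (D1 :|: D2) Q.
Proof.
move=> dD a0 b0 aA bQ; have [b1|b1] := lerP b 1; last first.
  by apply: le_trans (pr_ge0 _ _); lra.
apply: le_trans (pr_step dD bQ); have := ler_wpM2l (_ : 0 <= 1 - b) aA.
by rewrite subr_ge0 => /(_ b1); nra.
Qed.

Lemma pr_subset D1 D2 Q : D1 \subset D2 ->
  (forall S1 S2, S1 \subset S2 -> Q S1 -> Q S2) -> pr D1 Q <= pr D2 Q.
Proof.
move=> sD upQ; rewrite -(setID D2 D1) (setIidPr sD) -[leLHS]mul1r.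
apply: pr_step => [|S1 _ QS1].
  by rewrite disjoints_subset; apply/subsetP=> x xD; rewrite !inE xD.
rewrite -(pr_predT (D2 :\: D1)); apply: le_pr => S2 _ _.
by apply: upQ QS1; apply: subsetUl.
Qed.

End RandomSubset.

(** * Hall's theorem and random bipartite graphs *)

Section Hall.
Local Open Scope nat_scope.
Variables (A B : finType) (b0 : B).
Implicit Types (X S : {set A}) (r : A -> B -> bool).

Definition nbs r S : {set B} := [set y | [exists x in S, r x y]].

(** Halmos-Vaughan induction: a nonempty proper subset with exactly as many neighbours splits the
    problem in two, and if there is none, any edge at [x0] can be put into the matching. *)
Lemma hall X r : (forall S, S \subset X -> #|S| <= #|nbs r S|) ->
  exists f : A -> B, {in X &, injective f} /\ {in X, forall x, r x (f x)}.
Proof.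
move: {2}#|X|.+1 (ltnSn #|X|) => n; elim: n X r => // n IH X r ltXn hallX.
have [->|/set0Pn[x0 x0X]] := eqVneq X set0.
  by exists (fun _ => b0); split=> [x y|x]; rewrite inE.
case: (boolP [exists S : {set A}, [&& S != set0, S \proper X & #|nbs r S| == #|S|]]).
  case/existsP=> S /and3P[S0 /properP[sSX [x1 x1X x1S]] /eqP cS].
  have [|S' sS'|f1 [inj1 r1]] := IH S r.
  - apply: leq_trans (_ : #|X| <= n); last by rewrite -ltnS.
    by apply: proper_card; apply/properP; split=> //; exists x1.
  - by apply: hallX; apply: subset_trans sS' sSX.
  pose r' x y := r x y && (y \notin nbs r S).
  have [|S' sS'|f2 [inj2 r2]] := IH (X :\: S) r'.
  - rewrite -ltnS; apply: leq_trans ltXn; rewrite ltnS cardsD (setIidPr sSX).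
    have : 0 < #|S| by rewrite card_gt0.
    by have := subset_leq_card sSX; lia.
  - have /hallX : S :|: S' \subset X.
      by rewrite subUset sSX; apply: subset_trans sS' (subsetDl _ _).
    have /eqP: S :&: S' == set0.
      by rewrite setI_eq0 disjoint_sym disjoints_subset (subset_trans sS') // setDE subsetIr.
    rewrite cardsU => ->; rewrite cards0 subn0.
    have sN : nbs r (S :|: S') \subset nbs r S :|: nbs r' S'.
      apply/subsetP=> y; rewrite inE => /exists_inP[x /setUP[xS|xS'] rxy].
        by rewrite inE; apply/orP; left; rewrite inE; apply/exists_inP; exists x.
      rewrite inE; case: (boolP (y \in nbs r S)) => //= yS.
      by rewrite inE; apply/exists_inP; exists x => //; rewrite /r' rxy.
    have := subset_leq_card sN; have := (leq_card_setU (nbs r S) (nbs r' S')).1; lia.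
  exists (fun x => if x \in S then f1 x else f2 x); split=> [x y xX yX|x xX].
    have out z : z \in X -> z \notin S -> f2 z \notin nbs r S.
      by move=> zX zS; have := r2 z; rewrite inE zX zS => /(_ isT)/andP[].
    have inn z : z \in S -> f1 z \in nbs r S.
      by move=> zS; rewrite inE; apply/exists_inP; exists z => //; apply: r1.
    case: ifPn => xS; case: ifPn => yS.
    - exact: inj1.
    - by move=> eqf; have := out y yX yS; rewrite -eqf inn.
    - by move=> eqf; have := out x xX xS; rewrite eqf inn.
    - by apply: inj2; rewrite inE ?xS ?yS.
  case: ifPn => xS; first exact: r1.
  by have := r2 x; rewrite inE xX xS => /(_ isT)/andP[].
rewrite negb_exists => /forallP noS.
have [y ry] : exists y, r x0 y.
  have := hallX [set x0]; rewrite sub1set x0X cards1 => /(_ isT)/card_gt0P[y].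
  by rewrite inE => /exists_inP[x /set1P ->]; exists y.
pose r' x z := r x z && (z != y).
have [|S sS|f [injf rf]] := IH (X :\ x0) r'.
- by move: ltXn; rewrite (cardsD1 x0) x0X.
- have [->|S0] := eqVneq S set0; first by rewrite cards0.
  have pS : S \proper X.
    apply/properP; split; first by apply: subset_trans sS (subsetDl _ _).
    by exists x0 => //; apply/negP=> /(subsetP sS); rewrite !inE eqxx.
  have := noS S; rewrite S0 pS /= => nS; have := hallX S (proper_sub pS).
  rewrite leq_eqVlt eq_sym (negPf nS) /=.
  suff : #|nbs r S| <= 1 + #|nbs r' S| by lia.
  rewrite -(cards1 y); apply: leq_trans (leq_card_setU _ _).1.
  apply/subset_leq_card/subsetP=> z; rewrite inE => /exists_inP[x xS rxz].
  rewrite inE in_set1; case: eqVneq => //= zy; rewrite inE.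
  by apply/exists_inP; exists x => //; rewrite /r' rxz.
exists (fun x => if x == x0 then y else f x); split=> [x z xX zX|x xX].
  have ny u : u \in X -> u != x0 -> f u != y.
    by move=> uX ux; have := rf u; rewrite !inE uX ux => /(_ isT)/andP[].
  case: eqVneq => [->|xx0]; case: eqVneq => [->|zx0] //.
  - by move=> eqf; have := ny z zX zx0; rewrite -eqf eqxx.
  - by move=> eqf; have := ny x xX xx0; rewrite eqf eqxx.
  - by apply: injf; rewrite !inE ?xx0 ?zx0.
case: eqVneq => [->//|xx0].
by have := rf x; rewrite !inE xX xx0 => /(_ isT)/andP[].
Qed.

End Hall.

Definition edges (A B : finType) (E : A -> B -> bool) (S : {set A}) (W : {set B}) :
  {set A * B} := [set e | [&& e.1 \in S, e.2 \in W & E e.1 e.2]].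

(** * Hall violators in a random sparsification *)

Section SparseHall.
Variables (R : realFieldType) (A B T : finType) (b0 : B) (p : R).
Hypothesis p01 : 0 <= p <= 1.
Variables (X : {set A}) (Y : {set B}) (E free : A -> B -> bool) (tau : A -> B -> T).
Variable D : {set T}.
Hypothesis tauD : forall x y, x \in X -> y \in Y -> E x y -> ~~ free x y -> tau x y \in D.
Hypothesis tau_inj : forall x y x' y', x \in X -> y \in Y -> E x y ->
  x' \in X -> y' \in Y -> E x' y' -> ~~ free x y -> ~~ free x' y' ->
  tau x y = tau x' y' -> x = x' /\ y = y'.

(** An edge in [free] costs nothing, which is how pairs containing a dummy are treated; any other
    edge needs the presence of its triangle [tau x y]. *)
Definition avail (S : {set T}) x y := [&& y \in Y, E x y & free x y || (tau x y \in S)].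


Definition deficient (S : {set A}) (U : {set B}) : bool :=
  [&& S \subset X, U \subset Y & #|U| < #|S|]%N.

Definition saturated (S : {set T}) : Prop :=
  exists f : A -> B, {in X &, injective f} /\ {in X, forall x, avail S x (f x)}.

Lemma sparse_hall :
  1 - \sum_(P : {set A} * {set B} | deficient P.1 P.2) (1 - p) ^+ #|edges E P.1 (Y :\: P.2)|
    <= pr p D (fun S => `[< saturated S >]).
Proof.
have /andP[p0 p1] := p01.
rewrite prC // lerD2l lerN2.
pose Bad (P : {set A} * {set B}) (S : {set T}) :=
  [forall e in edges E P.1 (Y :\: P.2), ~~ avail S e.1 e.2].
apply: le_trans (_ : _ <= pr p D (fun S => [exists (P : {set A} * {set B} | deficient P.1 P.2), Bad P S])) _.
  apply: le_pr => // S _ /= /asboolP nsat; apply/exists_inP.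
  have : ~ (forall S' : {set A}, S' \subset X -> #|S'| <= #|nbs (avail S) S'|)%N.
    by move=> h; apply: nsat; apply: hall.
  move=> /existsNP[S' /not_implyP[sS' /negP]]; rewrite -ltnNge => ltN.
  exists (S', nbs (avail S) S') => /=.
    rewrite /deficient sS' ltN andbT /=; apply/subsetP=> y.
    by rewrite inE => /exists_inP[x _ /and3P[]].
  apply/forall_inP=> -[x y] /=; rewrite inE /= => /and3P[xS' /setDP[yY /negP yN] Exy].
  by apply/negP=> av; apply: yN; rewrite inE; apply/exists_inP; exists x.
apply: le_trans (pr_exists p01 _ _ _) _; apply: ler_sum => -[S U] /= /and3P[sSX sUY _].
case: (boolP [exists e in edges E S (Y :\: U), free e.1 e.2]) => [/exists_inP[e eC fe]|].
  rewrite (_ : pr _ _ _ = 0) ?exprn_ge0 ?subr_ge0 // /pr big_pred0 // => W.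
  apply/negP=> /andP[_ /forall_inP/(_ e eC)]; rewrite /avail fe andbT.
  by move: eC; rewrite inE => /and3P[_ /setDP[-> _] ->].
rewrite negb_exists => /forallP nfree.
have nf e : e \in edges E S (Y :\: U) -> ~~ free e.1 e.2.
  by move=> eC; have := nfree e; rewrite eC.
have crE e : e \in edges E S (Y :\: U) -> [/\ e.1 \in X, e.2 \in Y & E e.1 e.2].
  by rewrite inE => /and3P[eS /setDP[eY _] ->]; rewrite (subsetP sSX _ eS) eY.
pose tau2 (e : A * B) := tau e.1 e.2.
have inj2 : {in edges E S (Y :\: U) &, injective tau2}.
  move=> [x y] [x' y'] eC eC' /= teq; have [/= xX yY xy] := crE _ eC.
  have [/= xX' yY' xy'] := crE _ eC'.
  by have [-> ->] := tau_inj xX yY xy xX' yY' xy' (nf _ eC) (nf _ eC') teq.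
rewrite -(card_in_imset inj2) -(pr_disjoint p (D := D)); last first.
  by apply/subsetP=> _ /imsetP[e eC ->]; have [? ? ?] := crE e eC; apply: tauD => //; apply: nf.
apply: le_pr => // W _ /forall_inP nav; apply/pred0P=> t /=; apply/negP=> /andP[].
case/imsetP=> e eC -> tW; have := nav e eC; rewrite /avail -/(tau2 e) tW orbT.
by have [_ -> ->] := crE e eC.
Qed.

End SparseHall.

(** The union bound is grouped by the level [j = x i %/ d]: at most [L ^ j] terms, each at most
    [q ^+ (d * j)], so a level contributes at most [(L * q ^+ d) ^+ j <= e], and there are [N]
    levels. *)
Lemma sum_expr_by_level (R : realFieldType) (I : finType) (P : pred I) (x : I -> nat)
    (q e : R) (d L N : nat) :
  (0 < d)%N -> 0 <= q <= 1 -> e <= 1 -> L%:R * q ^+ d <= e ->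
  (forall i, P i -> d <= x i <= N * d)%N ->
  (forall j, (0 < j)%N -> #|[pred i | P i & (x i %/ d == j)%N]| <= L ^ j)%N ->
  \sum_(i | P i) q ^+ x i <= e *+ N.
Proof.
move=> d0 /andP[q0 q1] e1 Lq xb cb.
have e0 : 0 <= e by apply: le_trans Lq; rewrite mulr_ge0 ?exprn_ge0.
have -> : \sum_(i | P i) q ^+ x i =
    \sum_(1 <= j < N.+1) \sum_(i | P i && (x i %/ d == j)%N) q ^+ x i.
  rewrite (exchange_big_dep P) //=; last by move=> j i _ /andP[].
  apply: eq_bigr => i Pi; have /andP[dx xN] := xb i Pi.
  under eq_bigl => j do rewrite Pi /= eq_sym.
  rewrite big_nat1_eq divn_gt0 // dx ltnS.
  by rewrite (leq_trans (leq_div2r d xN)) // mulnK.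
have -> : e *+ N = \sum_(1 <= j < N.+1) e by rewrite sumr_const_nat subn1.
apply: ler_sum_nat => j /andP[j0 _].
apply: le_trans (_ : \sum_(i | P i && (x i %/ d == j)%N) (q ^+ d) ^+ j <= _).
  apply: ler_sum => i /andP[_ /eqP <-]; rewrite -exprM.
  by apply: ler_wiXn2l => //; rewrite mulnC leq_trunc_div.
rewrite sumr_const -[_ *+ _]mulr_natl.
apply: le_trans (_ : (L%:R * q ^+ d) ^+ j <= _).
  rewrite exprMn ler_wpM2r ?exprn_ge0 // -natrX ler_nat.
  by apply: leq_trans (cb j j0); apply: eq_leq; apply: eq_card => i; rewrite !inE.
case: j j0 => // j _; rewrite exprS; apply: le_trans (_ : e * 1 <= _); last by rewrite mulr1.
have z0 : 0 <= L%:R * q ^+ d by rewrite mulr_ge0 ?exprn_ge0.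
apply: ler_pM => //; first exact: exprn_ge0.
by apply: exprn_ile1 => //; apply: le_trans Lq e1.
Qed.

Section Counting.
Local Open Scope nat_scope.

(** Each such set is read off a map from ['I_l] to [option A], with [None] as padding. *)
Lemma card_small_sets (A : finType) (l : nat) :
  #|[set S : {set A} | #|S| <= l]| <= #|A|.+1 ^ l.
Proof.
pose g (t : {ffun 'I_l -> option A}) : {set A} := [set x | Some x \in codom t].
rewrite -card_option -[X in _ ^ X](card_ord l) -card_ffun.
apply: leq_trans (leq_imset_card g _); apply/subset_leq_card/subsetP=> S.
rewrite inE => leSl; apply/imsetP.
exists [ffun i : 'I_l => nth None (map Some (enum S)) i] => //.
apply/setP=> x; rewrite inE; apply/idP/idP=> [xS|/codomP[i]].
  have ltl : index x (enum S) < l.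
    by apply: leq_trans leSl; rewrite cardE index_mem mem_enum.
  apply/codomP; exists (Ordinal ltl); rewrite ffunE (nth_map x) ?nth_index ?mem_enum //.
  by rewrite index_mem mem_enum.
rewrite ffunE; case: (ltnP i (size (enum S))) => iS.
  by rewrite (nth_map x) // => -[->]; rewrite -mem_enum mem_nth.
by rewrite nth_default // size_map.
Qed.

Lemma card_le_decode (A B : finType) (g : A -> B) (P : {set B}) (Q : {set A}) :
  (forall b, b \in P -> exists2 a, a \in Q & g a = b) -> #|P| <= #|Q|.
Proof.
move=> PQ; apply: leq_trans (leq_imset_card g Q).
by apply/subset_leq_card/subsetP=> b /PQ[a aQ <-]; apply: imset_f.
Qed.

Variables (A B : finType) (E : A -> B -> bool).

Lemma card_edges_l (S : {set A}) (W : {set B}) :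
  #|edges E S W| = \sum_(x in S) #|[set y in W | E x y]|.
Proof.
under [RHS]eq_bigr => x _ do rewrite -sum1_card.
rewrite pair_big_dep /= -sum1_card; apply: eq_bigl => -[x y] /=.
by rewrite !inE.
Qed.

Lemma card_edges_r (S : {set A}) (W : {set B}) :
  #|edges E S W| = \sum_(y in W) #|[set x in S | E x y]|.
Proof.
rewrite card_edges_l; under eq_bigr => x _ do rewrite -sum1_card.
under [RHS]eq_bigr => x _ do rewrite -sum1_card.
rewrite (exchange_big_dep (mem W)) /=; last by move=> x y _; rewrite inE => /andP[].
by apply: eq_bigr => y yW; apply: eq_bigl => x; rewrite !inE yW.
Qed.

Lemma edges_markov_l (c : nat) (S S' : {set A}) (W : {set B}) : S' \subset S ->
  (forall x, x \in S' -> c <= #|[set y in W | E x y]|) -> #|S'| * c <= #|edges E S W|.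
Proof.
move=> sS' cS'; rewrite card_edges_l -sum_nat_const.
apply: (@leq_trans (\sum_(x in S') #|[set y in W | E x y]|)); first exact: leq_sum.
rewrite [leqRHS](big_setID S') /= (setIidPr sS'); exact: leq_addr.
Qed.

Lemma edges_markov_r (c : nat) (S : {set A}) (W W' : {set B}) : W' \subset W ->
  (forall y, y \in W' -> c <= #|[set x in S | E x y]|) -> #|W'| * c <= #|edges E S W|.
Proof.
move=> sW' cW'; rewrite card_edges_r -sum_nat_const.
apply: (@leq_trans (\sum_(x in W') #|[set z in S | E z x]|)); first exact: leq_sum.
rewrite [leqRHS](big_setID W') /= (setIidPr sW'); exact: leq_addr.
Qed.

End Counting.

(** * Nearly complete bipartite graphs *)

Section Dense.
Variables (R : realFieldType) (A B T : finType) (b0 : B) (p : R).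
Hypothesis p01 : 0 <= p <= 1.
Variables (X : {set A}) (Y : {set B}) (E free : A -> B -> bool) (tau : A -> B -> T).
Variable D : {set T}.
Hypothesis tauD : forall x y, x \in X -> y \in Y -> E x y -> ~~ free x y -> tau x y \in D.
Hypothesis tau_inj : forall x y x' y', x \in X -> y \in Y -> E x y ->
  x' \in X -> y' \in Y -> E x' y' -> ~~ free x y -> ~~ free x' y' ->
  tau x y = tau x' y' -> x = x' /\ y = y'.
Variables (beta h : nat).
Hypotheses (cX : #|X| = beta) (cY : #|Y| = beta) (h_beta : (4 * h <= beta)%N).
Hypothesis beta4 : (4 <= beta)%N.
Hypothesis degX : forall x, x \in X -> (beta <= #|[set y in Y | E x y]| + h)%N.
Hypothesis degY : forall y, y \in Y -> (beta <= #|[set x in X | E x y]| + h)%N.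

(** The boundary is measured in units of [beta %/ 4]. If [S] has at most half of [X], each of its
    vertices sends at least [beta - h - #|U|], hence one unit, of edges out of [U], so [#|S| <= j].
    Otherwise the same holds for the vertices of [Y :\: U] towards [S]. Deficiency transfers the
    bound to the other side. *)
Lemma dense_expansion (P : {set A} * {set B}) (j : nat) :
  j = (#|edges E P.1 (Y :\: P.2)| %/ (beta %/ 4))%N -> deficient X Y P.1 P.2 ->
  (0 < j)%N /\ ((#|P.1| <= j) && (#|P.2| <= j) || (#|X :\: P.1| <= j) && (#|Y :\: P.2| <= j))%N.
Proof.
case: P => S U /= jE /and3P[sSX sUY ltUS].
have d0 : (0 < beta %/ 4)%N by rewrite divn_gt0.
have cSX := subset_leq_card sSX; have cUY := subset_leq_card sUY.
have [leS|gtS] := leqP (2 * #|S|) beta.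
  suff leSj : (#|S| <= j)%N by rewrite leSj; split; lia.
  rewrite jE leq_divRL //; apply: edges_markov_l => // x xS.
  have := degX (subsetP sSX x xS).
  have : (#|[set y in Y | E x y]| <= #|[set y in Y :\: U | E x y]| + #|U|)%N.
    apply: leq_trans (leq_card_setU _ _).1; apply/subset_leq_card/subsetP=> y.
    by rewrite !inE => /andP[-> ->]; case: (y \in U).
  lia.
have cSD : (#|X :\: S| = beta - #|S|)%N by rewrite cardsD (setIidPr sSX) cX.
have cUD : (#|Y :\: U| = beta - #|U|)%N by rewrite cardsD (setIidPr sUY) cY.
suff leSj : (#|Y :\: U| <= j)%N by rewrite leSj; split; lia.
rewrite jE leq_divRL //; apply: edges_markov_r => // y /setDP[yY _].
have := degY yY.
have : (#|[set x in X | E x y]| <= #|[set x in S | E x y]| + #|X :\: S|)%N.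
  apply: leq_trans (leq_card_setU _ _).1; apply/subset_leq_card/subsetP=> x.
  by rewrite !inE => /andP[-> ->]; case: (x \in S).
lia.
Qed.

(** A violator of level [j] is coded by one bit, telling whether the sets or their complements are
    small, and two sets of size at most [j]. *)
Lemma dense_count j : (0 < j)%N ->
  (#|[pred P : {set A} * {set B} | deficient X Y P.1 P.2
      & (#|edges E P.1 (Y :\: P.2)| %/ (beta %/ 4) == j)]|
    <= (2 * (#|A|.+1 * #|B|.+1)) ^ j)%N.
Proof.
move=> j0.
pose Q := setX [set: bool] (setX [set S : {set A} | #|S| <= j]%N [set U : {set B} | #|U| <= j]%N).
pose g (c : bool * ({set A} * {set B})) :=
  if c.1 then c.2 else (X :\: c.2.1, Y :\: c.2.2).
apply: (@leq_trans #|Q|); last first.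
  rewrite !cardsX cardsT card_bool expnMn; apply: leq_mul.
    by case: (j) j0 => // i _; rewrite expnS leq_pmulr // expn_gt0.
  by rewrite expnMn; apply: leq_mul; apply: card_small_sets.
rewrite -[X in (X <= _)%N]cardsE; apply: (card_le_decode (g := g)) => -[S U]; rewrite inE.
move=> /andP[dfc /eqP jE]; have [_] := dense_expansion (esym jE) dfc.
have /and3P[/= sSX sUY _] := dfc.
case/orP=> /andP[leS leU].
  by exists (true, (S, U)) => //; rewrite !inE leS leU.
exists (false, (X :\: S, Y :\: U)); first by rewrite !inE leS leU.
by rewrite /g /= !setDDr !setDv !set0U (setIidPr sSX) (setIidPr sUY).
Qed.

Lemma dense_matching (e : R) : e <= 1 ->
  (2 * (#|A|.+1 * #|B|.+1))%:R * (1 - p) ^+ (beta %/ 4) <= e ->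
  1 - e *+ (7 * beta) <= pr p D (fun S => `[< saturated X Y E free tau S >]).
Proof.
move=> e1 qe; have /andP[p0 p1] := p01.
apply: le_trans (sparse_hall b0 p01 tauD tau_inj); rewrite lerD2l lerN2.
apply: (@sum_expr_by_level _ _ _ _ _ _ (beta %/ 4) (2 * (#|A|.+1 * #|B|.+1))) => //.
- by rewrite divn_gt0.
- by rewrite subr_ge0 p1 lerBlDr lerDl.
- move=> P dfc; have [j0 _] := dense_expansion erefl dfc; apply/andP; split.
    by move: j0; rewrite divn_gt0 // divn_gt0.
  (* The factor 7 of the number of levels: [beta <= 7 * (beta %/ 4)] as soon as [beta >= 4]. *)
  apply: (@leq_trans (#|X| * #|Y|)); last by rewrite cX cY; nia.
  rewrite -cardsX; apply/subset_leq_card/subsetP=> -[x y]; rewrite !inE /=.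
  by case/and3P: dfc => sSX _ _ /and3P[/(subsetP sSX) -> /andP[_ ->]].
- by move=> j j0; apply: dense_count.
Qed.

End Dense.

(** * Regular bipartite graphs of linear degree *)

Section Regular.
Variables (A B : finType) (b0 : B) (X : {set A}) (Y : {set B}) (E : A -> B -> bool) (d : nat).
Hypotheses (cXY : #|X| = #|Y|) (d_gt0 : (0 < d)%N).
Hypothesis degX : forall x, x \in X -> #|[set y in Y | E x y]| = d.
Hypothesis degY : forall y, y \in Y -> #|[set x in X | E x y]| = d.

Local Notation nb x := [set y in Y | E x y].
Local Notation cut P := (edges E P.1 (Y :\: P.2)).

(** Adding the edges between [S] and [U] to the two boundaries gives [d * #|U|] and [d * #|S|]
    respectively. *)
Lemma regular_balance (S : {set A}) (U : {set B}) : S \subset X -> U \subset Y ->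
  (#|edges E (X :\: S) U| + d * #|S| = #|edges E S (Y :\: U)| + d * #|U|)%N.
Proof.
move=> sSX sUY.
have eS : (#|edges E S Y| = d * #|S|)%N.
  rewrite card_edges_l mulnC -sum_nat_const; apply: eq_bigr => x xS.
  by rewrite degX // (subsetP sSX).
have eU : (#|edges E X U| = d * #|U|)%N.
  rewrite card_edges_r mulnC -sum_nat_const; apply: eq_bigr => y yU.
  by rewrite degY // (subsetP sUY).
have -> : (d * #|S| = #|edges E S U| + #|edges E S (Y :\: U)|)%N.
  rewrite -eS !card_edges_r [LHS](big_setID U) /= (setIidPr sUY); congr (_ + _)%N.
have -> : (d * #|U| = #|edges E S U| + #|edges E (X :\: S) U|)%N.
  rewrite -eU !card_edges_l [LHS](big_setID S) /= (setIidPr sSX); congr (_ + _)%N.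
lia.
Qed.

Lemma regular_perfect_matching :
  exists f : A -> B, {in X &, injective f} /\ {in X, forall x, (f x \in Y) && E x (f x)}.
Proof.
apply: (@hall _ _ b0 X (fun x y => (y \in Y) && E x y)) => S sSX; rewrite leqNgt; apply/negP=> ltN.
set N := nbs _ S in ltN.
have sN : N \subset Y by apply/subsetP=> y; rewrite inE => /exists_inP[x _ /andP[]].
have := regular_balance sSX sN.
rewrite (_ : edges E S (Y :\: N) = set0) ?cards0; first by nia.
apply/setP=> -[x y]; rewrite !inE /=; apply/negP=> /and3P[xS /andP[/negP nN yY] Exy].
by apply: nN; apply/exists_inP; exists x; rewrite ?yY.
Qed.

Variable Lam : nat.
Hypotheses (leXd : (#|X| <= Lam * d)%N) (Lam_gt0 : (0 < Lam)%N).

Let Ncup (F : {set A}) : {set B} := [set y in Y | [exists x in F, E x y]].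

(* The code of a deficient pair: [S] is, up to few exceptions, the set of vertices with most of their
   neighbours in the joint neighbourhood of boundedly many vertices of [S], and [U] is, up to few
   exceptions, the set of vertices with at least half of their neighbours in [S]. *)
Let decode (c : ({set A} * ({set A} * {set A})) * ({set B} * {set B})) : {set A} * {set B} :=
  let S := [set x in X | 3 * d <= 4 * #|nb x :&: Ncup c.1.1|]%N :\: c.1.2.1 :|: c.1.2.2 in
  (S, [set y in Y | d <= 2 * #|[set x in S | E x y]|]%N :\: c.2.1 :|: c.2.2).

(** Let [x] and [x'] count the edges from [S] to [Y :\: U] and from [X :\: S] to [U]. Balance and
    deficiency give [x' + d <= x], so [j > 0] and both are below [2 * j * d]. A vertex misplaced by
    the decoding accounts for at least half of [d] of these edges, which allows [4 * j] errors of
    each kind; only a vertex of [S] that is not [good] accounts for less, more than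
    [d / (16 * Lam)], which allows [32 * Lam * j]. *)
Lemma regular_decode (P : {set A} * {set B}) (j : nat) :
  j = (#|cut P| %/ d)%N -> deficient X Y P.1 P.2 ->
  (0 < j)%N /\ exists F Q1 Q2 Q3 Q4,
  [/\ decode ((F, (Q1, Q2)), (Q3, Q4)) = P, (#|F| <= 4 * Lam)%N, (#|Q1| <= 4 * j)%N,
      (#|Q2| <= 32 * Lam * j)%N & (#|Q3| <= 4 * j)%N /\ (#|Q4| <= 4 * j)%N].
Proof.
case: P => S U /= jE /and3P[sSX sUY ltUS].
have bal := regular_balance sSX sUY.
set x := #|edges E S (Y :\: U)| in jE bal; set x' := #|edges E (X :\: S) U| in bal.
have x'x : (x' + d <= x)%N by nia.
have j0 : (0 < j)%N by rewrite jE divn_gt0 //; lia.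
have xj : (x < 2 * j * d)%N.
  by have := divn_eq x d; have := ltn_pmod x d_gt0; rewrite -jE; nia.
split=> //.
(* [F] will be a maximal set of good vertices whose joint neighbourhood has at least [#|F| * d / 4]
   elements. As [#|Y| <= Lam * d], it has at most [4 * Lam] elements, so by goodness its
   neighbourhood leaves [U] in at most [d / 4] vertices. By maximality every good vertex of [S] has
   at most [d / 4] neighbours outside it. *)
pose good s := (16 * Lam * #|nb s :\: U| <= d)%N.
pose sparse (F : {set A}) := [&& F \subset [set s in S | good s] & #|F| * d <= 4 * #|Ncup F|]%N.
have : exists F, maxset sparse F.
  have [|F mF _] := @maxset_exists _ sparse set0; last by exists F.
  by rewrite /sparse sub0set cards0 mul0n.
case=> F /maxsetP[/andP[sF cF] maxF].
have cF4 : (#|F| <= 4 * Lam)%N.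
  have : (#|Ncup F| <= #|Y|)%N by apply/subset_leq_card/subsetP=> y; rewrite inE => /andP[].
  by rewrite -(leq_pmul2r d_gt0); nia.
have FU : (4 * #|Ncup F :\: U| <= d)%N.
  have : (#|Ncup F :\: U| <= \sum_(s in F) #|nb s :\: U|)%N.
    have -> : (\sum_(s in F) #|nb s :\: U| = #|edges E F (Y :\: U)|)%N.
      rewrite card_edges_l; apply: eq_bigr => s _; apply: eq_card => y.
      by rewrite !inE andbA.
    rewrite -[leqLHS]muln1; apply: edges_markov_r.
      by apply: setSD; apply/subsetP=> y; rewrite inE => /andP[].
    move=> y; rewrite !inE => /andP[_ /andP[_ /exists_inP[s sF' Esy]]].
    by apply/card_gt0P; exists s; rewrite inE sF'.
  have : (16 * Lam * \sum_(s in F) #|nb s :\: U| <= #|F| * d)%N.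
    rewrite big_distrr -sum_nat_const /=; apply: leq_sum => s /(subsetP sF).
    by rewrite inE => /andP[].
  nia.
have extF s : s \in S -> good s -> (3 * d <= 4 * #|nb s :&: Ncup F|)%N.
  move=> sS gs; have sX := subsetP sSX s sS.
  have := cardsID (Ncup F) (nb s); rewrite degX // => cds.
  suff : (4 * #|nb s :\: Ncup F| <= d)%N by lia.
  have [sF'|sF'] := boolP (s \in F).
    rewrite (_ : nb s :\: Ncup F = set0) ?cards0 //; apply/setP=> y; rewrite !inE.
    apply/negP=> /andP[/negP nF /andP[yY Esy]]; apply: nF.
    by rewrite yY; apply/exists_inP; exists s.
  rewrite leqNgt; apply/negP=> gt; suff /maxF/(_ (subsetUr _ _)) eqF : sparse (s |: F).
    by move: sF'; rewrite -eqF setU11.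
  rewrite /sparse subUset sub1set inE sS gs sF /= cardsU1 sF' mulnDl mul1n.
  have : (#|nb s :\: Ncup F| + #|Ncup F| <= #|Ncup (s |: F)|)%N.
    have disj : (nb s :\: Ncup F) :&: Ncup F = set0.
      by apply/setP=> y; rewrite !inE; case: (y \in Y); case: [exists _ in _, _]; rewrite ?andbF.
    rewrite -cardsUI disj cards0 addn0.
    apply/subset_leq_card/subsetP=> y; rewrite !inE.
    case/orP=> [/andP[_ /andP[-> Esy]]|/andP[-> /exists_inP[z zF Ezy]]] /=.
      by apply/exists_inP; exists s; rewrite ?setU11.
    by apply/exists_inP; exists z; rewrite // inE zF orbT.
  lia.
pose Sstar := [set s in X | 3 * d <= 4 * #|nb s :&: Ncup F|]%N.
pose Ustar := [set y in Y | d <= 2 * #|[set s in S | E s y]|]%N.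
exists F, (Sstar :\: S), (S :\: Sstar), (Ustar :\: U), (U :\: Ustar).
have decS : Sstar :\: (Sstar :\: S) :|: (S :\: Sstar) = S.
  by rewrite setDDr setDv set0U setIC setID.
split=> //; last split.
- by rewrite /decode /= -/Sstar decS -/Ustar setDDr setDv set0U setIC setID.
- rewrite -(leq_pmul2r (_ : 0 < 2 * d)%N) ?muln_gt0 //.
  suff : (#|Sstar :\: S| * ((d + 1) %/ 2) <= x')%N by nia.
  apply: edges_markov_l; first by apply: setSD; apply/subsetP=> s; rewrite inE => /andP[].
  move=> s; rewrite !inE => /andP[nsS /andP[sX hs]].
  have : (#|nb s :&: Ncup F| <= #|[set y in U | E s y]| + #|Ncup F :\: U|)%N.
    apply: leq_trans (leq_card_setU _ _).1; apply/subset_leq_card/subsetP=> y.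
    by rewrite !inE => /andP[/andP[-> ->] ->]; case: (y \in U).
  lia.
- suff : (#|S :\: Sstar| * (d %/ (16 * Lam)).+1 <= x)%N.
    have := divn_eq d (16 * Lam); have : (0 < 16 * Lam)%N by lia.
    move=> /(ltn_pmod d); nia.
  apply: edges_markov_l; first exact: subsetDl.
  move=> s; rewrite !inE => /andP[ns sS].
  have : ~~ good s by apply: contra ns => gs; rewrite (subsetP sSX) //= extF.
  rewrite /good -ltnNge => gt; rewrite ltn_divLR ?muln_gt0 // mulnC.
  apply: leq_trans gt _; rewrite leq_mul2l; apply/orP; right.
  by apply/subset_leq_card/subsetP=> y; rewrite !inE => /andP[-> /andP[-> ->]].
- suff : (#|Ustar :\: U| * ((d + 1) %/ 2) <= x)%N by nia.
  apply: edges_markov_r; first by apply: setSD; apply/subsetP=> s; rewrite inE => /andP[].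
  by move=> y; rewrite !inE => /andP[_ /andP[_ ?]]; lia.
- suff : (#|U :\: Ustar| * ((d + 1) %/ 2) <= x')%N by nia.
  apply: edges_markov_r; first exact: subsetDl.
  move=> y; rewrite !inE => /andP[nU yU]; move: nU; rewrite (subsetP sUY) //= -ltnNge => lt.
  have := degY (subsetP sUY _ yU).
  have : (#|[set x in X | E x y]| <= #|[set x in S | E x y]| + #|[set x in X :\: S | E x y]|)%N.
    apply: leq_trans (leq_card_setU _ _).1; apply/subset_leq_card/subsetP=> s.
    by rewrite !inE => /andP[-> ->]; case: (s \in S).
  lia.
Qed.

Let L := ((#|A|.+1 * #|B|.+1) ^ (40 * Lam))%N.

(** The exponent [40 * Lam] in [L] comes from [4 * Lam + 4 * j + 32 * Lam * j <= 40 * Lam * j], the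
    total size of the sets on the side of [A] in the code. *)
Lemma regular_count j : (0 < j)%N ->
  (#|[pred P : {set A} * {set B} | deficient X Y P.1 P.2 & (#|cut P| %/ d == j)]| <= L ^ j)%N.
Proof.
move=> j0.
pose small (C : finType) l := [set S : {set C} | #|S| <= l]%N.
pose Q := setX (setX (small A (4 * Lam)%N) (setX (small A (4 * j)%N) (small A (32 * Lam * j)%N)))
               (setX (small B (4 * j)%N) (small B (4 * j)%N)).
apply: (@leq_trans #|Q|).
  rewrite -[X in (X <= _)%N]cardsE; apply: (card_le_decode (g := decode)) => P; rewrite inE.
  move=> /andP[dfc /eqP jE].
  have [_ [F [Q1 [Q2 [Q3 [Q4 [decP cF c1 c2 [c3 c4]]]]]]]] := regular_decode (esym jE) dfc.
  by exists ((F, (Q1, Q2)), (Q3, Q4)); rewrite // !inE /= cF c1 c2 c3 c4.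
rewrite !cardsX /L.
have cs C l := @card_small_sets C l.
apply: (@leq_trans (#|A|.+1 ^ (4 * Lam) * (#|A|.+1 ^ (4 * j) * #|A|.+1 ^ (32 * Lam * j))
                   * (#|B|.+1 ^ (4 * j) * #|B|.+1 ^ (4 * j)))%N).
  by rewrite !leq_mul // cs.
rewrite -!expnD -expnM expnMn; apply: leq_mul; apply: leq_pexp2l => //; nia.
Qed.

Variables (R : realFieldType) (T : finType) (p : R).
Hypothesis p01 : 0 <= p <= 1.
Variables (free : A -> B -> bool) (tau : A -> B -> T) (D : {set T}).
Hypothesis tauD : forall x y, x \in X -> y \in Y -> E x y -> ~~ free x y -> tau x y \in D.
Hypothesis tau_inj : forall x y x' y', x \in X -> y \in Y -> E x y ->
  x' \in X -> y' \in Y -> E x' y' -> ~~ free x y -> ~~ free x' y' ->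
  tau x y = tau x' y' -> x = x' /\ y = y'.

Lemma regular_matching (e : R) : e <= 1 -> L%:R * (1 - p) ^+ d <= e ->
  1 - e *+ #|X| <= pr p D (fun S => `[< saturated X Y E free tau S >]).
Proof.
move=> e1 qe; have /andP[p0 p1] := p01.
apply: le_trans (sparse_hall b0 p01 tauD tau_inj); rewrite lerD2l lerN2.
apply: (@sum_expr_by_level _ _ _ _ _ _ d L) => //.
- by rewrite subr_ge0 p1 lerBlDr lerDl.
- move=> P dfc; have [j0 _] := regular_decode erefl dfc; apply/andP; split.
    by move: j0; rewrite divn_gt0.
  apply: (@leq_trans #|edges E X Y|).
    apply/subset_leq_card/subsetP=> -[x y]; rewrite !inE /=.
    by case/and3P: dfc => sSX _ _ /and3P[/(subsetP sSX) -> /andP[_ ->]].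
  rewrite card_edges_l (eq_bigr (fun=> d)) ?sum_nat_const //.
- by move=> j j0; apply: regular_count.
Qed.

End Regular.

(** * Matchings between blocks *)

Section BipartiteInvolution.
Variables (Z : finType) (left : pred Z).

(** A perfect matching becomes an involution of all of [Z]: [f] on the left and its inverse on the
    right. In this form it no longer depends on which side was called left. *)
Lemma matching_involution (r : rel Z) (f : Z -> Z) :
  symmetric r -> #|[set z | left z]| = #|[set z | ~~ left z]| ->
  {in [set z | left z] &, injective f} ->
  {in [set z | left z], forall z, (f z \in [set z | ~~ left z]) && r z (f z)} ->
  exists g : {ffun Z -> Z}, involutive g /\ forall z, r z (g z).
Proof.
move=> rsym cXY injf fP.
have imf : f @: [set z | left z] = [set z | ~~ left z].
  apply/eqP; rewrite eqEcard card_in_imset // cXY leqnn andbT.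
  by apply/subsetP=> _ /imsetP[z zX ->]; have /andP[] := fP z zX.
pose g z := if left z then f z else odflt z [pick x | left x && (f x == z)].
have gl z : left z -> g z = f z by rewrite /g => ->.
have gr z : ~~ left z -> left (g z) /\ f (g z) = z.
  move=> nz; rewrite /g (negPf nz); case: pickP => [x /andP[lx /eqP //]|noX].
  have : z \in f @: [set z | left z] by rewrite imf inE.
  by case/imsetP=> x; rewrite inE => lx zE; have := noX x; rewrite lx zE eqxx.
have fl z : left z -> ~~ left (f z) /\ r z (f z).
  by move=> lz; have := fP z; rewrite !inE lz => /(_ isT)/andP[].
exists (finfun g); split=> z; rewrite !ffunE.
  have [lz|nz] := boolP (left z); last by have [lg fg] := gr z nz; rewrite gl.
  rewrite (gl z lz); have [nfz _] := fl z lz; have [lg fg] := gr _ nfz.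
  by apply: injf; rewrite ?inE.
have [lz|nz] := boolP (left z); first by rewrite gl //; have [] := fl z lz.
have [lg fg] := gr z nz; rewrite -{1}fg rsym; by have [] := fl _ lg.
Qed.

Variables (E : rel Z) (d : nat).
Hypotheses (Esym : symmetric E) (d_gt0 : (0 < d)%N).
Hypothesis Eleft : forall x y, E x y -> left x = ~~ left y.
Hypothesis degE : forall x, #|[set y | E x y]| = d.

Let X := [set z | left z].
Let Y := [set z | ~~ left z].

Lemma bip_degX x : x \in X -> #|[set y in Y | E x y]| = d.
Proof.
rewrite inE => lx; rewrite -(degE x); apply: eq_card => y; rewrite !inE.
by case Exy: (E x y); rewrite ?andbF // -(Eleft Exy) lx.
Qed.

Lemma bip_degY y : y \in Y -> #|[set x in X | E x y]| = d.
Proof.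
rewrite inE => ly; rewrite -(degE y); apply: eq_card => x; rewrite !inE (Esym y x).
by case Exy: (E x y); rewrite ?andbF // (Eleft Exy) ly.
Qed.

Lemma bip_card : #|X| = #|Y|.
Proof.
apply/eqP; rewrite -(eqn_pmul2r d_gt0) -!sum_nat_const; apply/eqP.
rewrite -(eq_bigr _ bip_degX) -(eq_bigr _ bip_degY).
by rewrite -card_edges_l card_edges_r.
Qed.

Lemma regular_involution :
  exists g : {ffun Z -> Z}, involutive g /\ forall z, E z (g z).
Proof.
have [z0 _|noZ] := pickP (@predT Z); last first.
  by exists (finfun id); split=> z; have := noZ z.
have [f [injf fP]] := regular_perfect_matching z0 bip_card d_gt0 bip_degX bip_degY.
exact: matching_involution Esym bip_card injf fP.
Qed.

Variables (R : realFieldType) (p : R) (T : finType).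
Hypothesis p01 : 0 <= p <= 1.
Variables (free : rel Z) (tau : Z -> Z -> T) (D : {set T}) (Lam : nat).
Hypotheses (free_sym : symmetric free) (tau_sym : forall x y, tau x y = tau y x).
Hypothesis tauD : forall x y, E x y -> ~~ free x y -> tau x y \in D.
Hypothesis tau_inj : forall x y x' y', left x -> E x y -> left x' -> E x' y' ->
  ~~ free x y -> ~~ free x' y' -> tau x y = tau x' y' -> x = x' /\ y = y'.
Hypotheses (Lam_gt0 : (0 < Lam)%N) (leZ : (#|Z| <= Lam * d)%N).

Lemma regular_involution_pr (e : R) : 0 <= e <= 1 ->
  ((#|Z|.+1 * #|Z|.+1) ^ (40 * Lam))%:R * (1 - p) ^+ d <= e ->
  1 - e *+ #|Z| <= pr p D (fun S => `[< exists g : {ffun Z -> Z},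
    involutive g /\ forall z, E z (g z) && (free z (g z) || (tau z (g z) \in S)) >]).
Proof.
move=> /andP[e0 e1] qe.
have [z0 _|noZ] := pickP (@predT Z); last first.
  rewrite (@eq_pr _ _ _ _ _ predT) ?pr_predT; first by rewrite gerBl mulrn_wge0.
  by move=> S _; apply/asboolP; exists (finfun id); split=> z; have := noZ z.
have leX : (#|X| <= #|Z|)%N by apply: max_card.
apply: (@le_trans _ _ (1 - e *+ #|X|)); first by rewrite lerD2l lerN2 ler_wpMn2l.
apply: le_trans (regular_matching (tau := tau) (free := free) (D := D) (Lam := Lam)
          z0 bip_card d_gt0 bip_degX bip_degY _ Lam_gt0 p01 _ _ e1 qe) _.
- exact: leq_trans leX leZ.
- by move=> x y _ _; apply: tauD.
- by move=> x y x' y'; rewrite !inE => lx _ Exy lx' _ Exy'; apply: tau_inj.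
apply: le_pr => // S _ /asboolP[f [injf fP]]; apply/asboolP.
apply: (@matching_involution (fun x y => E x y && (free x y || (tau x y \in S))) f) => //.
- by move=> x y /=; rewrite Esym free_sym tau_sym.
- exact: bip_card.
Qed.

End BipartiteInvolution.

(* Vertices are grouped in blocks indexed by [K] and labelled by ['I_b] inside each block; since
   [x + x = 0] in [K], round [g] pairs block [u] with block [u + g]. *)
Section Families.
Variables (K : finZmodType) (b : nat).
Hypothesis Kxx : forall x : K, x + x = 0.
Local Notation Z := (K * 'I_b)%type.

Definition shift_family (g : K) (fs : seq {ffun Z -> Z}) : Prop :=
  [/\ forall f, f \in fs -> involutive f,
      forall f, f \in fs -> forall z, (f z).1 = z.1 + g
    & forall z, uniq [seq (f : {ffun Z -> Z}) z | f <- fs]].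

Definition unused g (fs : seq {ffun Z -> Z}) : rel Z :=
  fun z z' => (z'.1 == z.1 + g) && (z' \notin [seq (f : {ffun Z -> Z}) z | f <- fs]).

(** The two paired blocks play symmetric roles, so their order in the enumeration of [K] decides
    which one is the left side. *)
Definition round_left (g : K) : pred Z :=
  fun z => (enum_rank z.1 < enum_rank (z.1 + g)%R)%N.

Lemma addKK (x g : K) : x + g + g = x.
Proof. by rewrite -addrA Kxx addr0. Qed.

Lemma card_block (u : K) : #|[set z : Z | z.1 == u]| = b.
Proof.
rewrite (_ : [set _ | _] = [set (u, l) | l : 'I_b]).
  by rewrite card_imset ?card_ord // => l l' [].
apply/setP=> -[v l]; rewrite inE /=; apply/eqP/imsetP => [->|[l' _ [-> _]]//].
by exists l.
Qed.

Section OneRound.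
Variables (g : K) (fs : seq {ffun Z -> Z}).
Hypotheses (g0 : g != 0) (famP : shift_family g fs).

Lemma unused_sym : symmetric (unused g fs).
Proof.
have [inv sh _] := famP; move=> z z'; rewrite /unused; congr (_ && _).
  by apply/eqP/eqP => ->; rewrite addKK.
congr (~~ _); apply/mapP/mapP => -[f fin ->]; exists f => //; by rewrite inv.
Qed.

Lemma round_left_shift z z' : z'.1 = z.1 + g -> round_left g z = ~~ round_left g z'.
Proof.
move=> z'E; rewrite /round_left z'E addKK -leqNgt [RHS]leq_eqVlt.
rewrite orb_idl // => /eqP/val_inj/enum_rank_inj/eqP.
by rewrite -subr_eq0 opprD addNKr oppr_eq0 (negPf g0).
Qed.

Lemma unused_deg z : #|[set z' | unused g fs z z']| = (b - size fs)%N.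
Proof.
have [_ sh uq] := famP.
set us := [seq (f : {ffun Z -> Z}) z | f <- fs].
rewrite (_ : [set _ | _] = [set z' : Z | z'.1 == z.1 + g] :\: [set z' in us]); last first.
  by apply/setP=> z'; rewrite !inE andbC.
rewrite cardsD card_block (setIidPr _); last first.
  by apply/subsetP=> z'; rewrite !inE => /mapP[f /sh fz ->]; rewrite fz.
by rewrite cardsE (card_uniqP (uq z)) size_map.
Qed.

Lemma family_cons (f : {ffun Z -> Z}) :
  involutive f -> (forall z, unused g fs z (f z)) -> shift_family g (f :: fs).
Proof.
have [inv sh uq] := famP; move=> fI fE; split=> [f'|f'|z].
- by rewrite inE => /predU1P[->|/inv].
- rewrite inE => /predU1P[->|/sh//] z.
  by have /andP[/eqP] := fE z.
- by rewrite /= uq andbT; have /andP[] := fE z.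
Qed.

End OneRound.

Lemma family_full g fs z z' : shift_family g fs -> size fs = b -> z'.1 = z.1 + g ->
  exists2 f, f \in fs & z' = (f : {ffun Z -> Z}) z.
Proof.
move=> famP szb z'E; have := unused_deg famP z; rewrite szb subnn => /cards0_eq/setP/(_ z').
by rewrite !inE /unused z'E eqxx /= => /negbFE/mapP.
Qed.

(** Removing perfect matchings from a regular bipartite graph keeps it regular, so the round can be
    exhausted. No triangle is involved yet: these extra matchings receive their colours later. *)
Lemma family_complete g fs : g != 0 -> shift_family g fs -> (size fs <= b)%N ->
  exists fs', shift_family g (fs' ++ fs) /\ size (fs' ++ fs) = b.
Proof.
move=> g0 famP; move: {2}(b - size fs)%N (erefl (b - size fs)%N) => n.
elim: n fs famP => [|n IH] fs famP szn lsz.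
  by exists [::]; split=> //=; lia.
have d0 : (0 < b - size fs)%N by rewrite szn.
have [f [fI fE]] := regular_involution (left := round_left g)
  (unused_sym famP) d0 (fun x y Exy => round_left_shift g0 (eqP (proj1 (andP Exy))))
  (unused_deg famP).
have [||fs' [fam' sz']] := IH (f :: fs) (family_cons famP fI fE); rewrite /=; try lia.
by exists (rcons fs' f); rewrite cat_rcons.
Qed.

End Families.

(** * Perfect matchings for the main colours *)

Section MainPass.
Variables (K : finZmodType) (b : nat).
Hypothesis Kxx : forall x : K, x + x = 0.
Local Notation Z := (K * 'I_b)%type.
Variables (Col T : finType) (real : pred Z) (cols : {set Col}) (tau : Z -> Z -> Col -> T).
Hypothesis tau_sym : forall z z' c, tau z z' c = tau z' z c.
Hypothesis tau_inj : forall z1 z2 c z1' z2' c', c \in cols -> c' \in cols ->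
  [&& real z1, real z2 & z1 != z2] -> [&& real z1', real z2' & z1' != z2'] ->
  tau z1 z2 c = tau z1' z2' c' -> c = c' /\ [set z1; z2] = [set z1'; z2'].

Definition tri (cs : {set Col}) : {set T} :=
  [set tau e.1.1 e.1.2 e.2 | e in [set e : Z * Z * Col |
     [&& real e.1.1, real e.1.2 & e.1.1 != e.1.2] && (e.2 \in cs)]].

Lemma mem_tri (cs : {set Col}) z z' c : [&& real z, real z' & z != z'] -> c \in cs -> tau z z' c \in tri cs.
Proof.
by move=> rz cc; apply/imsetP; exists (z, z', c); rewrite // inE rz.
Qed.

Lemma tri_disjoint (cs cs' : {set Col}) : cs \subset cols -> cs' \subset cols ->
  [disjoint cs & cs'] -> [disjoint tri cs & tri cs'].
Proof.
move=> sc sc' dis; apply/pred0P=> t /=; apply/negP=> /andP[].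
case/imsetP=> -[[z z'] c]; rewrite inE /= => /andP[rz cc] ->.
case/imsetP=> -[[z1 z1'] c1]; rewrite inE /= => /andP[rz1 cc1] /tau_inj[] //.
- exact: (subsetP sc).
- exact: (subsetP sc').
by move=> c1E _; have /pred0P/(_ c) := dis; rewrite /= cc c1E cc1.
Qed.

Variables (R : realFieldType) (p : R).
Hypothesis p01 : 0 <= p <= 1.
Variables (rd : Col -> K) (d0 Lam : nat) (e : R).
Hypotheses (d0_gt0 : (0 < d0)%N) (Lam_gt0 : (0 < Lam)%N) (leZ : (#|{: Z}| <= Lam * d0)%N).
Hypotheses (e01 : 0 <= e <= 1)
  (qe : ((#|{: Z}|.+1 * #|{: Z}|.+1) ^ (40 * Lam))%:R * (1 - p) ^+ d0 <= e).

Definition rounds (F : Col -> {ffun Z -> Z}) (cs : seq Col) (g : K) :=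
  [seq F c | c <- cs & rd c == g].

Definition main_ok (cs : seq Col) (F : Col -> {ffun Z -> Z}) (S : {set T}) : Prop :=
  (forall g : K, shift_family g (rounds F cs g)) /\
  (forall c z, c \in cs -> real z -> real (F c z) -> tau z (F c z) c \in S).

Lemma main_pass (cs : seq Col) : uniq cs -> {subset cs <= cols} ->
  (forall c, c \in cs -> rd c != 0) ->
  (forall g : K, count (fun c => rd c == g) cs + d0 <= b)%N ->
  1 - e *+ #|{: Z}| *+ size cs
    <= pr p (tri [set c in cs]) (fun S => `[< exists F, main_ok cs F S >]).
Proof.
have /andP[p0 p1] := p01; have /andP[e0 e1] := e01.
elim: cs => [|c cs IH] /=.
  move=> _ _ _ _; rewrite mulr0n subr0 (@eq_pr _ _ _ _ _ predT) ?pr_predT // => S _.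
  by apply/asboolP; exists (fun=> finfun id); split=> // g; split.
move=> /andP[ccs uq] scs rd0 crd.
have cc : c \in cols by apply: scs; rewrite mem_head.
have triE : tri [set c' in c :: cs] = tri [set c' in cs] :|: tri [set c].
  apply/setP=> t; rewrite in_setU; apply/imsetP/orP.
    move=> [[[z z'] c']]; rewrite !inE /= => /andP[rz /predU1P[->|cin]] ->.
      by right; apply: mem_tri; rewrite ?inE.
    by left; apply: mem_tri; rewrite ?inE.
  by case=> /imsetP[[[z z'] c']]; rewrite !inE /= => /andP[rz cin] ->;
    exists (z, z', c'); rewrite // !inE rz cin ?orbT.
rewrite triE mulrS opprD addrA addrAC.
have scs' c' : c' \in cs -> c' \in cols by move=> h; apply: scs; rewrite inE h orbT.
apply: (pr_step_subr p01 (A := fun S => `[< exists F, main_ok cs F S >])); rewrite ?mulrn_wge0 //.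
- apply: tri_disjoint; rewrite ?sub1set //.
    by apply/subsetP=> c'; rewrite inE; apply: scs'.
  by rewrite disjoint_sym disjoints_subset sub1set !inE.
- apply: IH => // [c' cin|g]; first by apply: rd0; rewrite inE cin orbT.
  by have := crd g; clear; lia.
move=> S1 _ /asboolP[F [famF FS]].
set g := rd c; have g0 : g != 0 by apply: rd0; rewrite mem_head.
set fs := rounds F cs g; have famg : shift_family g fs by apply: famF.
have szfs : (size fs + d0 < b)%N.
  have := crd g; rewrite eqxx /fs size_map size_filter; clear; lia.
have d0d : (d0 <= b - size fs)%N by move: szfs; clear; lia.
apply: le_trans (regular_involution_pr (left := round_left g) (E := unused g fs)
  (d := b - size fs) (free := fun z z' => ~~ (real z && real z')) (Lam := Lam)
  (tau := fun z z' => tau z z' c) (D := tri [set c]) _ _ _ _ p01 _ _ _ _ Lam_gt0 _ e01 _) _.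
- exact: unused_sym.
- exact: leq_trans d0_gt0 d0d.
- by move=> x y /andP[/eqP xy _]; apply: round_left_shift.
- exact: unused_deg.
- by move=> x y /=; rewrite andbC.
- by move=> x y; apply: tau_sym.
- move=> x y /andP[/eqP yE _]; rewrite negbK => /andP[rx ry].
  apply: mem_tri; rewrite ?set11 // rx ry /=; apply/eqP=> xy.
  by move: yE; rewrite xy -[LHS]addr0 => /addrI/esym/eqP; rewrite (negPf g0).
- move=> x y x' y' lx Exy lx' Exy'; rewrite !negbK => /andP[rx ry] /andP[rx' ry'].
  have ne u v : unused g fs u v -> u != v.
    case/andP=> /eqP vE _; apply/eqP=> uv.
    by move: vE; rewrite uv -[LHS]addr0 => /addrI/esym/eqP; rewrite (negPf g0).
  case/tau_inj; rewrite ?rx ?ry ?rx' ?ry' ?ne // => _ eqs.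
  have ly : round_left g y = false.
    by apply/negbTE; case/andP: Exy => /eqP h _; rewrite -(round_left_shift Kxx g0 h).
  have ly' : round_left g y' = false.
    by apply/negbTE; case/andP: Exy' => /eqP h _; rewrite -(round_left_shift Kxx g0 h).
  have /set2P[xx|xy'] : x \in [set x'; y'] by rewrite -eqs set21.
    split=> //; have /set2P[yx|//] : y \in [set x'; y'] by rewrite -eqs set22.
    by move: ly; rewrite yx lx'.
  by move: ly'; rewrite -xy' lx.
- exact: leq_trans leZ (leq_mul _ d0d).
- apply: le_trans qe; rewrite ler_wpM2l // ler_wiXn2l // ?subr_ge0 //.
  by rewrite gerBl.
apply: le_pr => // S2 _ /asboolP[f [fI fP]]; apply/asboolP.
exists (fun c' => if c' == c then f else F c').
have rest g' : [seq (if c' == c then f else F c') | c' <- cs & rd c' == g'] = rounds F cs g'.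
  apply/eq_in_map=> c'; rewrite mem_filter => /andP[_ cin].
  by case: eqP => // cc'; rewrite cc' (negPf ccs) in cin.
split=> [g'|c' z].
  rewrite /rounds /=; case: ifP => [/eqP gg'|_]; rewrite /= rest //.
  rewrite eqxx -gg'; apply: family_cons => // z; by have /andP[] := fP z.
rewrite inE; have [-> _|_ /= cin] := eqVneq c' c.
  move=> rz rf; have /andP[_] := fP z; rewrite rz rf /= inE => ->; by rewrite orbT.
by move=> rz rf; rewrite inE FS.
Qed.

End MainPass.

(** * Colouring matchings bijectively by reserve colours *)

Section Rainbow.
Variables (Z Col T : finType) (real : pred Z) (cols Rs : {set Col}) (tau : Z -> Z -> Col -> T).
Hypothesis sRs : Rs \subset cols.
Hypothesis tau_sym : forall z z' c, tau z z' c = tau z' z c.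
Hypothesis tau_inj : forall z1 z2 c z1' z2' c', c \in cols -> c' \in cols ->
  [&& real z1, real z2 & z1 != z2] -> [&& real z1', real z2' & z1' != z2'] ->
  tau z1 z2 c = tau z1' z2' c' -> c = c' /\ [set z1; z2] = [set z1'; z2'].
Local Notation piece := ({set Z} * {ffun Z -> Z})%type.
Implicit Types (pc : piece) (pl : seq piece) (c : Col) (rho : Z -> Z -> pred Col).

(** It depends only on the size of the piece to be coloured, never on the random matchings; so how
    often a colour is used is known in advance. *)
Definition palette (y : nat) : {set Col} := [set c in take y (enum Rs)].

Lemma card_palette y : (y <= #|Rs|)%N -> #|palette y| = y.
Proof.
move=> yR; rewrite cardsE (card_uniqP _) ?size_takel -?cardE //.
by rewrite take_uniq // enum_uniq.
Qed.

Lemma palette_sub y : palette y \subset Rs.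
Proof. by apply/subsetP=> c; rewrite inE => /mem_take; rewrite mem_enum. Qed.

(** A piece [(X, f)] stands for the edges joining [z] to [f z] for [z] in [X]; thus [X] has to
    contain exactly one end of each of these edges. *)
Definition piece_ok pc := involutive pc.2 /\
  forall z, z \in pc.1 -> [&& real z, real (pc.2 z) & pc.2 z \notin pc.1].

Definition edge_of pc z z' :=
  (z \in pc.1) && (z' == pc.2 z) || (z' \in pc.1) && (z == pc.2 z').

Definition covered rho c : {set Z} := [set z | [exists z', rho z z' c]].

Definition rainbow_ok pl rho (S : {set T}) : Prop :=
  [/\ forall z z' c, rho z z' c -> rho z' z c,
      forall z z' c, rho z z' c ->
        [/\ exists2 pc, pc \in pl & edge_of pc z z', c \in Rs & tau z z' c \in S],
      forall z z' z'' c, rho z z' c -> rho z z'' c -> z' = z'',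
      forall z z' c c', rho z z' c -> rho z z' c' -> c = c'
    & [/\ forall pc z, pc \in pl -> z \in pc.1 -> exists c, rho z (pc.2 z) c,
      forall c, #|covered rho c| = (2 * count (fun pc => c \in palette #|pc.1|) pl)%N
    & forall z, (#|[set c | [exists z', rho z z' c]]| <= size pl)%N]].

Definition piece_tri pc : {set T} := [set tau z (pc.2 z) c | z in pc.1, c in Rs].

Definition add_piece pc (k : Z -> Col) rho z z' c :=
  [|| rho z z' c, [&& z \in pc.1, z' == pc.2 z & c == k z]
    | [&& z' \in pc.1, z == pc.2 z' & c == k z']].

Lemma rainbow_ok_cons pc pl rho (k : Z -> Col) (S S' : {set T}) :
  rainbow_ok pl rho S -> piece_ok pc -> (#|pc.1| <= #|Rs|)%N ->
  (forall pc' z z', pc' \in pl -> edge_of pc z z' -> ~~ edge_of pc' z z') ->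
  {in pc.1 &, injective k} ->
  (forall z, z \in pc.1 -> [/\ k z \in palette #|pc.1|, tau z (pc.2 z) (k z) \in S' &
     forall z', ~~ rho z z' (k z) && ~~ rho (pc.2 z) z' (k z)]) ->
  rainbow_ok (pc :: pl) (add_piece pc k rho) (S :|: S').
Proof.
case: pc => X f [rsym rin rprop rcol [rcov rcnt rdeg]] [/= fI Xok] leX dis inj_k kok.
have kR z : z \in X -> k z \in Rs.
  by move=> zX; have [/(subsetP (palette_sub _))] := kok z zX.
have kn z z' : z \in X -> rho z z' (k z) = false.
  by move=> zX; have [_ _ /(_ z')/andP[/negbTE]] := kok z zX.
have kn' z z' : z \in X -> rho (f z) z' (k z) = false.
  by move=> zX; have [_ _ /(_ z')/andP[_ /negbTE]] := kok z zX.
have fX z : z \in X -> f z \in X = false.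
  by move=> /Xok/and3P[_ _ /negbTE].
have old_new z z' : edge_of (X, f) z z' -> forall c, rho z z' c = false.
  move=> ez c; apply/negP=> /rin[[pc' pc'l ez'] _ _].
  by have := dis pc' z z' pc'l ez; rewrite ez'.
have imk : k @: X = palette #|X|.
  apply/eqP; rewrite eqEcard card_in_imset // card_palette // leqnn andbT.
  by apply/subsetP=> _ /imsetP[z zX ->]; have [] := kok z zX.
split.
- move=> z z' c; rewrite /add_piece /= => /or3P[/rsym ->//|->|->]; by rewrite ?orbT.
- move=> z z' c; rewrite /add_piece /= .
  case/or3P=> [/rin[[pc pcl ez] cR tS]|/and3P[zX /eqP z'E /eqP cE]|/and3P[zX /eqP z'E /eqP cE]].
  + by split; rewrite ?inE ?tS //; exists pc; rewrite // inE pcl orbT.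
  + split; rewrite ?cE ?kR // ?inE.
      by exists (X, f); rewrite ?mem_head // /edge_of /= zX z'E eqxx.
    by rewrite z'E; have [_ -> _] := kok z zX; rewrite orbT.
  + split; rewrite ?cE ?kR // ?inE.
      by exists (X, f); rewrite ?mem_head // /edge_of /= zX z'E eqxx orbT.
    by rewrite z'E tau_sym; have [_ -> _] := kok z' zX; rewrite orbT.
- move=> z z' z'' c; rewrite /add_piece /=.
  case/or3P=> [r1|/and3P[zX /eqP z'E /eqP cE]|/and3P[zX /eqP z'E /eqP cE]];
  case/or3P=> [r2|/and3P[zX2 /eqP z'E2 /eqP cE2]|/and3P[zX2 /eqP z'E2 /eqP cE2]].
  + exact: rprop r1 r2.
  + by rewrite cE2 kn in r1.
  + by rewrite cE2 z'E2 kn' in r1.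
  + by rewrite cE kn in r2.
  + by rewrite z'E.
  + by rewrite z'E2 fX in zX.
  + by rewrite cE z'E kn' in r2.
  + by rewrite z'E fX in zX2.
  + by apply: (can_inj fI); rewrite -z'E.
- move=> z z' c c'; rewrite /add_piece /=.
  have e1 : z \in X -> z' = f z -> edge_of (X, f) z z'.
    by move=> zX ->; rewrite /edge_of /= zX eqxx.
  have e2 : z' \in X -> z = f z' -> edge_of (X, f) z z'.
    by move=> zX ->; rewrite /edge_of /= zX eqxx orbT.
  case/or3P=> [r1|/and3P[zX /eqP z'E /eqP cE]|/and3P[zX /eqP z'E /eqP cE]];
  case/or3P=> [r2|/and3P[zX2 /eqP z'E2 /eqP cE2]|/and3P[zX2 /eqP z'E2 /eqP cE2]].
  + exact: rcol r1 r2.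
  + by rewrite old_new ?e1 in r1.
  + by rewrite old_new ?e2 in r1.
  + by rewrite old_new ?e1 in r2.
  + by rewrite cE cE2.
  + by rewrite z'E fX in zX2.
  + by rewrite old_new ?e2 in r2.
  + by rewrite z'E2 fX in zX.
  + by rewrite cE cE2.
split.
- move=> pc z; rewrite inE => /predU1P[->|pcl] /= zX.
    by exists (k z); rewrite /add_piece /= zX !eqxx orbT.
  by have [c rc] := rcov pc z pcl zX; exists c; rewrite /add_piece rc.
- move=> c; rewrite /= mulnDr -rcnt.
  have [|cY] := boolP (c \in palette #|X|); last first.
    rewrite muln0 add0n; apply: eq_card => z; rewrite !inE.
    apply: eq_existsb => z'; rewrite /add_piece /=.
    have nk u : u \in X -> c == k u = false.
      by move=> uX; apply/negbTE; apply: contra cY => /eqP ->; have [] := kok u uX.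
    by case: (rho z z' c) => //=; case: (boolP (z \in X)) => [/nk ->|_]; rewrite ?andbF /=;
       case: (boolP (z' \in X)) => [/nk ->|_]; rewrite ?andbF.
  rewrite -imk => /imsetP[u uX cE].
  have fu : u != f u by apply/eqP=> uf; have := fX u uX; rewrite -uf uX.
  have -> : covered (add_piece (X, f) k rho) c = [set u; f u] :|: covered rho c.
    apply/setP=> z; rewrite !inE; apply/existsP/idP.
      move=> [z']; rewrite /add_piece /= => /or3P[r|/and3P[zX _ /eqP ck]|/and3P[zX /eqP -> /eqP ck]].
      + by apply/orP; right; apply/existsP; exists z'.
      + by have -> : z = u; [apply: inj_k => //; rewrite -ck | rewrite eqxx].
      + by have -> : z' = u; [apply: inj_k => //; rewrite -ck | rewrite eqxx orbT].
    case/orP=> [/orP[/eqP ->|/eqP ->]|/existsP[z' r]].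
    + by exists (f u); rewrite /add_piece /= uX cE !eqxx orbT.
    + by exists u; rewrite /add_piece /= uX cE !eqxx !orbT.
    + by exists z'; rewrite /add_piece r.
  rewrite cardsU (_ : _ :&: _ = set0) ?cards0 ?subn0 ?cards2 ?fu //.
  apply/setP=> z; rewrite !inE; apply/negP=> /andP[/orP[/eqP ->|/eqP ->]] /existsP[z'].
    by rewrite cE kn.
  by rewrite cE kn'.
- move=> z; set old := [set c | [exists z', rho z z' c]].
  apply: leq_trans (_ : #|(if z \in X then k z else k (f z)) |: old| <= _)%N.
    apply/subset_leq_card/subsetP=> c; rewrite !inE => /existsP[z'].
    rewrite /add_piece /= => /or3P[r|/and3P[zX _ /eqP ->]|/and3P[zX /eqP -> /eqP ->]].
    + by apply/orP; right; apply/existsP; exists z'.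
    + by rewrite zX eqxx.
    + by rewrite fX // fI eqxx.
  rewrite cardsU1 /= -[leqRHS]add1n; apply: leq_add; last exact: rdeg.
  by case: (_ \notin _).
Qed.

Variables (R : realFieldType) (p : R).
Hypothesis p01 : 0 <= p <= 1.
Variables (s0 : nat) (e : R).
Hypotheses (s0_ge4 : (4 <= s0)%N) (e01 : 0 <= e <= 1).
Hypothesis qe : (2 * (#|Z|.+1 * #|Col|.+1))%:R * (1 - p) ^+ (s0 %/ 4) <= e.

Lemma edge_of_set pc z w w' :
  z \in pc.1 -> [set z; pc.2 z] = [set w; w'] -> w != w' -> edge_of pc w w'.
Proof.
move=> zX eqs ww'; rewrite /edge_of.
have /set2P[wz|wz] : w \in [set z; pc.2 z] by rewrite eqs set21.
  have /set2P[w'z|w'z] : w' \in [set z; pc.2 z] by rewrite eqs set22.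
    by move: ww'; rewrite wz w'z eqxx.
  by rewrite wz w'z zX eqxx.
have /set2P[w'z|w'z] : w' \in [set z; pc.2 z] by rewrite eqs set22.
  by rewrite wz w'z zX eqxx orbT.
by move: ww'; rewrite wz w'z eqxx.
Qed.

(** For the head piece, a perfect matching is sought between its edges and its palette, a colour
    being allowed on an edge if it is absent from both ends. With [l] earlier pieces a vertex
    carries at most [l] colours and a colour covers at most [2 * l] vertices, so an edge loses at
    most [2 * l] colours and a colour at most [4 * l] edges. This graph is nearly complete with
    [h = 4 * l], and [4 * h <= #|pc.1|] explains the factor 16. *)
Lemma rainbow_pass pl (c0 : Col) : uniq pl -> {in pl, forall pc, piece_ok pc} ->
  (forall pc pc' z z', pc \in pl -> pc' \in pl -> edge_of pc z z' -> edge_of pc' z z' -> pc = pc') ->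
  {in pl, forall pc, (maxn s0 (16 * size pl) <= #|pc.1| <= #|Rs|)%N} ->
  1 - e *+ (7 * #|Z|) *+ size pl
    <= pr p (\bigcup_(pc <- pl) piece_tri pc) (fun S => `[< exists rho, rainbow_ok pl rho S >]).
Proof.
have /andP[p0 p1] := p01; have /andP[e0 e1] := e01.
move: {2}(size pl) (leqnn (size pl)) => N; elim: pl => [|pc pl IH] /=.
  move=> _ _ _ _ _; rewrite mulr0n subr0 (@eq_pr _ _ _ _ _ predT) ?pr_predT // => S _.
  apply/asboolP; exists (fun _ _ _ => false); split=> //; split=> // c.
    by rewrite muln0; apply/eqP; rewrite cards_eq0; apply/eqP/setP=> z; rewrite !inE; apply/existsP=> -[].
  by rewrite leqn0 cards_eq0; apply/eqP/setP=> z; rewrite !inE; apply/existsP=> -[].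
move=> szN /andP[npc uq] okl disl szl.
have pcl : pc \in pc :: pl by rewrite mem_head.
have insl pc' : pc' \in pl -> pc' \in pc :: pl by move=> h; rewrite inE h orbT.
have [fI Xok] := okl pc pcl; have /andP[leX leXR] := szl pc pcl.
have dis pc' z z' : pc' \in pl -> edge_of pc z z' -> ~~ edge_of pc' z z'.
  move=> pc'l ez; apply/negP=> ez'; have := disl _ _ _ _ pcl (insl _ pc'l) ez ez'.
  by move=> pcE; rewrite -pcE (negPf npc) in pc'l.
have edge_tri pc1 z : pc1 \in pc :: pl -> z \in pc1.1 -> [&& real z, real (pc1.2 z) & z != pc1.2 z].
  move=> /okl[_ ok1] zX; have /and3P[-> -> nX] := ok1 z zX.
  by apply: contra nX => /eqP <-.
rewrite big_cons setUC mulrS opprD addrA addrAC.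
apply: (pr_step_subr p01 (A := fun S => `[< exists rho, rainbow_ok pl rho S >])); rewrite ?mulrn_wge0 //.
- apply/pred0P=> t /=; apply/negP=> /andP[]; rewrite bigcup_seq => /bigcupP[pc' pc'l].
  case/imset2P=> z c zX cR -> /imset2P[w c' wX c'R] /tau_inj[||||_ eqs].
  + exact: (subsetP sRs).
  + exact: (subsetP sRs).
  + by apply: edge_tri; rewrite ?insl.
  + exact: edge_tri.
  have /and3P[_ _ ww'] := edge_tri _ _ pcl wX.
  have := dis pc' w (pc.2 w) pc'l; rewrite (edge_of_set zX eqs ww').
  by move=> /(_ (edge_of_set wX erefl ww')).
- apply: IH => //; first by apply: ltnW.
  + by move=> pc' /insl; apply: okl.
  + by move=> pc1 pc2 z z' /insl h1 /insl h2; apply: disl.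
  + by move=> pc' /insl/szl; clear; lia.
move=> S1 _ /asboolP[rho okr].
have [rsym rin rprop rcol [rcov rcnt rdeg]] := okr.
pose E z c := [forall z', ~~ rho z z' c && ~~ rho (pc.2 z) z' c].
have szc c : (#|covered rho c| <= 2 * size pl)%N by rewrite rcnt leq_mul // count_size.
apply: (@le_trans _ _ (1 - e *+ (7 * #|pc.1|))).
  by rewrite lerD2l lerN2 ler_wpMn2l // leq_mul // max_card.
apply: le_trans (dense_matching (X := pc.1) (Y := palette #|pc.1|) (E := E)
  (free := fun _ _ => false) (tau := fun z c => tau z (pc.2 z) c) (D := piece_tri pc)
  (beta := #|pc.1|) (h := 4 * size pl) c0 p01 _ _ erefl (card_palette leXR) _ _ _ _ e1 _) _.
- move=> z c zX cP _ _; apply/imset2P; exists z c => //.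
  exact: (subsetP (palette_sub _) _ cP).
- move=> z c z' c' zX cP _ z'X c'P _ _ _ /tau_inj[||||-> eqs].
  + exact: (subsetP sRs _ (subsetP (palette_sub _) _ cP)).
  + exact: (subsetP sRs _ (subsetP (palette_sub _) _ c'P)).
  + exact: edge_tri.
  + exact: edge_tri.
  split=> //; have /set2P[//|zE] : z \in [set z'; pc.2 z'] by rewrite -eqs set21.
  by have /and3P[_ _] := Xok z' z'X; rewrite -zE zX.
- by move: leX; move: s0_ge4; clear; lia.
- by move: leX; move: s0_ge4; clear; lia.
- move=> z zX.
  have : (#|palette #|pc.1| | <= #|[set c in palette #|pc.1| | E z c]|
      + #|[set c | [exists z', rho z z' c]]| + #|[set c | [exists z', rho (pc.2 z) z' c]]|)%N.
    apply: leq_trans (_ : #|([set c in palette #|pc.1| | E z c] :|: [set c | [exists z', rho z z' c]])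
      :|: [set c | [exists z', rho (pc.2 z) z' c]]| <= _)%N; last first.
      by apply: leq_trans (leq_card_setU _ _).1 _; rewrite leq_add2r (leq_card_setU _ _).1.
    apply/subset_leq_card/subsetP=> c cP; rewrite in_setU in_setU 3!inE cP /=.
    case: (boolP (E z c)) => //=; rewrite negb_forall => /existsP[z'].
    by rewrite negb_and !negbK => /orP[r|r]; apply/orP; [left|right]; rewrite ?inE; apply/existsP; exists z'.
  by rewrite card_palette //; have := rdeg z; have := rdeg (pc.2 z); clear; lia.
- move=> c cP.
  have : (#|pc.1| <= #|[set z in pc.1 | E z c]| + #|covered rho c| + #|pc.2 @^-1: covered rho c|)%N.
    apply: leq_trans (_ : #|([set z in pc.1 | E z c] :|: covered rho c)
      :|: pc.2 @^-1: covered rho c| <= _)%N; last first.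
      by apply: leq_trans (leq_card_setU _ _).1 _; rewrite leq_add2r (leq_card_setU _ _).1.
    apply/subset_leq_card/subsetP=> z zX; rewrite in_setU in_setU 4!inE zX /=.
    case: (boolP (E z c)) => //=; rewrite negb_forall => /existsP[z'].
    by rewrite negb_and !negbK => /orP[r|r]; apply/orP; [left|right]; rewrite ?inE; apply/existsP; exists z'.
  rewrite on_card_preimset; last by apply: onW_bij; apply: (Bijective fI).
  by have := szc c; clear; lia.
- apply: le_trans qe; rewrite ler_wpM2l // ler_wiXn2l // ?subr_ge0 //.
    by rewrite gerBl.
  by apply: leq_div2r; move: leX; clear; lia.
apply: le_pr => // S2 _ /asboolP[k [injk kP]]; apply/asboolP.
exists (add_piece pc k rho); apply: rainbow_ok_cons => // z zX.
by have /and3P[kz /forallP Ez tz] := kP z zX.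
Qed.

End Rainbow.

Lemma uniq_map_inj (A B : eqType) (h : A -> B) (s : seq A) :
  uniq [seq h x | x <- s] -> {in s &, injective h}.
Proof.
elim: s => [|x s IH] //= /andP[xs uq] y z; rewrite !inE.
case/predU1P=> [->|yin]; case/predU1P=> [->|zin] // eqh; last exact: IH.
  by case/negP: xs; rewrite eqh map_f.
by case/negP: xs; rewrite -eqh map_f.
Qed.

Lemma card_involution_half (Z : finType) (f : Z -> Z) (W : {set Z}) : involutive f ->
  (forall z, z \in W -> (f z \in W) && (f z != z)) ->
  (2 * #|[set z in W | enum_rank z < enum_rank (f z)]| = #|W|)%N.
Proof.
move=> fI fW; set A := [set _ in _ | _].
have WE : W = A :|: f @: A.
  apply/setP=> z; rewrite inE inE; apply/idP/orP => [zW|[/andP[]//|/imsetP[y]]]; last first.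
    by rewrite inE => /andP[/fW/andP[fy _] _] ->.
  have /andP[fzW fz] := fW z zW; rewrite zW /=.
  case: ltngtP => [lt|gt|/val_inj/enum_rank_inj zfz]; [by left | right | ].
    by apply/imsetP; exists (f z); rewrite ?inE ?fzW ?fI.
  by rewrite -zfz eqxx in fz.
rewrite [in RHS]WE cardsU card_imset; last exact: can_inj fI.
rewrite (_ : A :&: _ = set0) ?cards0 ?subn0 ?mul2n ?addnn //.
apply/setP=> z; rewrite !inE; apply/negP=> /andP[/andP[_ lt] /imsetP[y]].
by rewrite inE => /andP[_ lt'] zE; move: lt; rewrite zE fI ltnNge ltnW.
Qed.

(** * Cutting a matching into pieces of linear size *)

Section Chunks.
Local Open Scope nat_scope.
Variables (Z : finType) (s0 : nat).
Hypothesis s0_gt0 : 0 < s0.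

(** The minimum lets the last chunk absorb the remainder, so every chunk has between [s0] and
    [2 * s0] elements. *)
Definition chunk (i z : nat) := minn (i %/ s0) (z %/ s0).-1.

(** A function of the cardinality alone: the sizes of the pieces do not depend on which edges the
    matching has. *)
Definition chunk_sizes (z : nat) : seq nat :=
  [seq count (fun i => chunk i z == j) (iota 0 z) | j <- iota 0 (z %/ s0)].

Definition chunk_of (X : {set Z}) (j : nat) : {set Z} :=
  [set z in X | chunk (index z (enum X)) #|X| == j].

Lemma map_index_uniq (A : eqType) (s : seq A) : uniq s -> [seq index x s | x <- s] = iota 0 (size s).
Proof.
case: s => // x0 s' uq; set s := x0 :: s' in uq *.
apply: (@eq_from_nth _ 0) => [|i]; rewrite size_map ?size_iota // => lti.
by rewrite (nth_map x0) // index_uniq // nth_iota.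
Qed.

Lemma card_chunk_of (X : {set Z}) j :
  #|chunk_of X j| = count (fun i => chunk i #|X| == j) (iota 0 #|X|).
Proof.
rewrite [in iota _ _]cardE -map_index_uniq ?enum_uniq // count_map -size_filter.
rewrite cardE; apply/perm_size/uniq_perm; first exact: enum_uniq.
  exact: filter_uniq (enum_uniq _).
by move=> z; rewrite mem_enum mem_filter inE mem_enum /= andbC.
Qed.

Lemma chunk_sizesE (X : {set Z}) :
  [seq #|chunk_of X j| | j <- iota 0 (#|X| %/ s0)] = chunk_sizes #|X|.
Proof. by apply: eq_map => j; rewrite card_chunk_of. Qed.

Lemma chunk_of_cover (X : {set Z}) z : z \in X -> s0 <= #|X| ->
  exists2 j, j \in iota 0 (#|X| %/ s0) & z \in chunk_of X j.
Proof.
move=> zX leX; exists (chunk (index z (enum X)) #|X|); last by rewrite inE zX eqxx.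
have J0 : 0 < #|X| %/ s0 by rewrite divn_gt0.
by rewrite mem_iota add0n /chunk leq0n /= -[ltnRHS](prednK J0) ltnS geq_minr.
Qed.

Lemma card_chunk_bounds (X : {set Z}) j : j \in iota 0 (#|X| %/ s0) ->
  s0 <= #|chunk_of X j| <= 2 * s0.
Proof.
rewrite mem_iota add0n /= card_chunk_of => ltj; set z := #|X| in ltj *.
have zE := divn_eq z s0; have ltm := ltn_pmod z s0_gt0.
have cnt P x : count P (iota 0 x) = #|[set i : 'I_x | P i]|.
  rewrite cardE -(size_map val) -size_filter; apply/perm_size/uniq_perm.
  - by rewrite filter_uniq ?iota_uniq.
  - by rewrite map_inj_uniq ?enum_uniq //; apply: val_inj.
  - move=> i; rewrite mem_filter mem_iota add0n /=; apply/andP/mapP.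
      by case=> Pi lti; exists (Ordinal lti); rewrite // mem_enum inE.
    by case=> i'; rewrite mem_enum inE => Pi ->.
rewrite cnt; apply/andP; split.
  have lts i : i < s0 -> j * s0 + i < z by nia.
  rewrite -[X in X <= _](card_ord s0).
  pose h (i : 'I_s0) : 'I_z := Ordinal (lts i (ltn_ord i)).
  have hinj : injective h by move=> i i' [] /addnI/val_inj.
  rewrite -(card_imset _ hinj); apply/subset_leq_card/subsetP=> _ /imsetP[i _ ->].
  rewrite inE /chunk /= divnMDl // divn_small // addn0; apply/eqP; lia.
have lts (i : 'I_z) : chunk i z == j -> j * s0 <= i < j * s0 + 2 * s0.
  rewrite /chunk => /eqP cj; have := divn_eq i s0; have := ltn_pmod i s0_gt0.
  have := ltn_ord i; nia.
rewrite -[X in _ <= X](card_ord (2 * s0)).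
have [s00|] := posnP (2 * s0); first by lia.
move: lts; case ds : (2 * s0) => [|m] // lts _.
pose h (i : 'I_z) : 'I_m.+1 := inord (i - j * s0).
have hinj : {in [set i : 'I_z | chunk i z == j] &, injective h}.
  move=> i i'; rewrite !inE => /lts hi /lts hi' /(congr1 val) /=.
  by rewrite !inordK; [move=> ?; apply: val_inj => /=; lia | lia | lia].
by rewrite -(card_in_imset hinj) max_card.
Qed.

End Chunks.

(** * A 1-factorisation inside the blocks *)

Section Reflections.
Variables (K : finZmodType) (b0 : nat).
Local Notation b := b0.+1.
Local Notation Z := (K * 'I_b)%type.

(** The classical factorisation by sums: the pair of labels [l], [l'] belongs to the reflection at
    [l + l'] modulo [b]. Fixed points, the solutions of [l + l = s], carry no edge. *)
Definition reflection (s : 'I_b) : {ffun Z -> Z} := [ffun z => (z.1, s - z.2)].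
Definition reflections : seq {ffun Z -> Z} := [seq reflection s | s <- enum 'I_b].

Lemma reflections_family : shift_family 0 reflections.
Proof.
split=> [f /mapP[s _ ->] z|f /mapP[s _ ->] z|z].
- by rewrite !ffunE /= subKr; case: z.
- by rewrite ffunE addr0.
rewrite -map_comp map_inj_uniq ?enum_uniq // => s s' /=; rewrite !ffunE.
by move/(congr1 (fun z' : Z => z'.2)) => /addIr.
Qed.

Lemma size_reflections : size reflections = b.
Proof. by rewrite size_map size_enum_ord. Qed.

Lemma card_label_fixed (s : 'I_b) : (#|[set l : 'I_b | (s - l)%R == l]| <= 2)%N.
Proof.
apply: (@leq_trans #|([set inord (s %/ 2); inord ((s + b) %/ 2)] : {set 'I_b})|); last first.
  by rewrite cards2; case: eqP.
apply/subset_leq_card/subsetP=> l; rewrite inE => /eqP slE.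
have sE : (s = (l + l) %% b :> nat)%N by rewrite -[s](subrK l) slE.
have ltl := ltn_ord l; have lts := ltn_ord s.
have [lt|ge] := ltnP (l + l) b; rewrite !inE.
  apply/orP; left; apply/eqP/val_inj; rewrite /= inordK; last by lia.
  by rewrite modn_small // in sE; lia.
apply/orP; right; apply/eqP/val_inj; have : (l + l = s + b)%N.
  have := divn_eq (l + l) b; rewrite -sE.
  have -> : ((l + l) %/ b = 1)%N; last by lia.
  apply/eqP; rewrite eqn_leq -ltnS ltn_divLR // leq_divRL //; apply/andP; split; lia.
by move=> e; rewrite /= inordK; lia.
Qed.

End Reflections.

(** * Colouring the edges inside a part *)

Section Inner.
Variables (K : finZmodType) (b0 a : nat).
Hypothesis Kxx : forall x : K, x + x = 0.
Local Notation b := b0.+1.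
Hypothesis le_ab : (a <= b)%N.
Local Notation Z := (K * 'I_b)%type.

(* Block [0] has only [a] genuine vertices; the others are dummies, and being matched with a dummy
   means being left for a cross edge. *)
Definition real : pred Z := fun z => (z.1 != 0) || (z.2 < a)%N.

Lemma card_dummies : #|[set z : Z | ~~ real z]| = (b - a)%N.
Proof.
have -> : [set z : Z | ~~ real z] = setX [set 0] [set l : 'I_b | a <= l]%N.
  by apply/setP=> -[u l]; rewrite !inE /real /= negb_or negbK -leqNgt.
rewrite cardsX cards1 mul1n.
have := cardsC [set l : 'I_b | (l < a)%N]; rewrite card_ord.
have -> : ~: [set l : 'I_b | (l < a)%N] = [set l : 'I_b | a <= l]%N.
  by apply/setP=> l; rewrite !inE -leqNgt.
have -> : #|[set l : 'I_b | (l < a)%N]| = a; last by lia.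
pose h (i : 'I_a) : 'I_b := widen_ord le_ab i.
rewrite -[RHS](card_ord a) -(card_imset _ (_ : injective h)).
  apply: eq_card => l; rewrite inE; apply/idP/imsetP=> [la|[i _ ->]]; last exact: (ltn_ord i).
  by exists (Ordinal la) => //; apply: val_inj.
by move=> i j /(congr1 val) /= /val_inj.
Qed.

Lemma card_real : (#|[set z : Z | real z]| + (b - a) = #|K| * b)%N.
Proof.
rewrite -card_dummies -[in RHS](card_ord b) -card_prod -(cardsC [set z : Z | real z]).
by congr (_ + #|pred_of_set _|)%N; apply/setP=> z; rewrite !inE.
Qed.

Variables (Col T : finType) (tau : Z -> Z -> Col -> T) (main : seq Col) (Rs : {set Col}).
Hypotheses (main_uniq : uniq main) (mainR : [disjoint [set c in main] & Rs]).
Let cols := [set c in main] :|: Rs.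
Hypothesis tau_sym : forall z z' c, tau z z' c = tau z' z c.
Hypothesis tau_inj : forall z1 z2 c z1' z2' c', c \in cols -> c' \in cols ->
  [&& real z1, real z2 & z1 != z2] -> [&& real z1', real z2' & z1' != z2'] ->
  tau z1 z2 c = tau z1' z2' c' -> c = c' /\ [set z1; z2] = [set z1'; z2'].

Variables (rd : Col -> K) (d0 s0 : nat).
Hypothesis rd0 : {in main, forall c, rd c != 0}.
Hypothesis rd_count : forall g, g != 0 -> (count (fun c => rd c == g) main + d0 = b)%N.
Hypothesis s0_gt0 : (0 < s0)%N.

Definition edge_reps (f : {ffun Z -> Z}) : {set Z} :=
  [set z | [&& real z, real (f z) & enum_rank z < enum_rank (f z)]%N].

(** The number of genuine edges of a matching in a nonzero round: the [b - a] dummies are matched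
    with as many genuine vertices, and the remaining genuine vertices are matched among
    themselves. *)
Definition round_size : nat := (#|[set z : Z | real z]| - (b - a)) %/ 2.

(** Sizes of the matchings left to the reserve colours: the reflections for round 0 and [d0]
    matchings for every other round. The list is deterministic, hence the same in both parts. *)
Definition matching_sizes : seq nat :=
  flatten [seq if g == 0 then [seq #|edge_reps f| | f <- reflections K b0] else nseq d0 round_size
          | g <- enum K].

Definition piece_sizes : seq nat := flatten [seq chunk_sizes s0 z | z <- matching_sizes].

Definition multiplicity (c : Col) : nat := count (fun y => c \in palette Rs y) piece_sizes.

Definition uncovered (col : Z -> Z -> pred Col) (c : Col) : {set Z} :=
  [set z | real z && ~~ [exists z', col z z' c]].

(** The last two clauses are what the cross edges need. They make the number of uncovered vertices
    of a colour independent of the random choices, and they confine those of a main colour to the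
    single block [rd c], where the partners of the dummies are. *)
Definition inner_ok (col : Z -> Z -> pred Col) (S : {set T}) : Prop :=
  [/\ forall z z' c, col z z' c -> col z' z c,
      forall z z' c, col z z' c -> [/\ [&& real z, real z' & z != z'], c \in cols & tau z z' c \in S],
      forall z z' z'' c, col z z' c -> col z z'' c -> z' = z'',
      forall z z' c c', col z z' c -> col z z' c' -> c = c'
    & [/\ forall z z', [&& real z, real z' & z != z'] -> exists c, col z z' c,
      forall c, c \in main ->
        (forall z, z \in uncovered col c -> z.1 = rd c) /\ #|uncovered col c| = (b - a)%N
    & forall c, c \in Rs ->
        (#|uncovered col c| + 2 * multiplicity c)%N = #|[set z : Z | real z]|]].

Hypothesis s0_round : (s0 <= round_size)%N.
Hypothesis s0_refl : forall f, f \in reflections K b0 -> (s0 <= #|edge_reps f|)%N.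

Section Pieces.
Variables (F : Col -> {ffun Z -> Z}) (W : K -> seq {ffun Z -> Z}).
Hypothesis famW : forall g, shift_family g (W g ++ rounds rd F main g).
Hypothesis sizeW : forall g, size (W g ++ rounds rd F main g) = b.
Hypothesis W0 : W 0 = reflections K b0.

Let inW g f : f \in W g -> f \in W g ++ rounds rd F main g.
Proof. by rewrite mem_cat => ->. Qed.

Lemma real_shift g (z : Z) : g != 0 -> z.1 = g -> real z.
Proof. by move=> g0 zg; rewrite /real zg g0. Qed.

Lemma card_edge_reps g f : g != 0 -> f \in W g -> #|edge_reps f| = round_size.
Proof.
move=> g0 fW; have [inv sh _] := famW g.
have fI := inv f (inW fW); have fsh := sh f (inW fW).
pose Wr := [set z | real z && real (f z)].
have ne z : f z != z.
  apply/eqP=> fz; have := fsh z; rewrite fz -[LHS]addr0 => /addrI/esym/eqP.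
  by rewrite (negPf g0).
have half := @card_involution_half _ f Wr fI.
have {}half : (2 * #|edge_reps f| = #|Wr|)%N.
  rewrite -half => [|z]; last by rewrite !inE fI andbC => ->; rewrite ne.
  by congr (2 * _)%N; apply: eq_card => z; rewrite !inE andbA.
have : (#|Wr| + (b - a) = #|[set z : Z | real z]|)%N.
  have <- : #|f @^-1: [set z : Z | ~~ real z]| = (b - a)%N.
    by rewrite on_card_preimset ?card_dummies //; apply: onW_bij; apply: (Bijective fI).
  rewrite -cardsUI (_ : Wr :&: _ = set0) ?cards0 ?addn0; last first.
    by apply/setP=> z; rewrite !inE; case: (real (f z)); rewrite ?andbF.
  apply: eq_card => z; rewrite !inE; case rfz: (real (f z)); rewrite ?andbT ?orbF //= andbF /=.
  have fz0 : (f z).1 = 0 by apply/eqP; move: rfz; rewrite /real; case: eqP.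
  by apply/esym/(real_shift g0); rewrite -[z]fI fsh fz0 add0r.
by rewrite /round_size => <-; rewrite addnK -half mulKn.
Qed.

Definition rainbow_matchings : seq {ffun Z -> Z} := [seq f | g <- enum K, f <- W g].

Definition pieces : seq ({set Z} * {ffun Z -> Z}) :=
  [seq (chunk_of s0 (edge_reps f) j, f) | f <- rainbow_matchings,
                                       j <- iota 0 (#|edge_reps f| %/ s0)].

Lemma rainbow_matchingsP f : f \in rainbow_matchings -> exists g, f \in W g.
Proof. by case/allpairsPdep=> g [f' [_ fW ->]]; exists g. Qed.

(** The round is recovered from the shift of the block, and within a round the matchings are
    pairwise disjoint; so an edge determines its matching. *)
Lemma rainbow_matchings_inj g g' f f' z : f \in W g -> f' \in W g' -> f z = f' z -> g = g' /\ f = f'.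
Proof.
move=> fW fW' fz; have [_ sh uq] := famW g; have [_ sh' _] := famW g'.
have gg' : g = g'.
  by apply: (@addrI _ z.1); rewrite -(sh f (inW fW)) -(sh' f' (inW fW')) fz.
split=> //; rewrite -gg' in fW'.
exact: (uniq_map_inj (uq z)) (inW fW) (inW fW') fz.
Qed.

Lemma map_edge_reps : [seq #|edge_reps f| | f <- rainbow_matchings] = matching_sizes.
Proof.
rewrite /rainbow_matchings map_flatten -map_comp; congr flatten; apply: eq_map => g /=.
rewrite map_id; case: eqP => [->|/eqP g0]; first by rewrite W0.
have szW : size (W g) = d0.
  have := sizeW g; rewrite size_cat /rounds size_map size_filter.
  by have := rd_count g0; lia.
rewrite -szW; apply: (@eq_from_nth _ 0%N); rewrite size_map ?size_nseq // => i ltiW.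
rewrite (nth_map (finfun id)) // nth_nseq ltiW.
by apply: card_edge_reps g0 _; apply: mem_nth.
Qed.

Lemma map_piece_sizes : [seq #|pc.1| | pc : {set Z} * {ffun Z -> Z} <- pieces] = piece_sizes.
Proof.
rewrite /pieces map_flatten -map_comp /piece_sizes -map_edge_reps -map_comp.
by congr flatten; apply: eq_map => f /=; rewrite -map_comp -chunk_sizesE.
Qed.

Lemma s0_edge_reps f : f \in rainbow_matchings -> (s0 <= #|edge_reps f|)%N.
Proof.
case/rainbow_matchingsP=> g fW; have [g0|g0] := eqVneq g 0.
  by apply: s0_refl; rewrite -W0 -g0.
by rewrite (card_edge_reps g0 fW).
Qed.

Lemma piecesP pc : pc \in pieces -> exists f j,
  [/\ pc = (chunk_of s0 (edge_reps f) j, f), f \in rainbow_matchings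
    & j \in iota 0 (#|edge_reps f| %/ s0)].
Proof. by case/allpairsPdep=> f [j [? ? ->]]; exists f, j. Qed.

Lemma card_piece pc : pc \in pieces -> (s0 <= #|pc.1| <= 2 * s0)%N.
Proof. by case/piecesP=> f [j [-> _ jin]]; apply: card_chunk_bounds. Qed.

Lemma pieces_ok pc : pc \in pieces -> piece_ok real pc.
Proof.
case/piecesP=> f [j [-> /rainbow_matchingsP[g fW] _]]; have [inv _ _] := famW g.
have fI := inv f (inW fW); split=> // z; rewrite !inE /= => /andP[/and3P[-> -> lt] _] /=.
by rewrite fI ltnNge (ltnW lt) !andbF.
Qed.

Lemma edge_of_piece pc z z' : pc \in pieces -> edge_of pc z z' -> z' = pc.2 z.
Proof.
move=> pcl; have [fI _] := pieces_ok pcl.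
by case/orP=> /andP[_ /eqP ->] //; rewrite fI.
Qed.

Lemma pieces_edge_inj pc pc' z z' : pc \in pieces -> pc' \in pieces ->
  edge_of pc z z' -> edge_of pc' z z' -> pc = pc'.
Proof.
move=> pcl pcl' ez ez'; have z'E := edge_of_piece pcl ez; have z'E' := edge_of_piece pcl' ez'.
have [f [j [pcE fr _]]] := piecesP pcl; have [f' [j' [pcE' fr' _]]] := piecesP pcl'.
have [g fW] := rainbow_matchingsP fr; have [g' fW'] := rainbow_matchingsP fr'.
have ff : f = f'.
  have [] // := @rainbow_matchings_inj g g' f f' z fW fW'.
  by rewrite -[f]/(chunk_of s0 (edge_reps f) j, f).2 -pcE -z'E z'E' pcE'.
subst f'; suff jj : j = j' by rewrite pcE pcE' jj.
have common : exists2 w, w \in chunk_of s0 (edge_reps f) j & w \in chunk_of s0 (edge_reps f) j'.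
  move: ez ez'; rewrite pcE pcE' /edge_of /=.
  have [inv _ _] := famW g; have fI := inv f (inW fW).
  have nofix w k k' : w \in chunk_of s0 (edge_reps f) k -> f w \in chunk_of s0 (edge_reps f) k' -> False.
    rewrite !inE => /andP[/and3P[_ _ lt] _] /andP[/and3P[_ _]].
    by rewrite fI ltnNge (ltnW lt).
  case/orP=> /andP[h1 /eqP e1]; case/orP=> /andP[h2 /eqP e2].
  - by exists z.
  - by case: (nofix z j j'); rewrite // -e1.
  - by case: (nofix z j' j); rewrite // -e2.
  - by exists z'.
by case: common => w; rewrite !inE => /andP[_ /eqP <-] /andP[_ /eqP].
Qed.

Lemma pieces_uniq : uniq pieces.
Proof.
have W_uniq g : uniq (W g).
  have [_ _ uq] := famW g; have z0 : Z := (0, ord0).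
  by have := map_uniq (uq z0); rewrite cat_uniq => /and3P[].
apply: allpairs_uniq_dep => [|f _|]; last first.
- move=> _ _ /allpairsPdep[f [j [fr jin ->]]] /allpairsPdep[f' [j' [fr' jin' ->]]] /=.
  move=> [eqX ff']; subst f'; congr (Tagged _ _).
  have /andP[le _] := card_chunk_bounds s0_gt0 jin.
  have /card_gt0P[z zX] : (0 < #|chunk_of s0 (edge_reps f) j|)%N by apply: leq_trans le.
  have := zX; rewrite eqX; move: zX; rewrite !inE.
  by move=> /andP[_ /eqP <-] /andP[_ /eqP].
- exact: iota_uniq.
apply: allpairs_uniq_dep => [|g _|]; rewrite ?enum_uniq ?W_uniq //.
move=> _ _ /allpairsPdep[g [f [_ fW ->]]] /allpairsPdep[g' [f' [_ fW' ->]]] /= ff'.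
have [gg _] := @rainbow_matchings_inj g g' f f' (0, ord0) fW fW' (congr1 (fun h : {ffun Z -> Z} => h _) ff').
by subst g' f'.
Qed.

Definition inner_coloring (rho : Z -> Z -> pred Col) (z z' : Z) : pred Col :=
  fun c => [&& c \in main, real z, real z' & z' == F c z] || rho z z' c.

(** Genuine vertices [z] and [z'] meet in the round [z.1 + z'.1], whose [b] matchings contain all
    pairs; theirs is [F c] for a main colour [c] or one of those cut into pieces. A vertex is
    uncovered by a main colour [c] exactly when [F c] sends it to a dummy. For a reserve colour the
    count comes from the prescribed sizes of the pieces. *)
Lemma inner_coloring_ok (rho : Z -> Z -> pred Col) (S1 S2 : {set T}) :
  (forall c z, c \in main -> real z -> real (F c z) -> tau z (F c z) c \in S1) ->
  rainbow_ok Rs tau pieces rho S2 -> inner_ok (inner_coloring rho) (S1 :|: S2).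
Proof.
move=> FS [rsym rin rprop rcol [rcov rcnt _]].
have notR c : c \in main -> c \notin Rs.
  move=> cm; have := mainR; rewrite disjoints_subset => /subsetP/(_ c).
  by rewrite !inE => /(_ cm).
have Fround c : c \in main -> F c \in W (rd c) ++ rounds rd F main (rd c).
  move=> cm; rewrite mem_cat; apply/orP; right; apply/mapP; exists c => //.
  by rewrite mem_filter eqxx.
have FI c : c \in main -> involutive (F c).
  by move=> cm; have [inv _ _] := famW (rd c); apply: inv; apply: Fround.
have Fsh c z : c \in main -> (F c z).1 = z.1 + rd c.
  by move=> cm; have [_ sh _] := famW (rd c); apply: sh; apply: Fround.
have rho_main z z' c : c \in main -> rho z z' c = false.
  by move=> cm; apply/negP=> /rin[_ cR _]; have := notR c cm; rewrite cR.
have rho_edge z z' c : rho z z' c -> exists2 f, f \in rainbow_matchings & z' = f z.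
  case/rin=> -[pc pcl ez] _ _; have z'E := edge_of_piece pcl ez.
  by have [f [j [pcE fr _]]] := piecesP pcl; exists f; rewrite // z'E pcE.
have rho_F z c c' : c \in main -> rho z (F c z) c' = false.
  move=> cm; apply/negP=> /rho_edge[f /rainbow_matchingsP[g fW] fz].
  have [_ sh uq] := famW g; have := sh f (inW fW) z; rewrite -fz Fsh // => /addrI rdg.
  have Fin : F c z \in [seq (f : {ffun Z -> Z}) z | f <- rounds rd F main g].
    apply: (map_f (fun h : {ffun Z -> Z} => h z)); rewrite -rdg.
    by apply: map_f; rewrite mem_filter eqxx.
  have := uq z; rewrite map_cat cat_uniq => /and3P[_ /hasPn/(_ _ Fin)].
  by rewrite /= fz (map_f (fun h : {ffun Z -> Z} => h z) fW).
split.
- move=> z z' c /orP[/and4P[cm rz rz' /eqP z'E]|/rsym r]; last by rewrite /inner_coloring r orbT.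
  by rewrite /inner_coloring cm rz rz' z'E FI // eqxx.
- move=> z z' c /orP[/and4P[cm rz rz' /eqP z'E]|r].
    rewrite rz rz' !inE cm z'E FS -?z'E //; split=> //.
    apply/eqP=> zz; have := Fsh c z cm; rewrite -z'E -zz -[LHS]addr0 => /addrI/esym/eqP.
    by rewrite (negPf (rd0 cm)).
  have [[pc pcl ez] cR tS] := rin _ _ _ r; rewrite !inE cR tS !orbT; split=> //.
  have [_ ok] := pieces_ok pcl.
  case/orP: ez => /andP[zX /eqP ->]; have /and3P[-> -> nX] := ok _ zX; rewrite //=.
    by apply: contra nX => /eqP <-.
  by apply: contra nX => /eqP ->.
- move=> z z' z'' c /orP[/and4P[cm rz rz' /eqP z'E]|r] /orP[/and4P[cm2 rz2 rz'2 /eqP z'E2]|r2].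
  + by rewrite z'E z'E2.
  + by rewrite rho_main in r2.
  + by rewrite rho_main in r.
  + exact: rprop r r2.
- move=> z z' c c' /orP[/and4P[cm rz rz' /eqP z'E]|r] /orP[/and4P[cm2 rz2 rz'2 /eqP z'E2]|r2].
  + have rdE : rd c = rd c' by apply: (@addrI _ z.1); rewrite -!Fsh // -z'E -z'E2.
    have [_ _ uq] := famW (rd c); have := uq z; rewrite map_cat cat_uniq => /and3P[_ _].
    rewrite /rounds -map_comp => /uniq_map_inj; apply; rewrite ?mem_filter ?eqxx -?rdE ?eqxx //=.
    by rewrite -z'E.
  + by rewrite z'E rho_F in r2.
  + by rewrite z'E2 rho_F in r.
  + exact: rcol r r2.
split.
- move=> z z' /and3P[rz rz' zz'].
  have z'E : z'.1 = z.1 + (z.1 + z'.1) by rewrite addrA Kxx add0r.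
  have [f fin z'f] := family_full (famW (z.1 + z'.1)) (sizeW _) z'E.
  have := fin; rewrite mem_cat => /orP[fW|/mapP[c]]; last first.
    rewrite mem_filter => /andP[_ cm] fF; exists c.
    by rewrite /inner_coloring cm rz rz' z'f fF eqxx.
  have [inv _ _] := famW (z.1 + z'.1); have fI := inv f fin.
  have fr : f \in rainbow_matchings.
    by apply/allpairsPdep; exists (z.1 + z'.1), f; rewrite mem_enum.
  have cov w : w \in edge_reps f -> exists c, rho w (f w) c.
    move=> wX; have [j jin wj] := chunk_of_cover s0_gt0 wX (s0_edge_reps fr).
    by apply: (rcov (chunk_of s0 (edge_reps f) j, f)) => //; apply/allpairsPdep; exists f, j.
  have : (z \in edge_reps f) || (z' \in edge_reps f).
    have fz' : f z' = z by rewrite z'f fI.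
    rewrite !inE -z'f fz' rz rz' /=.
    by case: ltngtP => // /val_inj/enum_rank_inj zE; rewrite zE eqxx in zz'.
  case/orP=> /cov[c r]; exists c; rewrite /inner_coloring.
    by rewrite z'f r orbT.
  by rewrite [X in _ || X]rsym ?orbT //; rewrite {2}z'f fI in r.
- move=> c cm.
  have uncE z : (z \in uncovered (inner_coloring rho) c) = ~~ real (F c z).
    rewrite inE; apply/andP/idP => [[rz]|nr].
      by apply: contra => rF; apply/existsP; exists (F c z); rewrite /inner_coloring cm rz rF eqxx.
    have rz : real z.
      apply: (@real_shift (rd c)); rewrite ?rd0 //.
      have : (F c z).1 = 0 by apply/eqP; move: nr; rewrite /real; case: eqP.
      by move=> F0; rewrite -[z](FI c cm) Fsh // F0 add0r.
    split=> //; apply/existsP=> -[z']; rewrite /inner_coloring rho_main // orbF.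
    by move=> /and4P[_ _ rz' /eqP z'E]; rewrite -z'E rz' in nr.
  split=> [z|].
    rewrite uncE => nr; have : (F c z).1 = 0 by apply/eqP; move: nr; rewrite /real; case: eqP.
    by rewrite Fsh // => zrd; rewrite -(addKK Kxx z.1 (rd c)) zrd add0r.
  rewrite (_ : uncovered _ _ = F c @^-1: [set z | ~~ real z]).
    by rewrite on_card_preimset ?card_dummies //; apply/onW_bij/inv_bij/FI.
  by apply/setP=> z; rewrite uncE !inE.
move=> c cR; have cm : c \notin main by apply: contraL cR; apply: notR.
have colE z z' : inner_coloring rho z z' c = rho z z' c.
  by rewrite /inner_coloring (negPf cm).
have -> : (2 * multiplicity c = #|covered rho c|)%N.
  by rewrite rcnt /multiplicity -map_piece_sizes count_map.
rewrite -cardsUI (_ : _ :&: _ = set0) ?cards0 ?addn0.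
  apply: eq_card => z; rewrite !inE; under eq_existsb => z' do rewrite colE.
  case: existsP => [[z' r]|_]; last by rewrite orbF andbT.
  rewrite orbT; have [[pc pcl ez] _ _] := rin _ _ _ r; have [_ ok] := pieces_ok pcl.
  by case/orP: ez => /andP[/ok/and3P[r1 r2 _] /eqP zE]; rewrite ?zE ?r1 ?r2.
apply/setP=> z; rewrite !inE; under eq_existsb => z' do rewrite colE.
by case: existsP; rewrite ?andbF.
Qed.

End Pieces.

Variables (R : realFieldType) (p : R).
Hypothesis p01 : 0 <= p <= 1.
Variables (Lam : nat) (e : R) (c0 : Col).
Hypotheses (d0_gt0 : (0 < d0)%N) (Lam_gt0 : (0 < Lam)%N) (leZ : (#|{: Z}| <= Lam * d0)%N).
Hypotheses (s0_ge4 : (4 <= s0)%N) (s0R : (2 * s0 <= #|Rs|)%N) (e01 : 0 <= e <= 1).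
Hypothesis qe1 : ((#|{: Z}|.+1 * #|{: Z}|.+1) ^ (40 * Lam))%:R * (1 - p) ^+ d0 <= e.
Hypothesis qe2 : (2 * (#|{: Z}|.+1 * #|Col|.+1))%:R * (1 - p) ^+ (s0 %/ 4) <= e.
Hypothesis le_d0b : (d0 <= b)%N.
Hypothesis few_pieces : (16 * size piece_sizes <= s0)%N.

(** The pieces depend on the outcome of the main pass, but the triangles needed to colour them
    contain a reserve colour and are therefore still unexposed. *)
Lemma inner_pass :
  1 - e *+ #|{: Z}| *+ size main - e *+ (7 * #|{: Z}|) *+ size piece_sizes
    <= pr p (tri real tau cols) (fun S => `[< exists col, inner_ok col S >]).
Proof.
have /andP[e0 e1] := e01.
have triE : tri real tau [set c in main] :|: tri real tau Rs \subset tri real tau cols.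
  by rewrite subUset; apply/andP; split; apply: imsetS; apply/subsetP=> -[[z z'] c];
    rewrite !inE /= => /andP[-> ->]; rewrite ?orbT.
have mono (col : Z -> Z -> pred Col) (S1 S2 : {set T}) : S1 \subset S2 -> inner_ok col S1 -> inner_ok col S2.
  move=> /subsetP sS [h1 h2 h3 h4 h5]; split=> // z z' c /h2[? ? /sS ?]; by split.
apply: le_trans (pr_subset p01 triE _); last first.
  by move=> S1 S2 sS /asboolP[col ok]; apply/asboolP; exists col; apply: mono ok.
apply: (pr_step_subr p01 (A := fun S => `[< exists F, main_ok real tau rd main F S >])).
- exact (tri_disjoint tau_inj (subsetUl _ _) (subsetUr _ _) mainR).
- by rewrite !mulrn_wge0.
- by rewrite !mulrn_wge0.
- apply: (main_pass Kxx tau_sym tau_inj p01 d0_gt0 Lam_gt0 leZ e01 qe1 main_uniq _ rd0).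
    by move=> c cm; rewrite !inE cm.
  move=> g; have [->|g0] := eqVneq g 0; last by rewrite rd_count.
  by rewrite (@eq_in_count _ _ pred0) ?count_pred0 // => c /rd0/negPf.
move=> S1 _ /asboolP[F [famF FS]].
have famW g : exists W, (shift_family g (W ++ rounds rd F main g) /\
    size (W ++ rounds rd F main g) = b) /\ (g = 0 -> W = reflections K b0).
  have [->|g0] := eqVneq g 0.
    exists (reflections K b0); rewrite /rounds (_ : [seq c <- main | _] = [::]) /=.
      by rewrite cats0 size_reflections; split=> //; split=> //; apply: reflections_family.
    by rewrite (@eq_in_filter _ _ pred0) ?filter_pred0 // => c /rd0/negPf.
  have [|W [fam sz]] := family_complete Kxx g0 (famF g).
    by rewrite /rounds size_map size_filter; have := rd_count g0; clear; lia.
  by exists W; split=> // g0'; rewrite g0' eqxx in g0.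
have [W famW'] := fin_all_exists famW.
have fam1 g : shift_family g (W g ++ rounds rd F main g) by have [[]] := famW' g.
have fam2 g : size (W g ++ rounds rd F main g) = b by have [[]] := famW' g.
have W0 : W 0 = reflections K b0 by have [_ ->] := famW' 0.
have szp : size (pieces W) = size piece_sizes by rewrite -(map_piece_sizes fam1 fam2 W0) size_map.
have sub : \bigcup_(pc <- pieces W) piece_tri Rs tau pc \subset tri real tau Rs.
  rewrite bigcup_seq; apply/bigcupsP=> pc pcl; apply/subsetP=> _ /imset2P[z c zX cR ->].
  apply: mem_tri => //; have [_ ok] := pieces_ok fam1 pcl.
  have /and3P[-> -> nX] := ok z zX; by apply: contra nX => /eqP <-.
rewrite -szp; apply: le_trans (le_trans _ (pr_subset p01 sub _)); last first.
- move=> S2 S3 sS /asboolP[col ok]; apply/asboolP; exists col; apply: mono ok.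
  exact: setUS.
- apply: le_trans (le_pr p01 (Q1 := fun S => `[< exists rho, rainbow_ok Rs tau (pieces W) rho S >]) _).
    apply: lexx.
  move=> S2 _ /asboolP[rho ok]; apply/asboolP; exists (inner_coloring F rho).
  by apply: inner_coloring_ok => //.
apply: (rainbow_pass (subsetUr _ _) tau_sym tau_inj p01 s0_ge4 e01 qe2 c0).
- exact: pieces_uniq.
- by move=> pc; apply: pieces_ok.
- by move=> pc pc' z z'; apply: pieces_edge_inj.
move=> pc pcl; have /andP[l1 l2] := card_piece pcl.
by rewrite szp geq_max l1 (leq_trans few_pieces l1) (leq_trans l2 s0R).
Qed.

End Inner.

(** * Cross edges *)

Section Cross.
Variables (R : realFieldType) (p : R).
Hypothesis p01 : 0 <= p <= 1.
Variables (Z Col T : finType) (z0 : Z) (real : pred Z) (cols : {set Col}) (tau : Z -> Z -> Col -> T).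
Hypothesis tau_inj : forall z w c z' w' c', c \in cols -> c' \in cols ->
  real z -> real w -> real z' -> real w' ->
  tau z w c = tau z' w' c' -> [/\ z = z', w = w' & c = c'].
Variables (U1 U2 : Col -> {set Z}) (s1 : nat) (e : R).
Hypotheses (s1_ge4 : (4 <= s1)%N) (e01 : 0 <= e <= 1).
Hypothesis qe : (2 * (#|Z|.+1 * #|Z|.+1))%:R * (1 - p) ^+ (s1 %/ 4) <= e.

Definition cross_tri (cs : {set Col}) : {set T} :=
  [set tau x.1.1 x.1.2 x.2 | x in [set x : Z * Z * Col |
     (real x.1.1 && real x.1.2) && (x.2 \in cs)]].

Lemma mem_cross_tri (cs : {set Col}) z w c :
  real z -> real w -> c \in cs -> tau z w c \in cross_tri cs.
Proof. by move=> rz rw cc; apply/imsetP; exists (z, w, c); rewrite // inE rz rw. Qed.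

Definition cross_ok (cs : seq Col) (h : Col -> {ffun Z -> Z}) (S : {set T}) : Prop :=
  [/\ forall c, c \in cs -> {in U1 c &, injective (h c)},
      forall c z, c \in cs -> z \in U1 c -> (h c z \in U2 c) && (tau z (h c z) c \in S)
    & forall c c' z, c \in cs -> c' \in cs -> z \in U1 c -> z \in U1 c' -> h c z = h c' z -> c = c'].

(* Colours are treated from the end of the list, so only the tail of the list can conflict with
   its head. *)
Fixpoint light (cs : seq Col) : Prop :=
  if cs is c :: cs' then
    [/\ forall z, z \in U1 c ->
          (4 * count (fun c' => (z \in U1 c') && ~~ [disjoint U2 c' & U2 c]) cs' <= #|U1 c|)%N,
        forall w, w \in U2 c ->
          (4 * count (fun c' => (w \in U2 c') && ~~ [disjoint U1 c' & U1 c]) cs' <= #|U1 c|)%N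
      & light cs']
  else True.

(** The head colour [c] needs a perfect matching between [U1 c] and [U2 c] that avoids the cross
    edges taken so far. An earlier colour [c'] takes at most one edge at [z], and this matters only
    if [z] is in [U1 c'] and [U2 c'] meets [U2 c]. By [light] at most a quarter of the possible
    partners is lost on either side, so the graph is dense enough. *)
Lemma cross_pass (cs : seq Col) : uniq cs -> {subset cs <= cols} ->
  (forall c, c \in cs -> [/\ #|U1 c| = #|U2 c|, (s1 <= #|U1 c|)%N,
     {in U1 c, forall z, real z} & {in U2 c, forall z, real z}]) ->
  light cs ->
  1 - e *+ (7 * #|Z|) *+ size cs
    <= pr p (cross_tri [set c in cs]) (fun S => `[< exists h, cross_ok cs h S >]).
Proof.
have /andP[p0 p1] := p01; have /andP[e0 e1] := e01.
elim: cs => [|c cs IH] /=.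
  move=> _ _ _ _; rewrite mulr0n subr0 (@eq_pr _ _ _ _ _ predT) ?pr_predT // => S _.
  by apply/asboolP; exists (fun=> finfun id); split.
move=> /andP[ccs uq] scs Uok [l1 l2 lcs].
have cc : c \in cols by apply: scs; rewrite mem_head.
have scs' c' : c' \in cs -> c' \in c :: cs by move=> h; rewrite inE h orbT.
have triE : cross_tri [set c' in c :: cs] = cross_tri [set c' in cs] :|: cross_tri [set c].
  apply/setP=> t; rewrite in_setU; apply/imsetP/orP.
    move=> [[[z w] c']]; rewrite !inE /= => /andP[/andP[rz rw] /predU1P[->|cin]] ->.
      by right; apply: mem_cross_tri; rewrite ?inE.
    by left; apply: mem_cross_tri; rewrite ?inE.
  by case=> /imsetP[[[z w] c']]; rewrite !inE /= => /andP[rz cin] ->;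
    exists (z, w, c'); rewrite // !inE rz cin ?orbT.
rewrite triE mulrS opprD addrA addrAC.
apply: (pr_step_subr p01 (A := fun S => `[< exists h, cross_ok cs h S >])); rewrite ?mulrn_wge0 //.
- apply/pred0P=> t /=; apply/negP=> /andP[].
  case/imsetP=> -[[z w] c1]; rewrite !inE /= => /andP[/andP[rz rw] cin] ->.
  case/imsetP=> -[[z' w'] c2]; rewrite !inE /= => /andP[/andP[rz' rw'] /eqP ->].
  case/tau_inj => //; first by apply/scs/scs'.
  by move=> _ _ c1E; rewrite -c1E cin in ccs.
- apply: IH => // c' cin; first by apply/scs/scs'.
  by apply/Uok/scs'.
move=> S1 _ /asboolP[h [hinj hin hdis]].
have [cU leU rU1 rU2] := Uok c (mem_head _ _).
pose E z w := all (fun c' => (z \in U1 c') ==> (h c' z != w)) cs.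
apply: (@le_trans _ _ (1 - e *+ (7 * #|U1 c|))).
  by rewrite lerD2l lerN2 ler_wpMn2l // leq_mul // max_card.
apply: le_trans (dense_matching (X := U1 c) (Y := U2 c) (E := E)
  (free := fun _ _ => false) (tau := fun z w => tau z w c) (D := cross_tri [set c])
  (beta := #|U1 c|) (h := #|U1 c| %/ 4) z0 p01 _ _ erefl (esym cU) _ _ _ _ e1 _) _.
- by move=> z w zU wU _ _; apply: mem_cross_tri (set11 _); [apply: rU1 | apply: rU2].
- move=> z w z' w' zU wU _ z'U w'U _ _ _ teq.
  by have [-> -> _] := tau_inj cc cc (rU1 _ zU) (rU2 _ wU) (rU1 _ z'U) (rU2 _ w'U) teq.
- by clear; lia.
- exact: leq_trans s1_ge4 leU.
- move=> z zU; set cf := [seq h c' z | c' <- cs & (z \in U1 c') && ~~ [disjoint U2 c' & U2 c]].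
  have : (#|U2 c| <= #|[set w in U2 c | E z w]| + #|[set w in cf]|)%N.
    apply: leq_trans (leq_card_setU _ _).1; apply/subset_leq_card/subsetP=> w wU.
    rewrite !inE wU /=; case: (boolP (E z w)) => //= /allPn[c' cin].
    rewrite negb_imply negbK => /andP[zc' /eqP hw]; apply/mapP; exists c' => //.
    rewrite mem_filter zc' cin andbT /=; apply/pred0Pn; exists w => /=.
    by rewrite wU andbT -hw; have /andP[] := hin c' z cin zc'.
  have : (#|[set w in cf]| <= size cf)%N by rewrite cardsE card_size.
  have := l1 z zU; rewrite -size_filter -(size_map (fun c' => h c' z)) -/cf; move: cU; clear; lia.
- move=> w wU; pose inv c' := odflt z0 [pick z in U1 c' | h c' z == w].
  set cf := [seq inv c' | c' <- cs & (w \in U2 c') && ~~ [disjoint U1 c' & U1 c]].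
  have : (#|U1 c| <= #|[set z in U1 c | E z w]| + #|[set z in cf]|)%N.
    apply: leq_trans (leq_card_setU _ _).1; apply/subset_leq_card/subsetP=> z zU.
    rewrite !inE zU /=; case: (boolP (E z w)) => //= /allPn[c' cin].
    rewrite negb_imply negbK => /andP[zc' /eqP hw]; apply/mapP; exists c'.
      rewrite mem_filter cin andbT -hw; have /andP[-> _] := hin c' z cin zc'.
      by apply/pred0Pn; exists z; rewrite /= zc'.
    rewrite /inv; case: pickP => [z' /andP[z'U /eqP hz']|/(_ z)]; last by rewrite zc' hw eqxx.
    by apply: (hinj c'); rewrite // hw hz'.
  have : (#|[set w in cf]| <= size cf)%N by rewrite cardsE card_size.
  have := l2 w wU; rewrite -size_filter -(size_map inv) -/cf; move: cU; clear; lia.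
- apply: le_trans qe; rewrite ler_wpM2l // ler_wiXn2l // ?subr_ge0 //.
    by rewrite gerBl.
  exact: leq_div2r.
apply: le_pr => // S2 _ /asboolP[k [injk kP]]; apply/asboolP.
pose h' c' := if c' == c then finfun k else h c'.
have h'c : h' c = finfun k by rewrite /h' eqxx.
have h'cs c' : c' \in cs -> h' c' = h c'.
  by move=> cin; rewrite /h'; case: eqP => // cE; rewrite -cE cin in ccs.
have new z c' : z \in U1 c -> c' \in cs -> z \in U1 c' -> h c' z != k z.
  move=> zU cin zU'; have /and3P[_ /allP/(_ c' cin)] := kP z zU.
  by rewrite zU'.
exists h'; split.
- move=> c'; rewrite inE => /predU1P[->|cin].
    by rewrite h'c => z z' zU zU'; rewrite !ffunE; apply: injk.
  by rewrite h'cs //; apply: hinj.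
- move=> c' z; rewrite inE => /predU1P[->|cin] zU.
    by rewrite h'c ffunE inE; have /and3P[-> _ /= ->] := kP z zU; rewrite orbT.
  by rewrite h'cs // inE; have /andP[-> ->] := hin c' z cin zU.
move=> c1 c2 z; rewrite !inE => /predU1P[->|cin1] /predU1P[->|cin2] // zU zU'.
- by rewrite h'c ffunE h'cs // => eqk; have := new z c2 zU cin2 zU'; rewrite eqk eqxx.
- by rewrite h'c ffunE h'cs // => eqk; have := new z c1 zU' cin1 zU; rewrite eqk eqxx.
- by rewrite !h'cs //; apply: hdis.
Qed.

End Cross.

(** * From colourings to triangles *)

Section Assembly.
Variables (V : finType) (V1 V2 C1 C2 C2' : {set V}) (S : {set {set V}}).
Let V12 := V1 :|: V2.
Let Cc := C1 :|: C2'.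
Let G := edges_meeting V12.
Hypothesis cover_all : V12 :|: (C1 :|: C2) = [set: V].
Hypothesis dis12 : [disjoint V1 & V2].
Hypothesis disVC : [disjoint V12 & C1 :|: C2].
Hypothesis dis_C : [disjoint C1 & C2].
Hypothesis sub_C2 : C2' \subset C2.
Hypothesis card_V12 : #|V12| = (#|Cc| + (#|C2| - #|C2'|) + 1)%N.

(* [M x y c]: the edge [xy] is given colour [c], i.e. [xyc] is one of the triangles. *)
Variable M : V -> V -> pred V.
Hypothesis Msym : forall x y c, M x y c -> M y x c.
Hypothesis M_in : forall x y c, M x y c ->
  [/\ x \in V12, y \in V12, x != y, c \in Cc & [set x; y; c] \in S].
Hypothesis Mproper : forall x y y' c, M x y c -> M x y' c -> y = y'.
Hypothesis Mcolor : forall x y c c', M x y c -> M x y c' -> c = c'.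
Hypothesis Mperfect : forall x c, x \in V12 -> c \in Cc -> exists y, M x y c.
Hypothesis Minner : forall x y, x != y ->
  (x \in V1) && (y \in V1) || (x \in V2) && (y \in V2) -> exists c, M x y c.

Lemma color_notin c : c \in C1 :|: C2 -> c \notin V12.
Proof.
move=> cC; apply: contraL cC => cV; have := disVC.
by rewrite disjoints_subset => /subsetP/(_ c cV); rewrite inE.
Qed.

Lemma Cc_sub c : c \in Cc -> c \in C1 :|: C2.
Proof. by rewrite !inE => /orP[->//|/(subsetP sub_C2) ->]; rewrite orbT. Qed.

Lemma mem_G a b : ([set a; b] \in G) = (a != b) && ((a \in V12) || (b \in V12)).
Proof.
apply/imset2P/andP => [[x y xV]|[ab]].
  rewrite inE => /andP[_ yx] eqs; have xy : x != y by rewrite eq_sym.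
  have := set21 a b; rewrite eqs => /set2P[|] aE; have := set22 a b; rewrite eqs => /set2P[|] bE.
  - have : y \in [set a; b] by rewrite eqs set22.
    by rewrite aE bE !inE orbb (negPf yx).
  - by rewrite aE bE xy xV.
  - by rewrite aE bE yx xV orbT.
  - have : x \in [set a; b] by rewrite eqs set21.
    by rewrite aE bE !inE orbb (negPf xy).
case/orP=> [aV|bV]; first by exists a b; rewrite // !inE eq_sym ab.
by exists b a; rewrite // ?inE ?ab // setUC.
Qed.

Definition chosen : {set {set V}} :=
  [set t | [exists x, exists y, exists c, M x y c && (t == [set x; y; c])]].

Lemma chosenP t : reflect (exists x y c, M x y c /\ t = [set x; y; c]) (t \in chosen).
Proof.
rewrite inE; apply: (iffP existsP) => [[x /existsP[y /existsP[c /andP[Mxy /eqP tE]]]]|[x [y [c [Mxy tE]]]]].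
  by exists x, y, c.
by exists x; apply/existsP; exists y; apply/existsP; exists c; rewrite Mxy tE eqxx.
Qed.

Lemma mem_triangle_edges (a b : V) (t : {set V}) :
  ([set a; b] \in triangle_edges t) = [&& a \in t, b \in t & a != b].
Proof. by rewrite inE subUset !sub1set cards2 -andbA; case: (a == b). Qed.

Lemma mem_set3 (a x y z : V) : (a \in [set x; y; z]) = [|| a == x, a == y | a == z].
Proof. by rewrite !inE orbA. Qed.

Lemma chosen_inner x y c a b : M x y c -> a \in [set x; y; c] -> b \in [set x; y; c] -> a != b ->
  a \in V12 -> b \in V12 -> M a b c /\ [set x; y; c] = [set a; b; c].
Proof.
move=> Mxy; have [_ _ _ /Cc_sub/color_notin cV _] := M_in Mxy.
rewrite !mem_set3 => /or3P[] /eqP -> /or3P[] /eqP -> ab aV bV;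
  rewrite ?eqxx // in ab; rewrite ?aV ?bV // in cV; split=> //; first exact: Msym.
by rewrite [[set x; y]]setUC.
Qed.

Lemma chosen_cross x y c a b : M x y c -> a \in [set x; y; c] -> b \in [set x; y; c] -> a != b ->
  a \in V12 -> b \notin V12 -> b = c /\ exists y', M a y' c /\ [set x; y; c] = [set a; y'; c].
Proof.
move=> Mxy; have [xV yV _ /Cc_sub/color_notin cV _] := M_in Mxy.
rewrite !mem_set3 => /or3P[] /eqP -> /or3P[] /eqP -> ab aV bV;
  rewrite ?eqxx // in ab; rewrite ?xV ?yV // in bV; rewrite ?aV // in cV; split=> //.
- by exists y.
- by exists x; split; [apply: Msym | rewrite [[set x; y]]setUC].
Qed.

(** An edge inside [V12] determines its colour, and an edge from a vertex to a colour determines the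
    partner of the vertex in that colour; either way the triangle is determined. No edge lies among
    the colours, since a chosen triangle contains only one. *)
Lemma chosen_edge_disjoint : edge_disjoint chosen.
Proof.
have aux x1 y1 c1 x2 y2 c2 a b : M x1 y1 c1 -> M x2 y2 c2 -> a != b -> a \in V12 ->
    a \in [set x1; y1; c1] -> b \in [set x1; y1; c1] ->
    a \in [set x2; y2; c2] -> b \in [set x2; y2; c2] -> [set x1; y1; c1] = [set x2; y2; c2].
  move=> M1 M2 ab aV a1 b1 a2 b2; have [bV|bV] := boolP (b \in V12).
    have [Ma1 ->] := chosen_inner M1 a1 b1 ab aV bV.
    have [Ma2 ->] := chosen_inner M2 a2 b2 ab aV bV.
    by rewrite (Mcolor Ma1 Ma2).
  have [bc1 [z1 [Ma1 ->]]] := chosen_cross M1 a1 b1 ab aV bV.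
  have [bc2 [z2 [Ma2 ->]]] := chosen_cross M2 a2 b2 ab aV bV.
  by rewrite -bc1 -bc2 in Ma1 Ma2 *; rewrite (Mproper Ma1 Ma2).
apply/forall_inP=> t1 /chosenP[x1 [y1 [c1 [M1 ->]]]].
apply/forall_inP=> t2 /chosenP[x2 [y2 [c2 [M2 ->]]]]; apply/implyP; apply: contraNT.
move=> /pred0Pn[e /andP[/= e1 e2]].
have /cards2P[a [b [ab eE]]] : #|e| == 2%N by move: (e1); rewrite inE => /andP[].
move: e1 e2; rewrite eE !mem_triangle_edges => /and3P[a1 b1 _] /and3P[a2 b2 _].
have [aV|aV] := boolP (a \in V12); first by apply/eqP; apply: (aux _ _ _ _ _ _ a b M1 M2).
have bV : b \in V12.
  move: a1 b1 ab; have [xV yV _ _ _] := M_in M1.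
  rewrite !mem_set3 => /or3P[] /eqP aE; rewrite aE ?xV ?yV // in aV *.
  by case/or3P=> /eqP -> //; rewrite eqxx.
by apply/eqP; apply: (aux _ _ _ _ _ _ b a M1 M2); rewrite // eq_sym.
Qed.

Let H := remove_triangles G chosen.

Lemma mem_H a b : ([set a; b] \in H) =
  ([set a; b] \in G) && ~~ [exists t in chosen, (a \in t) && (b \in t)].
Proof.
rewrite inE andbC; have [abG|//] := boolP ([set a; b] \in G); rewrite /=.
have ab : a != b by move: abG; rewrite mem_G => /andP[].
congr (~~ _); apply/bigcupP/exists_inP => -[t tc]; last first.
  by move=> /andP[at_ bt]; exists t; rewrite // mem_triangle_edges at_ bt.
by rewrite mem_triangle_edges => /and3P[at_ bt _]; exists t; rewrite // at_ bt.
Qed.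

Lemma mem_H_inner a b : a \in V12 -> b \in V12 ->
  ([set a; b] \in H) = (a != b) && ~~ [exists c, M a b c].
Proof.
move=> aV bV; rewrite mem_H mem_G aV /= andbT; have [//|ab /=] := eqVneq a b; congr (~~ _).
apply/exists_inP/existsP => [[t /chosenP[x [y [c [Mxy ->]]]] /andP[at_ bt]]|[c Mab]].
  by exists c; have [] := chosen_inner Mxy at_ bt ab aV bV.
exists [set a; b; c]; last by rewrite !inE !eqxx orbT.
by apply/chosenP; exists a, b, c.
Qed.

Lemma mem_H_cross a c : a \in V12 -> c \in C1 :|: C2 -> ([set a; c] \in H) = (c \notin Cc).
Proof.
move=> aV cC; have cV := color_notin cC.
have ac : a != c by apply: contraNneq cV => <-.
rewrite mem_H mem_G aV ac /=; congr (~~ _); apply/exists_inP/idP.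
  move=> [t /chosenP[x [y [c' [Mxy ->]]]] /andP[at_ ct]].
  by have [-> _] := chosen_cross Mxy at_ ct ac aV cV; have [] := M_in Mxy.
move=> /(Mperfect aV)[y May]; exists [set a; y; c]; last by rewrite !inE !eqxx orbT.
by apply/chosenP; exists a, y, c.
Qed.

Lemma nbr_H_color c : c \in C1 :|: C2 ->
  neighbours H c = if c \in Cc then set0 else V12.
Proof.
move=> cC; apply/setP=> y; rewrite inE; have [yV|yV] := boolP (y \in V12).
  by rewrite setUC mem_H_cross //; case: (c \in Cc); rewrite ?in_set0 ?yV.
rewrite mem_H mem_G (negPf yV) (negPf (color_notin cC)) /= andbF /=.
by case: (c \in Cc); rewrite ?in_set0 ?(negPf yV).
Qed.

Lemma H_tripartite : tripartite H V1 V2 (C1 :|: C2).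
Proof.
have noedge (A : {set V}) : {in A &, forall a b, a != b -> ([set a; b] \in H) = false} -> independent H A.
  move=> noA; apply/forall_inP=> e eH; apply/negP=> eA.
  have : e \in G by move: eH; rewrite inE => /andP[].
  case/imset2P=> x y xV; rewrite inE => /andP[_ yx] eE; move: eH eA; rewrite eE subUset !sub1set.
  by move=> eH /andP[xA yA]; rewrite noA // eq_sym in eH.
have inner (A : {set V}) : A \subset V12 ->
    {in A &, forall a b, a != b -> exists c, M a b c} -> independent H A.
  move=> sA Ain; apply: noedge => a b aA bA ab.
  by rewrite mem_H_inner ?(subsetP sA) // ab; apply/negbF/existsP/Ain.
rewrite /tripartite -/V12 cover_all eqxx dis12 /=; apply/andP; split.
  by have := disVC; rewrite !disjoints_subset subUset.
apply/and3P; split.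
- apply: inner => [|a b aV bV ab]; first exact: subsetUl.
  by apply: Minner; rewrite // aV bV.
- apply: inner => [|a b aV bV ab]; first exact: subsetUr.
  by apply: Minner; rewrite // aV bV orbT.
apply: noedge => a b aC bC ab; rewrite mem_H mem_G.
by rewrite (negPf (color_notin aC)) (negPf (color_notin bC)) andbF.
Qed.

(** Each vertex loses exactly one neighbour in [V12] per colour of [Cc]; the rest is the arithmetic
    of [card_V12], whose [+ 1] stands for the vertex itself. *)
Lemma H_regular : regular_on V12 (induced H V12) (#|C2| - #|C2'|).
Proof.
apply/forall_inP=> x xV; rewrite /degree.
have -> : neighbours (induced H V12) x = [set y in V12 | (x != y) && ~~ [exists c, M x y c]].
  apply/setP=> y; rewrite /neighbours /induced [LHS]in_set [LHS]in_set [RHS]in_set.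
  rewrite subUset !sub1set xV /= andbC.
  by have [yV|//] := boolP (y \in V12); rewrite mem_H_inner.
pose N := [set y | [exists c, M x y c]].
have cN : #|N| = #|Cc|.
  have [f fP] : exists f : V -> V, forall c, c \in Cc -> M x (f c) c.
    exists (fun c => odflt x [pick y | M x y c]) => c /(Mperfect xV)[y Mxy].
    by case: pickP => [//|/(_ y)]; rewrite Mxy.
  rewrite -(card_in_imset (f := f) (D := mem Cc)).
    apply: eq_card => y; rewrite inE; apply/existsP/imsetP => [[c Mxy]|[c cC ->]].
      have [_ _ _ cC _] := M_in Mxy; exists c => //.
      exact: Mproper Mxy (fP c cC).
    by exists c; apply: fP.
  move=> c c' cC c'C eqf; apply: (@Mcolor x (f c)); [exact: fP | by rewrite eqf; apply: fP].
have sN : N \subset V12 :\ x.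
  apply/subsetP=> y; rewrite in_setD1 in_set => /existsP[c Mxy].
  by have [_ -> xy _ _] := M_in Mxy; rewrite eq_sym xy.
have -> : [set y in V12 | (x != y) && ~~ [exists c, M x y c]] = (V12 :\ x) :\: N.
  by apply/setP=> y; rewrite !inE (eq_sym y x); case: (x == y); case: [exists c, _]; rewrite ?andbF ?andbT.
rewrite cardsD (setIidPr sN) cN.
by move: card_V12; rewrite (cardsD1 x) xV; lia.
Qed.

Lemma assembly : [exists TT : {set {set V}},
   let H := remove_triangles (edges_meeting (V1 :|: V2)) TT in
   [&& TT \subset S, edge_disjoint TT, tripartite H V1 V2 (C1 :|: C2),
       [forall c in C1 :|: C2', degree H c == 0%N],
       [forall c in C2 :\: C2', neighbours H c == V1 :|: V2] &
       regular_on (V1 :|: V2) (induced H (V1 :|: V2)) (#|C2| - #|C2'|)]].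
Proof.
apply/existsP; exists chosen; rewrite /= -/V12 -/G -/H chosen_edge_disjoint H_tripartite H_regular.
rewrite andbT /=; apply/and3P; split.
- by apply/subsetP=> t /chosenP[x [y [c [Mxy ->]]]]; have [] := M_in Mxy.
- apply/forall_inP=> c cC; rewrite /degree nbr_H_color ?Cc_sub // cC.
  by rewrite cards0.
apply/forall_inP=> c /setDP[cC nc]; rewrite nbr_H_color; last by rewrite inE cC orbT.
rewrite ifF ?eqxx //; apply/negP; rewrite !inE (negPf nc) orbF => cC1.
by have := dis_C; rewrite disjoints_subset => /subsetP/(_ c cC1); rewrite inE cC.
Qed.

End Assembly.

Section Labelling.
Variables (Z V : finType) (real : pred Z).

(** Mutually inverse bijections between the genuine labels and [W], written as total functions;
    their values on dummies or outside [W] are arbitrary. *)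
Definition labelling (W : {set V}) (phi : Z -> V) (psi : V -> Z) : Prop :=
  (forall z, real z -> phi z \in W /\ psi (phi z) = z) /\
  (forall x, x \in W -> real (psi x) /\ phi (psi x) = x).

Variables (W : {set V}) (phi : Z -> V) (psi : V -> Z) (cols : {set V}).
Hypotheses (lab : labelling W phi psi) (disW : [disjoint W & cols]).

Lemma color_notin_block c : c \in cols -> c \notin W.
Proof. by apply: contraL => cW; move: disW; rewrite disjoints_subset => /subsetP/(_ c cW); rewrite inE. Qed.

Lemma labelling_inj z z' : real z -> real z' -> phi z = phi z' -> z = z'.
Proof.
by move=> rz rz' eqp; rewrite -(proj2 (lab.1 z rz)) eqp (proj2 (lab.1 z' rz')).
Qed.

Lemma labelling_tau_inj z1 z2 c z1' z2' c' : c \in cols -> c' \in cols ->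
  [&& real z1, real z2 & z1 != z2] -> [&& real z1', real z2' & z1' != z2'] ->
  [set phi z1; phi z2; c] = [set phi z1'; phi z2'; c'] -> c = c' /\ [set z1; z2] = [set z1'; z2'].
Proof.
move=> cC cC' /and3P[r1 r2 _] /and3P[r1' r2' _] eqs.
have inW z : real z -> phi z \in W by move=> /lab.1[].
have aux u v u' v' d d' : real u -> real v -> real u' -> real v' -> d \in cols -> d' \in cols ->
    [set phi u; phi v; d] = [set phi u'; phi v'; d'] -> u \in [set u'; v'].
  move=> ru rv ru' rv' dC dC' eqs'; have : phi u \in [set phi u'; phi v'; d'].
    by rewrite -eqs' mem_set3 eqxx.
  rewrite mem_set3 => /or3P[] /eqP h.
  - by rewrite (labelling_inj ru ru' h) set21.
  - by rewrite (labelling_inj ru rv' h) set22.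
  - by have := color_notin_block dC'; rewrite -h inW.
split.
  have : c \in [set phi z1'; phi z2'; c'] by rewrite -eqs mem_set3 eqxx !orbT.
  rewrite mem_set3 => /or3P[] /eqP // h; have := color_notin_block cC; by rewrite h inW.
have swap (u v w : V) : [set u; v; w] = [set v; u; w] by rewrite [[set u; v]]setUC.
apply/setP/subset_eqP/andP; split; apply/subsetP=> z /set2P[] ->.
- exact: aux eqs.
- by rewrite swap in eqs; apply: aux eqs.
- exact: aux (esym eqs).
- by move/esym: eqs; rewrite swap => eqs; apply: aux eqs.
Qed.

End Labelling.

(** * Both parts and the cross edges together *)

Section Model.
Variables (K : finZmodType) (b0 a : nat).
Hypothesis Kxx : forall x : K, x + x = 0.
Local Notation b := b0.+1.
Hypothesis le_ab : (a <= b)%N.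
Local Notation Z := (K * 'I_b)%type.
Local Notation rl := (real a : pred Z).

Variables (V : finType) (V1 V2 C1 C2 C2' : {set V}).
Hypothesis cover_all : V1 :|: V2 :|: (C1 :|: C2) = [set: V].
Hypothesis dis12 : [disjoint V1 & V2].
Hypothesis disVC : [disjoint V1 :|: V2 & C1 :|: C2].
Hypothesis dis_C : [disjoint C1 & C2].
Hypothesis sub_C2 : C2' \subset C2.
Hypothesis card_V12 : #|V1 :|: V2| = (#|C1 :|: C2'| + (#|C2| - #|C2'|) + 1)%N.

Variables (phi1 phi2 : Z -> V) (psi1 psi2 : V -> Z).
Hypotheses (lab1 : labelling rl V1 phi1 psi1) (lab2 : labelling rl V2 phi2 psi2).

Variables (main : seq V) (Rs : {set V}).
Hypotheses (main_uniq : uniq main) (mainR : [disjoint [set c in main] & Rs]).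
Let cols := [set c in main] :|: Rs.
Hypothesis colsE : cols = C1 :|: C2'.

Let tau1 z z' c : {set V} := [set phi1 z; phi1 z'; c].
Let tau2 z z' c : {set V} := [set phi2 z; phi2 z'; c].
Let tauX z w c : {set V} := [set phi1 z; phi2 w; c].

Lemma dis1c : [disjoint V1 & cols].
Proof.
rewrite colsE disjoints_subset; move: disVC; rewrite disjoints_subset subUset => /andP[s1 _].
apply: subset_trans s1 _; rewrite setCS; exact: setUS.
Qed.

Lemma dis2c : [disjoint V2 & cols].
Proof.
rewrite colsE disjoints_subset; move: disVC; rewrite disjoints_subset subUset => /andP[_ s2].
apply: subset_trans s2 _; rewrite setCS; exact: setUS.
Qed.

Lemma disjoint_neq (A B : {set V}) x y : [disjoint A & B] -> x \in A -> y \in B -> x != y.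
Proof.
move=> dis xA; apply: contraTneq => <-; move: dis.
by rewrite disjoints_subset => /subsetP/(_ x xA); rewrite inE.
Qed.

Lemma tauX_inj z w c z' w' c' : c \in cols -> c' \in cols ->
  rl z -> rl w -> rl z' -> rl w' -> tauX z w c = tauX z' w' c' -> [/\ z = z', w = w' & c = c'].
Proof.
move=> cC cC' rz rw rz' rw' eqs.
have [in1 _] := lab1.1 z rz; have [in1' _] := lab1.1 z' rz'.
have [in2 _] := lab2.1 w rw; have [in2' _] := lab2.1 w' rw'.
have ne12 := disjoint_neq dis12; have ne1c := disjoint_neq dis1c; have ne2c := disjoint_neq dis2c.
split.
- have : phi1 z \in tauX z' w' c' by rewrite -eqs mem_set3 eqxx.
  rewrite mem_set3 (negPf (ne12 _ _ in1 in2')) (negPf (ne1c _ _ in1 cC')) !orbF => /eqP.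
  exact: labelling_inj lab1 _ _ rz rz'.
- have : phi2 w \in tauX z' w' c' by rewrite -eqs mem_set3 eqxx orbT.
  rewrite mem_set3 eq_sym (negPf (ne12 _ _ in1' in2)) (negPf (ne2c _ _ in2 cC')) orbF => /eqP.
  exact: labelling_inj lab2 _ _ rw rw'.
have : c \in tauX z' w' c' by rewrite -eqs mem_set3 eqxx !orbT.
by rewrite mem_set3 eq_sym (negPf (ne1c _ _ in1' cC)) eq_sym (negPf (ne2c _ _ in2' cC)) => /eqP.
Qed.

Variables (rd1 rd2 : V -> K) (d0 s0 : nat).
Hypotheses (rd1_0 : {in main, forall c, rd1 c != 0}) (rd2_0 : {in main, forall c, rd2 c != 0}).
Hypothesis rd1_count : forall g, g != 0 -> (count (fun c => rd1 c == g) main + d0 = b)%N.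
Hypothesis rd2_count : forall g, g != 0 -> (count (fun c => rd2 c == g) main + d0 = b)%N.
Hypothesis s0_gt0 : (0 < s0)%N.

Section Deterministic.
Variables (col1 col2 : Z -> Z -> pred V) (h : V -> {ffun Z -> Z}) (S1 S2 S3 : {set {set V}}).
Hypotheses (ok1 : inner_ok a tau1 main Rs rd1 d0 s0 col1 S1)
  (ok2 : inner_ok a tau2 main Rs rd2 d0 s0 col2 S2).
Let U1 c := uncovered a col1 c.
Let U2 c := uncovered a col2 c.
Variable cs : seq V.
Hypothesis csE : cs =i cols.
Hypothesis okX : cross_ok tauX U1 U2 cs h S3.

(** Both sizes are prescribed: [b - a] for a main colour, and for a reserve colour the number of
    genuine vertices minus twice its multiplicity, which is computed from the same constants in both
    parts. *)
Lemma card_uncovered c : c \in cols -> #|U1 c| = #|U2 c|.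
Proof.
have [_ _ _ _ [_ m1 r1]] := ok1; have [_ _ _ _ [_ m2 r2]] := ok2.
rewrite inE => /orP[|cR]; first by rewrite inE => cm; rewrite (m1 c cm).2 (m2 c cm).2.
by have := r1 c cR; rewrite -(r2 c cR) => /addIn.
Qed.

Let X z w c := [&& c \in cols, z \in U1 c & w == h c z].

Definition joint (x y : V) : pred V := fun c =>
  [|| [&& x \in V1, y \in V1 & col1 (psi1 x) (psi1 y) c],
      [&& x \in V2, y \in V2 & col2 (psi2 x) (psi2 y) c],
      [&& x \in V1, y \in V2 & X (psi1 x) (psi2 y) c]
    | [&& x \in V2, y \in V1 & X (psi1 y) (psi2 x) c]].

Lemma psi_inj1 x y : x \in V1 -> y \in V1 -> psi1 x = psi1 y -> x = y.
Proof. by move=> xV yV eqp; rewrite -(proj2 (lab1.2 x xV)) eqp (proj2 (lab1.2 y yV)). Qed.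

Lemma psi_inj2 x y : x \in V2 -> y \in V2 -> psi2 x = psi2 y -> x = y.
Proof. by move=> xV yV eqp; rewrite -(proj2 (lab2.2 x xV)) eqp (proj2 (lab2.2 y yV)). Qed.

Lemma notin1 x : x \in V2 -> x \in V1 = false.
Proof. by move=> xV; apply/negP=> xV'; have := disjoint_neq dis12 xV' xV; rewrite eqxx. Qed.

Lemma notin2 x : x \in V1 -> x \in V2 = false.
Proof. by move=> xV; apply/negP=> xV'; have := disjoint_neq dis12 xV xV'; rewrite eqxx. Qed.

Lemma joint11 x y c : x \in V1 -> y \in V1 -> joint x y c = col1 (psi1 x) (psi1 y) c.
Proof. by move=> xV yV; rewrite /joint xV yV !notin2 //= !orbF. Qed.

Lemma joint22 x y c : x \in V2 -> y \in V2 -> joint x y c = col2 (psi2 x) (psi2 y) c.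
Proof. by move=> xV yV; rewrite /joint xV yV !notin1 //= !orbF. Qed.

Lemma joint12 x y c : x \in V1 -> y \in V2 -> joint x y c = X (psi1 x) (psi2 y) c.
Proof. by move=> xV yV; rewrite /joint xV yV notin1 // notin2 //= !orbF. Qed.

Lemma joint21 x y c : x \in V2 -> y \in V1 -> joint x y c = X (psi1 y) (psi2 x) c.
Proof. by move=> xV yV; rewrite /joint xV yV notin1 // notin2 //=. Qed.

Lemma joint_in x y c : joint x y c -> x \in V1 :|: V2 /\ y \in V1 :|: V2.
Proof. by rewrite !inE => /or4P[] /and3P[-> ->]; rewrite ?orbT. Qed.

Lemma X_U2 z w c : X z w c -> w \in U2 c /\ tauX z w c \in S3.
Proof.
have [_ hin _] := okX; case/and3P; rewrite -csE => cC zU /eqP ->.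
by have /andP[] := hin c z cC zU.
Qed.

Lemma X_col1 z z' w c : X z w c -> col1 z z' c = false.
Proof.
case/and3P=> _; rewrite inE => /andP[_ /existsPn nz] _; exact/negbTE/nz.
Qed.

Lemma X_col2 z w w' c : X z w c -> col2 w w' c = false.
Proof.
case/X_U2; rewrite inE => /andP[_ /existsPn nz] _; exact/negbTE/nz.
Qed.

Lemma X_injl z z' w c : X z w c -> X z' w c -> z = z'.
Proof.
have [hinj _ _] := okX; case/and3P=> cC zU /eqP ->; case/and3P=> _ zU' /eqP.
by apply: hinj; rewrite ?csE.
Qed.

Lemma X_injr z w w' c : X z w c -> X z w' c -> w = w'.
Proof. by case/and3P=> _ _ /eqP -> /and3P[_ _ /eqP ->]. Qed.

Lemma X_color z w c c' : X z w c -> X z w c' -> c = c'.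
Proof.
have [_ _ hd] := okX; case/and3P=> cC zU /eqP wE; case/and3P=> cC' zU' /eqP wE'.
by apply: (hd c c' z); rewrite ?csE // -wE.
Qed.

Lemma X_surj w c : c \in cols -> w \in U2 c -> exists z, X z w c.
Proof.
have [hinj hin _] := okX => cC wU.
have : h c @: U1 c = U2 c.
  apply/eqP; rewrite eqEcard card_in_imset ?card_uncovered //; last by apply: hinj; rewrite csE.
  rewrite leqnn andbT; apply/subsetP=> _ /imsetP[z zU ->].
  by rewrite -csE in cC; have /andP[] := hin c z cC zU.
move=> imE; rewrite -imE in wU; case/imsetP: wU => z zU ->.
by exists z; rewrite /X cC zU eqxx.
Qed.

Lemma V12P x : x \in V1 :|: V2 -> x \in V1 \/ x \in V2.
Proof. by rewrite inE => /orP. Qed.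

Lemma joint_sym x y c : joint x y c -> joint y x c.
Proof.
have [sym1 _ _ _ _] := ok1; have [sym2 _ _ _ _] := ok2.
move=> J; have [/V12P[] xV /V12P[] yV] := joint_in J; move: J.
- by rewrite !joint11 //; apply: sym1.
- by rewrite joint12 // joint21.
- by rewrite joint21 // joint12.
- by rewrite !joint22 //; apply: sym2.
Qed.

Lemma joint_valid x y c : joint x y c ->
  [/\ x \in V1 :|: V2, y \in V1 :|: V2, x != y, c \in C1 :|: C2' & [set x; y; c] \in S1 :|: S2 :|: S3].
Proof.
have [_ v1 _ _ _] := ok1; have [_ v2 _ _ _] := ok2; rewrite -colsE => J.
have [xV' yV'] := joint_in J; rewrite xV' yV' /=; move: J.
case: (V12P xV') => xV; case: (V12P yV') => yV.
- rewrite joint11 // => /v1[/and3P[_ _ ne] -> tS]; split=> //.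
    by apply: contraNneq ne => ->.
  by move: tS; rewrite /tau1 (proj2 (lab1.2 x xV)) (proj2 (lab1.2 y yV)) !inE => ->.
- rewrite joint12 // => J; have [_ tS] := X_U2 J; split=> //; first exact: disjoint_neq dis12 xV yV.
    by case/and3P: J.
  by move: tS; rewrite /tauX (proj2 (lab1.2 x xV)) (proj2 (lab2.2 y yV)) inE orbC => ->.
- rewrite joint21 // => J; have [_ tS] := X_U2 J; split=> //.
  + by rewrite eq_sym; apply: disjoint_neq dis12 yV xV.
  + by case/and3P: J.
  by move: tS; rewrite /tauX (proj2 (lab1.2 y yV)) (proj2 (lab2.2 x xV)) inE orbC [[set y; x]]setUC => ->.
- rewrite joint22 // => /v2[/and3P[_ _ ne] -> tS]; split=> //.
    by apply: contraNneq ne => ->.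
  by move: tS; rewrite /tau2 (proj2 (lab2.2 x xV)) (proj2 (lab2.2 y yV)) !inE => ->; rewrite orbT.
Qed.

Lemma joint_proper x y y' c : joint x y c -> joint x y' c -> y = y'.
Proof.
have [_ _ pr1 _ _] := ok1; have [_ _ pr2 _ _] := ok2.
move=> J J'; have [/V12P[] xV /V12P[] yV] := joint_in J; have [_ /V12P[] yV'] := joint_in J';
  move: J J'.
- by rewrite !joint11 // => J J'; apply: psi_inj1 => //; apply: pr1 J J'.
- by rewrite joint11 // joint12 // => J J'; rewrite (X_col1 _ J') in J.
- by rewrite joint12 // joint11 // => J J'; rewrite (X_col1 _ J) in J'.
- by rewrite !joint12 // => J J'; apply: psi_inj2 => //; apply: X_injr J J'.
- by rewrite !joint21 // => J J'; apply: psi_inj1 => //; apply: X_injl J J'.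
- by rewrite joint21 // joint22 // => J J'; rewrite (X_col2 _ J) in J'.
- by rewrite joint22 // joint21 // => J J'; rewrite (X_col2 _ J') in J.
- by rewrite !joint22 // => J J'; apply: psi_inj2 => //; apply: pr2 J J'.
Qed.

Lemma joint_color x y c c' : joint x y c -> joint x y c' -> c = c'.
Proof.
have [_ _ _ u1 _] := ok1; have [_ _ _ u2 _] := ok2.
move=> J; have [/V12P[] xV /V12P[] yV] := joint_in J; move: J.
- by rewrite !joint11 //; apply: u1.
- by rewrite !joint12 //; apply: X_color.
- by rewrite !joint21 //; apply: X_color.
- by rewrite !joint22 //; apply: u2.
Qed.

Lemma joint_perfect x c : x \in V1 :|: V2 -> c \in C1 :|: C2' -> exists y, joint x y c.
Proof.
have [_ v1 _ _ _] := ok1; have [_ v2 _ _ _] := ok2; rewrite -colsE.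
move=> /V12P[] xV cC.
- have [rx _] := lab1.2 x xV.
  case: (boolP (psi1 x \in U1 c)) => [xU|].
    have Xx : X (psi1 x) (h c (psi1 x)) c by rewrite /X cC xU eqxx.
    have [] := X_U2 Xx; rewrite inE => /andP[rw _] _; have [yV yE] := lab2.1 _ rw.
    by exists (phi2 (h c (psi1 x))); rewrite joint12 // yE.
  rewrite inE rx negbK /= => /existsP[z' cz]; have [/and3P[_ rz' _] _ _] := v1 _ _ _ cz.
  by have [yV yE] := lab1.1 _ rz'; exists (phi1 z'); rewrite joint11 // yE.
have [rx _] := lab2.2 x xV.
case: (boolP (psi2 x \in U2 c)) => [xU|].
  have [z Xz] := X_surj cC xU.
  have : z \in U1 c by case/and3P: Xz.
  rewrite inE => /andP[rz _]; have [yV yE] := lab1.1 _ rz.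
  by exists (phi1 z); rewrite joint21 // yE.
rewrite inE rx negbK /= => /existsP[z' cz]; have [/and3P[_ rz' _] _ _] := v2 _ _ _ cz.
by have [yV yE] := lab2.1 _ rz'; exists (phi2 z'); rewrite joint22 // yE.
Qed.

Lemma joint_inner x y : x != y -> (x \in V1) && (y \in V1) || (x \in V2) && (y \in V2) ->
  exists c, joint x y c.
Proof.
have [_ _ _ _ [c1 _ _]] := ok1; have [_ _ _ _ [c2 _ _]] := ok2.
move=> xy /orP[] /andP[xV yV].
  have [rx _] := lab1.2 x xV; have [ry _] := lab1.2 y yV.
  have [|c cxy] := c1 (psi1 x) (psi1 y); last by exists c; rewrite joint11.
  by rewrite rx ry; apply: contraNneq xy => /(psi_inj1 xV yV) ->.
have [rx _] := lab2.2 x xV; have [ry _] := lab2.2 y yV.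
have [|c cxy] := c2 (psi2 x) (psi2 y); last by exists c; rewrite joint22.
by rewrite rx ry; apply: contraNneq xy => /(psi_inj2 xV yV) ->.
Qed.

End Deterministic.

Variables (R : realFieldType) (p : R).
Hypothesis p01 : 0 <= p <= 1.
Variables (Lam s1 : nat) (e : R) (c0 : V).
Hypotheses (d0_gt0 : (0 < d0)%N) (Lam_gt0 : (0 < Lam)%N) (leZ : (#|{: Z}| <= Lam * d0)%N).
Hypotheses (s0_ge4 : (4 <= s0)%N) (s0R : (2 * s0 <= #|Rs|)%N) (e01 : 0 <= e <= 1).
Hypothesis qe1 : ((#|{: Z}|.+1 * #|{: Z}|.+1) ^ (40 * Lam))%:R * (1 - p) ^+ d0 <= e.
Hypothesis qe2 : (2 * (#|{: Z}|.+1 * #|V|.+1))%:R * (1 - p) ^+ (s0 %/ 4) <= e.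
Hypothesis qe3 : (2 * (#|{: Z}|.+1 * #|{: Z}|.+1))%:R * (1 - p) ^+ (s1 %/ 4) <= e.
Hypothesis le_d0b : (d0 <= b)%N.
Hypothesis s0_round : (s0 <= round_size K b0 a)%N.
Hypothesis s0_refl : forall f, f \in reflections K b0 -> (s0 <= #|edge_reps a f|)%N.
Let np := size (piece_sizes K b0 a d0 s0).
Hypothesis few_pieces : (16 * np <= s0)%N.
Hypotheses (s1_ge4 : (4 <= s1)%N) (s1_ba : (s1 <= b - a)%N).
Hypothesis pair_count : forall i j,
  (4 * count (fun c => (rd1 c == i) && (rd2 c == j)) main <= b - a)%N.
Hypothesis real_large : (s1 + 4 * (#|Rs| + b) + 2 * np <= #|[set z : Z | rl z]|)%N.

Section Light.
Variables (col1 col2 : Z -> Z -> pred V) (S1 S2 : {set {set V}}).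
Hypotheses (ok1 : inner_ok a tau1 main Rs rd1 d0 s0 col1 S1)
  (ok2 : inner_ok a tau2 main Rs rd2 d0 s0 col2 S2).
Let U1 c := uncovered a col1 c.
Let U2 c := uncovered a col2 c.

Let main1 c z : c \in main -> z \in U1 c -> z.1 = rd1 c.
Proof. by have [_ _ _ _ [_ m1 _]] := ok1; move=> cm; apply: (m1 c cm).1. Qed.

Let main2 c z : c \in main -> z \in U2 c -> z.1 = rd2 c.
Proof. by have [_ _ _ _ [_ m2 _]] := ok2; move=> cm; apply: (m2 c cm).1. Qed.

Let card1 c : c \in main -> #|U1 c| = (b - a)%N.
Proof. by have [_ _ _ _ [_ m1 _]] := ok1; move=> cm; apply: (m1 c cm).2. Qed.

Let cardR c : c \in Rs -> (s1 + 4 * (#|Rs| + b) <= #|U1 c|)%N.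
Proof.
have [_ _ _ _ [_ _ r1]] := ok1; move=> /r1 cE.
have : (multiplicity K b0 a Rs d0 s0 c <= np)%N by rewrite /multiplicity /np count_size.
move: (multiplicity _ _ _ _ _ _ _) np real_large cE => mc nn.
by rewrite /U1; move: #|_| #|_| #|_| => x y z; clear; lia.
Qed.

Let count_le (P Q : pred V) s t : {in main, forall c, P c -> Q c} -> main = t ++ s ->
  (count P s <= count Q main)%N.
Proof.
move=> PQ mE; rewrite {1}mE count_cat; apply: leq_trans (leq_addl _ _).
have : {in s, forall c, P c -> Q c}.
  by move=> c cs; apply: PQ; rewrite mE mem_cat cs orbT.
elim: s {mE} => //= c s IH sPQ; apply: leq_add.
  by case: (boolP (P c)) => // /(sPQ c (mem_head _ _)) ->.
by apply: IH => c' cs; apply: sPQ; rewrite inE cs orbT.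
Qed.

(** Two main colours conflict only if their uncovered vertices lie in the same block of [V1] and in
    the same block of [V2], that is if they have the same pair of rounds; [pair_count] limits the
    number of such colours. *)
Lemma light_main s t : main = t ++ s -> light U1 U2 s.
Proof.
elim: s t => //= c s IH t mE.
have cm : c \in main by rewrite mE mem_cat mem_head orbT.
have mE' : main = rcons t c ++ s by rewrite cat_rcons.
split; last exact: IH mE'.
  move=> z zU; rewrite card1 //; apply: leq_trans (pair_count z.1 (rd2 c)).
  rewrite leq_mul //; apply: count_le mE' => c' cm' /andP[zU' /pred0Pn[w /andP[/= wU' wU]]].
  by rewrite (main1 cm' zU') -(main2 cm' wU') (main2 cm wU) !eqxx.
move=> w wU; rewrite card1 //; apply: leq_trans (pair_count (rd1 c) w.1).
rewrite leq_mul //; apply: count_le mE' => c' cm' /andP[wU' /pred0Pn[z /andP[/= zU' zU]]].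
by rewrite (main2 cm' wU') -(main1 cm' zU') (main1 cm zU) !eqxx.
Qed.

Let count_main (rd : V -> K) (P : V -> pred Z) z : {in main, forall c, rd c != 0} ->
  (forall g, g != 0 -> (count (fun c => rd c == g) main + d0 = b)%N) ->
  (forall c, c \in main -> P c z -> z.1 = rd c) -> (count (fun c => P c z) main <= b)%N.
Proof.
move=> rd0 rdc Prd; apply: (@leq_trans (count (fun c => rd c == z.1) main)).
  by apply: (@count_le _ _ main [::]) => // c cm /(Prd c cm) ->.
have [z0|z0] := eqVneq z.1 0; last first.
  by apply: leq_trans (leq_addr d0 _) _; rewrite rdc.
by rewrite (@eq_in_count _ _ pred0) ?count_pred0 // => c /rd0; rewrite z0 => /negPf.
Qed.

(** The reserve colours stand in front, hence are treated last. Their uncovered sets are large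
    enough to tolerate all other reserve colours together with the main colours that leave a given
    vertex uncovered, of which there are at most [b] since they share one round. *)
Lemma light_all r : uniq r -> {subset r <= Rs} -> light U1 U2 (r ++ main).
Proof.
elim: r => [_ _|c r IH] /=; first exact: (@light_main main [::]).
move=> /andP[cr uq] sr; have cR : c \in Rs by apply: sr; rewrite mem_head.
have sr' c' : c' \in r -> c' \in Rs by move=> h; apply: sr; rewrite inE h orbT.
have szr : (size r <= #|Rs|)%N.
  rewrite -(card_uniqP uq); apply/subset_leq_card/subsetP=> c'; exact: sr'.
have cb (P : pred V) : (count P main <= b)%N -> (4 * count P (r ++ main) <= #|U1 c|)%N.
  move=> cP; apply: leq_trans (cardR cR); apply: leq_trans (leq_addl _ _).
  by rewrite leq_mul2l /= count_cat leq_add // (leq_trans (count_size _ _)).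
split; last exact: IH.
  move=> z zU; apply: cb; apply: leq_trans (_ : count (fun c' => z \in U1 c') main <= _)%N.
    by apply: sub_count => c' /andP[].
  by apply: (@count_main rd1 (fun c z => z \in U1 c)) => // c' cm; apply: main1.
move=> z zU; apply: cb; apply: leq_trans (_ : count (fun c' => z \in U2 c') main <= _)%N.
  by apply: sub_count => c' /andP[].
by apply: (@count_main rd2 (fun c z => z \in U2 c)) => // c' cm; apply: main2.
Qed.

Lemma card_uncovered_ge c : c \in cols -> (s1 <= #|U1 c|)%N.
Proof.
rewrite inE => /orP[|/cardR]; last by apply: leq_trans; rewrite leq_addr.
by rewrite inE => /card1 ->.
Qed.

End Light.

Lemma triangle_in x y c : x \in V1 :|: V2 -> y \in V1 :|: V2 -> x != y -> c \in cols ->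
  [set x; y; c] \in triangles (edges_meeting (V1 :|: V2)).
Proof.
move=> xV yV xy cC; have cV : c \notin V1 :|: V2.
  apply: (color_notin disVC); move: cC; rewrite colsE; apply: Cc_sub => //.
have xc : x != c by apply: contraNneq cV => <-.
have yc : y != c by apply: contraNneq cV => <-.
rewrite inE; apply/andP; split.
  by rewrite setUC cardsU1 cards2 xy in_set2 negb_or (eq_sym c x) (eq_sym c y) xc yc.
apply/subsetP=> t; rewrite inE => /andP[st /cards2P[u [v [uv tE]]]].
rewrite tE mem_G uv /=; move: st; rewrite tE subUset !sub1set !mem_set3.
case/andP=> /or3P[] /eqP uE; rewrite ?uE ?xV ?yV //.
case/or3P=> /eqP vE; [by rewrite vE xV orbT | by rewrite vE yV orbT |].
by move: uv; rewrite uE vE eqxx.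
Qed.

Lemma set3_disjoint (x y c : V) (A : {set V}) :
  [disjoint [set x; y; c] & A] = [&& x \notin A, y \notin A & c \notin A].
Proof. by rewrite disjoints_subset !subUset !sub1set !inE -andbA. Qed.

Let fail1 := e *+ #|{: Z}| *+ size main + e *+ (7 * #|{: Z}|) *+ np.
Let fail2 := e *+ (7 * #|{: Z}|) *+ (#|Rs| + size main).

(** The triangles with two vertices in [V1], with two in [V2], and with one in each form three
    disjoint families. So the cross pass may use the uncovered sets produced by the two inner
    passes. *)
Lemma model_pass : 1 - fail1 - fail1 - fail2 <= pr p (triangles (edges_meeting (V1 :|: V2)))
  (fun S => [exists TT : {set {set V}},
   let H := remove_triangles (edges_meeting (V1 :|: V2)) TT in
   [&& TT \subset S, edge_disjoint TT, tripartite H V1 V2 (C1 :|: C2),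
       [forall c in C1 :|: C2', degree H c == 0%N],
       [forall c in C2 :\: C2', neighbours H c == V1 :|: V2] &
       regular_on (V1 :|: V2) (induced H (V1 :|: V2)) (#|C2| - #|C2'|)]]).
Proof.
have /andP[e0 e1] := e01.
have f1 : 0 <= fail1 by rewrite addr_ge0 ?mulrn_wge0.
have f2 : 0 <= fail2 by rewrite !mulrn_wge0.
have inj1 := labelling_tau_inj lab1 dis1c; have inj2 := labelling_tau_inj lab2 dis2c.
have sym1 z z' c : tau1 z z' c = tau1 z' z c by rewrite /tau1 [[set phi1 z; _]]setUC.
have sym2 z z' c : tau2 z z' c = tau2 z' z c by rewrite /tau2 [[set phi2 z; _]]setUC.
pose D1 := tri rl tau1 cols; pose D2 := tri rl tau2 cols; pose D3 := cross_tri rl tauX cols.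
have cN1 c : c \in cols -> c \notin V1 by move/(color_notin_block dis1c).
have cN2 c : c \in cols -> c \notin V2 by move/(color_notin_block dis2c).
have D1P t : t \in D1 -> [disjoint t & V2] && ~~ [disjoint t & V1].
  case/imsetP=> -[[z z'] c]; rewrite inE /= => /andP[/and3P[rz rz' _] cC] ->.
  have [iz _] := lab1.1 z rz; have [iz' _] := lab1.1 z' rz'.
  by rewrite !set3_disjoint (notin2 iz) (notin2 iz') (cN2 _ cC) iz.
have D2P t : t \in D2 -> [disjoint t & V1] && ~~ [disjoint t & V2].
  case/imsetP=> -[[z z'] c]; rewrite inE /= => /andP[/and3P[rz rz' _] cC] ->.
  have [iz _] := lab2.1 z rz; have [iz' _] := lab2.1 z' rz'.
  by rewrite !set3_disjoint (notin1 iz) (notin1 iz') (cN1 _ cC) iz.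
have D3P t : t \in D3 -> ~~ [disjoint t & V1] && ~~ [disjoint t & V2].
  case/imsetP=> -[[z z'] c]; rewrite inE /= => /andP[/andP[rz rz'] cC] ->.
  have [iz _] := lab1.1 z rz; have [iz' _] := lab2.1 z' rz'.
  by rewrite !set3_disjoint iz iz' /= !andbF.
have dis_12 : [disjoint D1 & D2].
  by apply/pred0P=> t /=; apply/negP=> /andP[/D1P/andP[_ /negP h] /D2P/andP[/h]].
have dis_123 : [disjoint D1 :|: D2 & D3].
  apply/pred0P=> t /=; apply/negP=> /andP[/setUP[/D1P/andP[h _]|/D2P/andP[h _]] /D3P/andP[h1 h2]].
    by rewrite h in h2.
  by rewrite h in h1.
have subD : D1 :|: D2 :|: D3 \subset triangles (edges_meeting (V1 :|: V2)).
  rewrite !subUset -andbA; apply/and3P; split; apply/subsetP=> t /imsetP[[[z z'] c]];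
    rewrite inE /= => /andP[].
  - case/and3P=> rz rz' zz' cC ->; have [iz _] := lab1.1 z rz; have [iz' _] := lab1.1 z' rz'.
    apply: triangle_in; rewrite ?inE ?iz ?iz' //.
      by apply: contraNneq zz' => /(labelling_inj lab1 rz rz') ->.
    by move: cC; rewrite !inE.
  - case/and3P=> rz rz' zz' cC ->; have [iz _] := lab2.1 z rz; have [iz' _] := lab2.1 z' rz'.
    apply: triangle_in; rewrite ?inE ?iz ?iz' ?orbT //.
      by apply: contraNneq zz' => /(labelling_inj lab2 rz rz') ->.
    by move: cC; rewrite !inE.
  - case/andP=> rz rz' cC ->; have [iz _] := lab1.1 z rz; have [iz' _] := lab2.1 z' rz'.
    apply: triangle_in; rewrite ?inE ?iz ?iz' ?orbT //; first exact: disjoint_neq dis12 iz iz'.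
    by move: cC; rewrite !inE.
(* The event is increasing in the set of available triangles, so it suffices to expose the three
   families. *)
apply: le_trans (pr_subset p01 subD _); last first.
  move=> S S' sS /existsP[TT /and5P[h1 h2 h3 h4 h5]]; apply/existsP; exists TT.
  by apply/and5P; split=> //; apply: subset_trans h1 sS.
pose A (S : {set {set V}}) := `[<
  exists (col1 col2 : Z -> Z -> pred V) (S1 S2 : {set {set V}}), [/\ S1 \subset S, S2 \subset S,
   inner_ok a tau1 main Rs rd1 d0 s0 col1 S1 & inner_ok a tau2 main Rs rd2 d0 s0 col2 S2] >].
have -> : 1 - fail1 - fail1 = 1 - (fail1 + fail1) by ring.
apply: (pr_step_subr p01 (A := A)) => //; first exact: addr_ge0.
  rewrite opprD addrA.
  apply: (pr_step_subr p01 (A := fun S => `[< exists col, inner_ok a tau1 main Rs rd1 d0 s0 col S >])) => //.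
    rewrite /fail1 opprD addrA.
    exact: (inner_pass Kxx le_ab main_uniq mainR sym1 inj1 rd1_0 rd1_count s0_gt0
             s0_round s0_refl p01 c0 d0_gt0 Lam_gt0 leZ s0_ge4 s0R e01 qe1 qe2 le_d0b few_pieces).
  move=> S1 _ /asboolP[col1 ok1].
  apply: le_trans (_ : pr p D2 (fun S => `[< exists col, inner_ok a tau2 main Rs rd2 d0 s0 col S >]) <= _).
    rewrite /fail1 opprD addrA.
    exact: (inner_pass Kxx le_ab main_uniq mainR sym2 inj2 rd2_0 rd2_count s0_gt0
             s0_round s0_refl p01 c0 d0_gt0 Lam_gt0 leZ s0_ge4 s0R e01 qe1 qe2 le_d0b few_pieces).
  apply: le_pr => // S2 _ /asboolP[col2 ok2]; apply/asboolP.
  by exists col1, col2, S1, S2; split=> //; [apply: subsetUl | apply: subsetUr].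
move=> S _ /asboolP[col1 [col2 [S1 [S2 [sS1 sS2 ok1 ok2]]]]].
pose cs := enum Rs ++ main.
have csE : cs =i cols by move=> c; rewrite mem_cat !inE mem_enum orbC.
have z0 : Z := (0, ord0).
have cs_uniq : uniq cs.
  rewrite cat_uniq enum_uniq main_uniq andbT /=; apply/hasPn=> c cm; rewrite /= mem_enum.
  by move: mainR; rewrite disjoints_subset => /subsetP/(_ c); rewrite !inE; apply.
have szcs : size cs = (#|Rs| + size main)%N by rewrite size_cat -cardE.
have lt : light (uncovered a col1) (uncovered a col2) cs.
  by apply: light_all ok1 ok2 _ _ _; [exact: enum_uniq | move=> c; rewrite mem_enum].
have setcs : [set c in cs] = cols by apply/setP=> c; rewrite inE csE.
have := cross_pass (cs := cs) p01 z0 tauX_inj s1_ge4 e01 qe3 cs_uniq _ _ lt.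
rewrite szcs setcs => /(_ _ _)/le_trans; apply.
- by move=> c; rewrite csE.
- move=> c; rewrite csE => cC; split.
  + exact: card_uncovered ok1 ok2 _ cC.
  + exact: card_uncovered_ge ok1 _ cC.
  + by move=> z; rewrite inE => /andP[].
  + by move=> z; rewrite inE => /andP[].
apply: le_pr => // S3 _ /asboolP[h okX].
apply: (@assembly _ _ _ _ _ _ _ _ _ _ _ _ _ (joint col1 col2 h)) => //.
- by move=> x y c; apply: joint_sym ok1 ok2 _ _ _.
- move=> x y c J; have [? ? ? ?] := joint_valid ok1 ok2 csE okX J; split=> //.
  by apply: subsetP _ _ _; last eassumption; rewrite !setSU // subUset sS1 sS2.
- by move=> x y y' c J J'; exact: (joint_proper ok1 ok2 csE okX J J').
- by move=> x y c c' J J'; exact: (joint_color ok1 ok2 csE okX J J').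
- by move=> x c xV cC; exact: (joint_perfect ok1 ok2 csE okX xV cC).
- by move=> x y; exact: (joint_inner h ok1 ok2).
Qed.

End Model.

Lemma exists_labelling (Z V : finType) (z0 : Z) (x0 : V) (real : pred Z) (W : {set V}) :
  #|[set z | real z]| = #|W| -> exists phi psi, labelling real W phi psi.
Proof.
set A := [set z | real z] => cAW.
exists (fun z => nth x0 (enum W) (index z (enum A))), (fun x => nth z0 (enum A) (index x (enum W))).
split=> [z rz|x xW].
  have lti : (index z (enum A) < size (enum W))%N.
    by rewrite -cardE -cAW cardE index_mem mem_enum inE.
  rewrite -mem_enum mem_nth // index_uniq ?enum_uniq //.
  by rewrite nth_index // mem_enum inE.
have lti : (index x (enum W) < size (enum A))%N.
  by rewrite -cardE cAW cardE index_mem mem_enum.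
have : nth z0 (enum A) (index x (enum W)) \in A by rewrite -mem_enum mem_nth.
rewrite inE => ->; rewrite index_uniq ?enum_uniq //.
by rewrite nth_index // mem_enum.
Qed.

(** * Assigning pairs of rounds to the main colours *)

Section Schedule.
Local Open Scope nat_scope.
Variables (K : finZmodType) (V : finType) (Cc : {set V}) (w : nat).

Lemma card_nonzero : #|[set g : K | g != 0%R]| = #|K|.-1.
Proof.
rewrite (_ : [set g : K | g != 0%R] = [set~ 0%R]); first by rewrite cardsC1.
by apply/setP=> g; rewrite !inE.
Qed.

Let NZ := setX [set g : K | g != 0%R] [set g : K | g != 0%R].
Let L := flatten (nseq w (enum NZ)).

Let count_L (P : pred (K * K)) : count P L = w * #|[set x in NZ | P x]|.
Proof.
rewrite count_flatten map_nseq sumn_nseq mulnC; congr (_ * _).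
rewrite -size_filter cardE; apply/perm_size/uniq_perm.
- exact: filter_uniq (enum_uniq _).
- exact: enum_uniq.
by move=> x; rewrite mem_filter !mem_enum [RHS]inE andbC.
Qed.

(** Each pair of nonzero rounds, one for [V1] and one for [V2], is given to [w] colours. Every
    single round then has the same load, while few colours share both rounds; giving a colour the
    same round in both parts would create too many conflicts between cross edges. *)
Lemma schedule : w * #|K|.-1 ^ 2 <= #|Cc| -> exists main (rd : V -> K * K),
  [/\ uniq main, {subset main <= Cc}, size main = w * #|K|.-1 ^ 2,
      forall c, c \in main -> ((rd c).1 != 0%R) && ((rd c).2 != 0%R)
    & [/\ forall g, g != 0%R -> count (fun c => (rd c).1 == g) main = #|K|.-1 * w,
          forall g, g != 0%R -> count (fun c => (rd c).2 == g) main = #|K|.-1 * w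
        & forall i j, count (fun c => ((rd c).1 == i) && ((rd c).2 == j)) main <= w]].
Proof.
move=> leC; set M := _ * _ in leC *.
pose main := take M (enum Cc); pose rd c := nth (0, 0)%R L (index c main).
have uq : uniq main by rewrite take_uniq ?enum_uniq.
have szm : size main = M by rewrite size_takel // -cardE.
have szL : size L = M.
  rewrite -(count_predT L) count_L (_ : [set x in NZ | _] = NZ) ?cardsX ?card_nonzero ?mulnn //.
  by apply/setP=> x; rewrite inE andbT.
have mapL : [seq rd c | c <- main] = L.
  apply: (@eq_from_nth _ (0, 0)%R); rewrite size_map ?szm ?szL // => i ltiM.
  have x0 : V by case: (main) szm ltiM => [<-|].
  by rewrite (nth_map x0) ?szm // /rd index_uniq ?szm.
have cntm P : count (fun c => P (rd c)) main = w * #|[set x in NZ | P x]|.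
  by rewrite -count_L -mapL count_map.
exists main, rd; split=> //.
- by move=> c /mem_take; rewrite mem_enum.
- move=> c cm; have : rd c \in L by rewrite -mapL map_f.
  by move=> /flattenP[s /nseqP[-> _]]; rewrite mem_enum !inE.
split=> [g g0|g g0|i j].
- rewrite (cntm (fun x => x.1 == g)) mulnC; congr (_ * _).
  rewrite -card_nonzero -[RHS]mul1n -(cards1 g) -cardsX; apply: eq_card => -[x y].
  by rewrite !inE /=; case: (eqVneq x g) => [->|_]; rewrite ?g0 ?andbT ?andbF.
- rewrite (cntm (fun x => x.2 == g)) mulnC; congr (_ * _).
  rewrite -card_nonzero -[RHS]muln1 -(cards1 g) -cardsX; apply: eq_card => -[x y].
  by rewrite !inE /=; case: (eqVneq y g) => [->|_]; rewrite ?g0 ?andbT ?andbF.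
rewrite (cntm (fun x => (x.1 == i) && (x.2 == j))) -[X in _ <= X]muln1 leq_mul //.
rewrite -(cards1 (i, j)); apply/subset_leq_card/subsetP=> -[x y]; rewrite !inE /=.
by move=> /andP[_ /andP[/eqP -> /eqP ->]].
Qed.

End Schedule.

Section PieceBounds.
Local Open Scope nat_scope.
Variables (K : finZmodType) (b0 a d0 s0 : nat).
Local Notation b := b0.+1.

Lemma size_matching_sizes : size (matching_sizes K b0 a d0) = b + #|K|.-1 * d0.
Proof.
rewrite size_flatten /shape -map_comp sumnE big_map big_enum /= (bigD1 0%R) //= eqxx.
rewrite size_map size_reflections; congr (_ + _).
rewrite (eq_bigr (fun=> d0)) => [|g /negPf ->]; last by rewrite size_nseq.
by rewrite sum_nat_const -card_nonzero; congr (_ * _); apply: eq_card => g; rewrite !inE.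
Qed.

Lemma size_piece_sizes :
  size (piece_sizes K b0 a d0 s0) <= (b + #|K|.-1 * d0) * (#|K| * b %/ s0).
Proof.
rewrite size_flatten /shape -map_comp sumnE big_map -size_matching_sizes.
have small z : z \in matching_sizes K b0 a d0 -> z <= #|K| * b.
  case/flattenP=> s /mapP[g _ ->]; case: ifP => _.
    by case/mapP=> f _ ->; apply: leq_trans (max_card _) _; rewrite card_prod card_ord.
  case/nseqP=> -> _; apply: leq_trans (leq_div _ _) _; apply: leq_trans (leq_subr _ _) _.
  by apply: leq_trans (max_card _) _; rewrite card_prod card_ord.
move: (matching_sizes _ _ _ _) small => ms small.
rewrite big_seq; apply: (@leq_trans (\sum_(z <- ms | z \in ms) (#|K| * b %/ s0))).
  by apply: leq_sum => z zm; rewrite /= size_map size_iota leq_div2r // small.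
by rewrite -big_seq big_const_seq count_predT iter_addn_0 mulnC.
Qed.

(** Only the nonzero blocks are counted: they contain no dummies, and a reflection fixes at most two
    labels in each. *)
Lemma card_edge_reps_reflection f : f \in reflections K b0 ->
  #|K|.-1 * (b - 2) <= 2 * #|edge_reps a f|.
Proof.
move=> fr; have [inv _ _] := reflections_family K b0.
have fI := inv f fr; case/mapP: fr => s _ fE.
pose W := [set z : K * 'I_b | (z.1 != 0%R) && (f z != z)].
have half := @card_involution_half _ f W fI.
have Wf z : z \in W -> (f z \in W) && (f z != z).
  rewrite !inE fI => /andP[z0 fz]; rewrite (eq_sym z) fz !andbT.
  by rewrite fE ffunE z0.
have cW : #|K|.-1 * (b - 2) <= #|W|.
  have -> : W = setX [set g : K | g != 0%R] (~: [set l : 'I_b | (s - l)%R == l]).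
    apply/setP=> -[u l]; rewrite !inE fE ffunE /=; congr (_ && ~~ _).
    by apply/eqP/eqP => [[]|->].
  rewrite cardsX card_nonzero leq_mul //.
  by have := cardsC [set l : 'I_b | (s - l)%R == l]; have := card_label_fixed s; rewrite card_ord; lia.
apply: leq_trans cW _; rewrite -(half Wf) leq_mul2l /=; apply/subset_leq_card/subsetP=> z.
by rewrite !inE => /andP[/andP[z0 fz] ->]; rewrite /real z0 fE ffunE /= z0.
Qed.

End PieceBounds.

(** * Choice of the constants *)

Section Numerics.
Local Open Scope nat_scope.
Variables (n k1 E m : nat).
Local Notation k := k1.+1.
Hypotheses (E100 : 100 <= E) (kE : 4800 * E ^ 2 <= k) (nk : 200 * k ^ 4 <= n).
Hypotheses (nEm : n <= 2 * E * m) (mn : 100 * m <= n).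

Let b := n %/ k1.
Let a := n %% k1.
Let w := b %/ k.
Let d0 := b - k1 * w.
Let s0 := m %/ 2.
Let s1 := b %/ 2.

Lemma k_ge1000 : 1000 <= k.
Proof. by clear -E100 kE; nia. Qed.

Lemma nE : n = b * k1 + a.
Proof. exact: divn_eq. Qed.

Lemma a_lt : a < k1.
Proof. by rewrite ltn_mod; have := k_ge1000; clear; lia. Qed.

Lemma b_large : 100 * k ^ 3 <= b.
Proof.
have := nE; have := a_lt; have := k_ge1000; move: nk; move: (b) (a) => b' a'; clear; nia.
Qed.

Lemma wE : exists2 c, c < k & b = w * k + c.
Proof. by exists (b %% k); [rewrite ltn_mod | exact: divn_eq]. Qed.

Lemma d0E : d0 + k1 * w = b.
Proof.
by rewrite /d0 subnK //; have [c _ ->] := wE; move: (w) => w'; clear; nia.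
Qed.

Lemma kd0 : b <= k * d0 <= b + k ^ 2.
Proof.
have := d0E; have [c] := wE; move: (b) (w) (d0) => b' w' d'; clear; nia.
Qed.

Lemma k1d0 : k1 * d0 <= 2 * b.
Proof.
have := kd0; have := b_large; have := k_ge1000; move: (b) (d0) => b' d'; clear; nia.
Qed.

Lemma n_le_kb : n <= k * b <= 2 * n.
Proof.
have := nE; have := a_lt; have := b_large; have := k_ge1000; move: (b) (a) => b' a'; clear; nia.
Qed.

Lemma m_large : 4 * E <= m.
Proof. by move: nEm nk kE E100 k_ge1000; clear; nia. Qed.

Lemma s0_large : n <= 5 * E * s0.
Proof.
have : m = s0 * 2 + m %% 2 by exact: divn_eq.
have : m %% 2 < 2 by rewrite ltn_mod.
have := m_large; move: nEm E100; move: (s0) (m %% 2) => s' c; clear; nia.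
Qed.

(** This is what forces [k] to be of order [E ^ 2]. There are at most [3 * b] matchings, each cut
    into at most [k * b / s0] pieces, so [48 * k * b ^ 2 <= s0 ^ 2] is needed; as [s0] is at least
    [n / (5 * E)] and [n >= b * k1], this reduces to [1200 * E ^ 2 * k <= k1 ^ 2]. *)
Lemma piece_count_bound : 16 * ((b + k1 * d0) * (k * b %/ s0)) <= s0.
Proof.
have s00 : 0 < s0 by rewrite divn_gt0 //; have := m_large; move: E100; clear; lia.
rewrite -(leq_pmul2r s00); have h := leq_trunc_div (k * b) s0.
apply: (@leq_trans (48 * b * (k * b))).
  have := k1d0; move: h; move: (_ %/ _) => x; move: (k * b) (k1 * d0) (b) (s0) => y z b' s'; clear; nia.
have h5 := s0_large; rewrite -(@leq_pmul2l (25 * E ^ 2)); last by move: E100; clear; nia.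
apply: (@leq_trans (n ^ 2)); last by move: h5; move: (s0) => s'; clear; nia.
apply: (@leq_trans ((b * k1) ^ 2)); last by rewrite leq_exp2r // nE leq_addr.
rewrite expnMn; apply: (@leq_trans (b ^ 2 * (1200 * E ^ 2 * k))).
  by apply: eq_leq; rewrite /=; move: (b) (k) => b' k'; clear; nia.
rewrite leq_mul2l; apply/orP; right.
have := k_ge1000; move: kE; clear; nia.
Qed.

Lemma main_lt : w * k1 ^ 2 < n.
Proof.
have := nE; have [c] := wE; have := b_large; have := k_ge1000.
move: (b) (a) (w) => b' a' w'; clear; nia.
Qed.

Lemma main_large : k * (n - w * k1 ^ 2) <= 2 * n.
Proof.
have lt := main_lt; have h1 := nE; have [c h2 h3] := wE; have h4 := a_lt.
have h5 := b_large; have h6 := k_ge1000.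
have : k * n <= 2 * n + k * (w * k1 ^ 2).
  have -> : k * (w * k1 ^ 2) = (b - c) * k1 ^ 2 by rewrite h3 addnK; move: (w) => w'; clear; nia.
  have : c * k1 ^ 2 <= k ^ 3 by move: h2; clear; nia.
  have : b * k1 ^ 2 + k * a = k1 * n + a by rewrite h1; move: (b) (a) => b' a'; clear; nia.
  have : k ^ 3 + k * a <= n by move: h4 nk h6; move: (a) => a'; clear; nia.
  have : c <= b by rewrite h3 leq_addl.
  rewrite mulnBl; move: (b * k1 ^ 2) (c * k1 ^ 2) (k * a) (k ^ 3) => x y z u.
  by rewrite mulSn; move: (k1 * n) (a) => v a'; clear; lia.
by rewrite mulnBr; clear; lia.
Qed.

Lemma a_small : 2 * a <= b.
Proof.
have := a_lt; have := b_large; have := k_ge1000; move: (b) (a) => b' a'; clear; nia.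
Qed.

Lemma w_pair : 4 * w <= b - a.
Proof.
have := a_small; have := k_ge1000; have [c _] := wE.
move: (b) (a) (w) => b' a' w'; clear; nia.
Qed.

Lemma s1_bounds : 4 <= s1 <= b - a.
Proof.
have := a_small; have := b_large; have := k_ge1000; rewrite /s1.
have : 100 * k <= 100 * k ^ 3 by clear; nia.
move: (b) (a) (k ^ 3) => b' a' x; clear; lia.
Qed.

Lemma s0_bounds : 4 <= s0 /\ 2 * s0 <= m.
Proof. by have := m_large; move: E100; rewrite /s0; clear; lia. Qed.

Lemma d0_bounds : [/\ 0 < d0, d0 <= b & k * b <= k ^ 2 * d0].
Proof.
have := d0E; have := kd0; have := b_large; have := k_ge1000.
move: (b) (d0) (w) => b' d' w'; clear; split; nia.
Qed.

Lemma reserve_small : 100 * (n - 1 + m - w * k1 ^ 2) <= 2 * n.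
Proof.
have := main_large; have := main_lt; have := k_ge1000; move: mn.
move: (w * k1 ^ 2) => M; clear; nia.
Qed.

Lemma b_small : 100 * b <= n.
Proof. by have := nE; have := k_ge1000; move: (b) (a) => b' a'; clear; nia. Qed.

Lemma round_bound : s0 <= (n - (b - a)) %/ 2.
Proof.
have := b_small; have := s0_bounds; move: mn; move: (b) (a) (s0) => b' a' s'; clear; lia.
Qed.

Lemma reflection_bound x : k1 * (b - 2) <= 2 * x -> s0 <= x.
Proof.
have := nE; have := a_lt; have := b_large; have := k_ge1000; have := s0_bounds; move: mn.
have := b_small; have := a_small.
move: (b) (a) (s0) => b' a' s' h1 h2 h3 [_ h4] h5 h6 h7 h8.
have : k1 * (b' - 2) + 2 * k1 + a' = n by rewrite h8; move: h5 h6; clear; nia.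
have : 6 * k1 <= n by rewrite h8; move: h5 h6; clear; nia.
move: h4 h3 h7; move: (k1 * _) => y; clear; lia.
Qed.

Lemma reserve_light np : 16 * np <= s0 ->
  s1 + 4 * (n - 1 + m - w * k1 ^ 2 + b) + 2 * np <= n.
Proof.
have := reserve_small; have := b_small; have [_] := s0_bounds; move: mn; rewrite /s1.
move: (n - 1 + m - _) (b) (s0) => r b' s'; clear; lia.
Qed.

(** All three kinds of matching steps have an exponent of at least [n / k ^ 2], which turns powers
    of [1 - p] into negative powers of [n] of order [C / k ^ 2]. *)
Lemma exponents : [/\ n <= k ^ 2 * d0, n <= k ^ 2 * (s0 %/ 4) & n <= k ^ 2 * (s1 %/ 4)].
Proof.
have [h1 h2 h3] := d0_bounds; have /andP[h4 _] := n_le_kb; split.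
- exact: leq_trans h4 h3.
- have := s0_large; have [h5 _] := s0_bounds; move: kE E100.
  have : s0 <= 8 * (s0 %/ 4) by move: h5; clear; lia.
  move: (s0) (s0 %/ 4) => s' x; clear => l1 l2 l3 l4.
  apply: leq_trans l4 _; apply: (@leq_trans (40 * E * x)); first by move: l1; clear; nia.
  by rewrite leq_mul2r; apply/orP; right; move: l2 l3; clear; nia.
have /andP[h5 _] := s1_bounds; apply: leq_trans h4 _.
have : s1 <= 8 * (s1 %/ 4) by move: h5; clear; lia.
have : b <= 3 * s1 by move: h5; rewrite /s1; clear; lia.
have := k_ge1000; move: (b) (s1) (s1 %/ 4) => b' s' x; clear; nia.
Qed.

End Numerics.

(** By [1 - p <= expR (- p)], the left side is at most [expR (- p * x)], and [p * x] is at least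
    [y * ln n]. *)
Lemma onesub_expn_le (R : realType) (n x y : nat) (p C : R) :
  (1 < n)%N -> p <= 1 -> C * ln n%:R / n%:R <= p -> y%:R * n%:R <= C * x%:R ->
  (1 - p) ^+ x <= n%:R^-1 ^+ y.
Proof.
move=> n1 p1 Cp yC; have n0 : (0 : R) < n%:R by rewrite ltr0n ltnW.
have lnn : 0 <= ln (n%:R : R) by rewrite ln_ge0 // ler1n ltnW.
apply: (@le_trans _ _ (expR (- p) ^+ x)).
  by apply: lerXn2r; rewrite ?nnegrE ?subr_ge0 ?expR_ge0 //; apply: expR_ge1Dx.
have -> : n%:R^-1 = expR (- ln n%:R) :> R by rewrite expRN lnK ?posrE.
rewrite -!expRM_natl ler_expR !mulrN lerN2.
apply: (@le_trans _ _ (x%:R * (C * ln n%:R / n%:R))); last by rewrite ler_wpM2l.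
rewrite !mulrA ler_pdivlMr // mulrAC [x%:R * C]mulrC.
exact: ler_wpM2r.
Qed.

Lemma mul_onesub_le (R : realType) (n y M : nat) (u : R) : (0 < n)%N -> (5 <= y)%N ->
  u <= n%:R^-1 ^+ y -> 0 <= u -> (M <= n ^ (y - 5))%N -> M%:R * u <= n%:R^-1 ^+ 5.
Proof.
move=> n0 y5 uy u0 Mn; apply: (@le_trans _ _ ((n ^ (y - 5))%:R * n%:R^-1 ^+ y)).
  by apply: ler_pM; rewrite ?ler_nat.
rewrite -{2}(subnK y5) exprD mulrA natrX -exprMn divff ?pnatr_eq0 -?lt0n //.
by rewrite expr1n mul1r.
Qed.

(** Every part has at most [#|C1| + 1 = n] vertices, and the total [4 * n - 1] forces equality for
    the other three. *)
Lemma equitable_cards (V : finType) (n : nat) (V1 V2 C1 C2 : {set V}) :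
  (0 < n)%N -> #|V| = (4 * n - 1)%N -> uniq [:: V1; V2; C1; C2] ->
  equitable_partition [set V1; V2; C1; C2] -> #|C1| = (n - 1)%N ->
  [/\ #|V1| = n, #|V2| = n, #|C2| = n,
      [&& [disjoint V1 & V2], [disjoint V1 :|: V2 & C1 :|: C2] & [disjoint C1 & C2]]
    & V1 :|: V2 :|: (C1 :|: C2) = [set: V]].
Proof.
move=> n0 cV uq /andP[/and3P[/eqP cov /trivIsetP triv _] /forall_inP eqt] cC1.
move: uq; rewrite /= !inE !negb_or => /and4P[/and3P[n12 n13 n14] /andP[n23 n24] n34 _].
pose P := [set V1; V2; C1; C2].
have P1 : V1 \in P by rewrite !inE eqxx.
have P2 : V2 \in P by rewrite !inE eqxx ?orbT.
have P3 : C1 \in P by rewrite !inE eqxx ?orbT.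
have P4 : C2 \in P by rewrite !inE eqxx ?orbT.
have d12 := triv _ _ P1 P2 n12; have d13 := triv _ _ P1 P3 n13; have d14 := triv _ _ P1 P4 n14.
have d23 := triv _ _ P2 P3 n23; have d24 := triv _ _ P2 P4 n24; have d34 := triv _ _ P3 P4 n34.
have covE : V1 :|: V2 :|: (C1 :|: C2) = [set: V].
  rewrite -cov; apply/setP=> x; apply/idP/bigcupP => [|[A]].
    by rewrite !inE => /orP[/orP[]|/orP[]] xA; [exists V1 | exists V2 | exists C1 | exists C2].
  by rewrite !inE -!orbA => /or4P[] /eqP -> ->; rewrite ?orbT.
have dVC : [disjoint V1 :|: V2 & C1 :|: C2].
  rewrite disjoints_subset subUset setCU !subsetI.
  by move: d13 d14 d23 d24; rewrite !disjoints_subset => -> -> -> ->.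
have cU (A B : {set V}) : [disjoint A & B] -> #|A :|: B| = (#|A| + #|B|)%N.
  by move=> dis; rewrite cardsU (disjoint_setI0 dis) cards0 subn0.
have tot : (#|V1| + #|V2| + (#|C1| + #|C2|) = 4 * n - 1)%N.
  by rewrite -cV -cardsT -covE !cU.
have le1 := forall_inP (eqt _ P1) _ P3; have le2 := forall_inP (eqt _ P2) _ P3.
have le4 := forall_inP (eqt _ P4) _ P3; rewrite d12 dVC d34.
rewrite !cC1 in le1 le2 le4 tot.
by split=> //; move: n0 le1 le2 le4 tot; clear; lia.
Qed.

Lemma decomposition_probability (R : realType) (n k1 E m q : nat) (p C : R)
    (V : finType) (V1 V2 C1 C2 C2' : {set V}) :
  (100 <= E)%N -> (4800 * E ^ 2 <= k1.+1)%N -> (200 * k1.+1 ^ 4 <= n)%N ->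
  (n <= 2 * E * m)%N -> (100 * m <= n)%N -> (k1.+1 = 2 ^ q)%N ->
  0 <= p <= 1 -> C * ln n%:R / n%:R <= p -> (200 * k1.+1 ^ 4)%:R <= C ->
  #|V| = (4 * n - 1)%N -> #|V1| = n -> #|V2| = n -> #|C1| = (n - 1)%N -> #|C2| = n -> #|C2'| = m ->
  [disjoint V1 & V2] -> [disjoint V1 :|: V2 & C1 :|: C2] -> [disjoint C1 & C2] ->
  V1 :|: V2 :|: (C1 :|: C2) = [set: V] -> C2' \subset C2 ->
  1 - n%:R^-1 <= pr p (triangles (edges_meeting (V1 :|: V2)))
    (fun S => [exists TT : {set {set V}},
     let H := remove_triangles (edges_meeting (V1 :|: V2)) TT in
     [&& TT \subset S, edge_disjoint TT, tripartite H V1 V2 (C1 :|: C2),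
         [forall c in C1 :|: C2', degree H c == 0%N],
         [forall c in C2 :\: C2', neighbours H c == V1 :|: V2] &
         regular_on (V1 :|: V2) (induced H (V1 :|: V2)) (#|C2| - #|C2'|)]]).
Proof.
move=> E100 kE nk nEm mn kq p01 Cp kC cV cV1 cV2 cC1 cC2 cC2' dis12 disVC disC cov subC.
pose b := (n %/ k1)%N; pose a := (n %% k1)%N; pose w := (b %/ k1.+1)%N.
pose d0 := (b - k1 * w)%N; pose s0 := (m %/ 2)%N; pose s1 := (b %/ 2)%N.
have k1000 := k_ge1000 E100 kE.
have blarge := b_large E100 kE nk.
have b_gt0 : (0 < b)%N by apply: leq_trans blarge; rewrite muln_gt0 expn_gt0.
pose b0 := b.-1; have bE : b0.+1 = b by rewrite prednK.
(* The elementary abelian 2-group of order [k1.+1 = 2 ^ q]. *)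
pose K : finZmodType := 'rV['F_2]_q.
have cK : #|K| = k1.+1 by rewrite card_mx card_Fp // mul1n kq.
have Kxx (x : K) : x + x = 0.
  by apply/rowP=> i; rewrite !mxE; case: (x _ _) => -[|[|]] //= *; apply: val_inj.
have a_b : (2 * a <= b)%N := a_small E100 kE nk.
have le_ab : (a <= b0.+1)%N by rewrite bE; move: a_b; clear; lia.
pose rl : pred (K * 'I_b0.+1) := real a.
have card_Z : #|{: K * 'I_b0.+1}| = (k1.+1 * b)%N by rewrite card_prod card_ord cK bE.
have card_rl : #|[set z | rl z]| = n.
  move: (card_real K le_ab); rewrite cK -/rl; move: #|[set z | rl z]| => x; rewrite bE.
  have := nE n k1; rewrite -/a -/b; move: a_b; clearbody a b; clear; nia.
have z0 : K * 'I_b0.+1 := (0, ord0).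
have n_gt1 : (1 < n)%N by apply: leq_trans nk; move: k1000; clear; nia.
have [x0 x0V] : exists x, x \in V1.
  by apply/card_gt0P; rewrite cV1; apply: ltnW.
have [phi1 [psi1 lab1]] := exists_labelling z0 x0 (etrans card_rl (esym cV1)).
have [phi2 [psi2 lab2]] := exists_labelling z0 x0 (etrans card_rl (esym cV2)).
have cCc : #|C1 :|: C2'| = (n - 1 + m)%N.
  rewrite cardsU cC1 cC2' (_ : C1 :&: C2' = set0) ?cards0 ?subn0 //.
  apply: disjoint_setI0; move: disC; rewrite !disjoints_subset => /subset_trans; apply.
  by rewrite setCS.
have M_lt : (w * k1 ^ 2 < n)%N := main_lt E100 kE nk.
have [main [rd [main_uniq smain szmain rdnz [rc1 rc2 rcp]]]] :
  exists main (rd : V -> K * K), [/\ uniq main, {subset main <= C1 :|: C2'}, size main = (w * #|K|.-1 ^ 2)%N,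
      forall c, c \in main -> ((rd c).1 != 0) && ((rd c).2 != 0)
    & [/\ forall g, g != 0 -> count (fun c => (rd c).1 == g) main = (#|K|.-1 * w)%N,
          forall g, g != 0 -> count (fun c => (rd c).2 == g) main = (#|K|.-1 * w)%N
        & forall i j, (count (fun c => ((rd c).1 == i) && ((rd c).2 == j)) main <= w)%N]].
  by apply: schedule; rewrite cK cCc /=; move: M_lt; clear; lia.
rewrite cK /= in szmain rc1 rc2.
pose Rs := (C1 :|: C2') :\: [set c in main].
have colsE : [set c in main] :|: Rs = C1 :|: C2'.
  apply/setP=> c; rewrite !inE; case: (boolP (c \in main)) => //= cm.
  by have := smain c cm; rewrite !inE => ->.
have mainR : [disjoint [set c in main] & Rs].
  by rewrite disjoints_subset; apply/subsetP=> c cm; rewrite !inE in cm *; rewrite cm.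
have cRs : #|Rs| = (n - 1 + m - w * k1 ^ 2)%N.
  rewrite cardsD (setIidPr _) ?cCc; last by apply/subsetP=> c; rewrite inE => /smain.
  by rewrite cardsE (card_uniqP main_uniq) szmain.
have [s04 s0m] := s0_bounds E100 kE nk nEm.
have /andP[s14 s1ba] := s1_bounds E100 kE nk.
have [d0_gt0 le_d0b Zd0] := d0_bounds E100 kE nk.
have d0Eb : (d0 + k1 * w = b)%N := d0E n k1.
set np := size (piece_sizes K b0 a d0 s0).
have np_le : (16 * np <= s0)%N.
  apply: leq_trans (piece_count_bound E100 kE nk nEm); rewrite leq_mul2l /=.
  by move: (size_piece_sizes K b0 a d0 s0); rewrite -/np cK bE.
have [x1 x2 x3] := exponents E100 kE nk nEm.
have /andP[_ kb2n] := n_le_kb E100 kE nk.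
(* With [Lam = k1.+1 ^ 2] and [#|Z|.+1 <= n ^ 2], the number of codes per level is at most
   [n ^ (160 * k1.+1 ^ 2)]. The exponent [y] leaves room for this and for the five powers in [e]; it
   is available because [C] is at least [y * k1.+1 ^ 2 = 200 * k1.+1 ^ 4]. *)
pose e : R := n%:R^-1 ^+ 5.
pose y := (200 * k1.+1 ^ 2)%N.
have small x : (n <= k1.+1 ^ 2 * x)%N -> (1 - p) ^+ x <= n%:R^-1 ^+ y.
  move=> nx; apply: onesub_expn_le Cp _ => //; first by case/andP: p01.
  apply: le_trans (ler_wpM2r _ kC) => //; rewrite -!natrM ler_nat /y.
  by apply: leq_trans (leq_mul (leqnn _) nx) _; move: (k1.+1) => k; clear; nia.
have pos x : 0 <= (1 - p) ^+ x by rewrite exprn_ge0 // subr_ge0; case/andP: p01.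
have n0 := ltnW n_gt1.
have n200 : (200 <= n)%N by apply: leq_trans nk; rewrite leq_pmulr // expn_gt0.
have y5 : (200 <= y)%N by rewrite leq_pmulr // expn_gt0.
have Zn : (#|{: K * 'I_b0.+1}|.+1 <= n ^ 2)%N.
  by rewrite card_Z; move: kb2n n200; move: (k1.+1 * _)%N => v; clear; nia.
have e01 : 0 <= e <= 1.
  by rewrite exprn_ge0 ?invr_ge0 //= exprn_ile1 // ?invr_ge0 // invf_le1 ?ltr0n // ler1n.
have q1 : ((#|{: K * 'I_b0.+1}|.+1 * #|{: K * 'I_b0.+1}|.+1) ^ (40 * k1.+1 ^ 2))%:R * (1 - p) ^+ d0 <= e.
  apply: mul_onesub_le (small _ x1) (pos _) _ => //; first exact: leq_trans y5.
  apply: (@leq_trans ((n ^ 4) ^ (40 * k1.+1 ^ 2))%N).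
    by rewrite leq_exp2r ?muln_gt0 ?expn_gt0 // (expnD n 2 2) leq_mul.
  rewrite -expnM leq_pexp2l // /y; move: k1000; clear; nia.
have q5 M x : (n <= k1.+1 ^ 2 * x)%N -> (M <= n ^ 6)%N -> M%:R * (1 - p) ^+ x <= e.
  move=> nx Mn; apply: mul_onesub_le (small _ nx) (pos _) _ => //; first exact: leq_trans y5.
  by apply: leq_trans Mn _; rewrite leq_pexp2l //; move: y5; clear; lia.
have q2 : (2 * (#|{: K * 'I_b0.+1}|.+1 * #|V|.+1))%:R * (1 - p) ^+ (s0 %/ 4) <= e.
  apply: q5 => //; rewrite cV.
  move: Zn n200; move: (#|_|.+1) => v; clear => h1 h2.
  apply: (@leq_trans (2 * (n ^ 2 * n ^ 2))%N); first by rewrite !leq_mul //; move: h2; clear; nia.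
  by rewrite -!expnD (_ : 6 = 2 + 4)%N // [X in (_ <= X)%N]expnD leq_mul //; move: h2; clear; nia.
have q3 : (2 * (#|{: K * 'I_b0.+1}|.+1 * #|{: K * 'I_b0.+1}|.+1))%:R * (1 - p) ^+ (s1 %/ 4) <= e.
  apply: q5 => //.
  move: Zn n200; move: (#|_|.+1) => v; clear => h1 h2.
  apply: (@leq_trans (2 * (n ^ 2 * n ^ 2))%N); first by rewrite !leq_mul.
  by rewrite -!expnD (_ : 6 = 2 + 4)%N // [X in (_ <= X)%N]expnD leq_mul //; move: h2; clear; nia.
have rdc1 g : g != 0 -> (count (fun c => (rd c).1 == g) main + d0 = b0.+1)%N.
  by move=> g0; rewrite rc1 // addnC d0Eb bE.
have rdc2 g : g != 0 -> (count (fun c => (rd c).2 == g) main + d0 = b0.+1)%N.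
  by move=> g0; rewrite rc2 // addnC d0Eb bE.
have cV12 : #|V1 :|: V2| = (#|C1 :|: C2'| + (#|C2| - #|C2'|) + 1)%N.
  rewrite cCc cC2 cC2' cardsU cV1 cV2 (disjoint_setI0 dis12) cards0.
  by move: mn n0; clear; lia.
apply: le_trans (model_pass Kxx le_ab cov dis12 disVC disC subC cV12 lab1 lab2
  main_uniq mainR colsE _ _ rdc1 rdc2 (_ : 0 < s0)%N p01 x0 d0_gt0 (_ : 0 < k1.+1 ^ 2)%N _ s04 _ e01 q1 q2 q3
  _ _ _ np_le s14 _ _ _).
- have M_le : (size main <= n)%N by rewrite szmain ltnW.
  have np_n : (np <= n)%N by move: np_le s0m mn; clear; lia.
  have rM : (#|Rs| + size main <= 2 * n)%N.
    by rewrite cRs szmain subnK; move: M_lt mn; clear; lia.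
  have Z2 : (#|{: K * 'I_b0.+1}| <= 2 * n)%N by rewrite card_Z.
  (* The total coefficient of [e] is at most [60 * n ^ 2], hence below [n ^ 4], and [n ^ 4 * e] is
     [1 / n]. *)
  rewrite -/np -!addrA -!opprD lerD2l lerN2 -!mulrnA -!mulrnDr /e.
  have n0R : (0 : R) < n%:R by rewrite ltr0n.
  rewrite [leRHS](_ : _ = (n ^ 4)%N%:R * n%:R^-1 ^+ 5); last first.
    by rewrite exprS mulrCA natrX -exprMn divff ?expr1n ?mulr1 // lt0r_neq0.
  rewrite -[leLHS]mulr_natl ler_wpM2r ?exprn_ge0 ?invr_ge0 // ler_nat.
  clearbody np; move: M_le np_n rM Z2 n200.
  move: #|{: K * 'I_b0.+1}| (size main) (#|Rs| + _)%N => z x v; clear => h1 h2 h3 h4 h5.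
  have l1 := leq_mul h4 h1; have l2 := leq_mul h4 h2; have l3 := leq_mul h4 h3.
  have l4 : (60 * (n * n) <= n ^ 4)%N by move: h5; clear; nia.
  by move: l1 l2 l3 l4; clear; nia.
- by move=> c /rdnz/andP[].
- by move=> c /rdnz/andP[].
- exact: leq_trans s04.
- by rewrite expn_gt0.
- by rewrite card_Z.
- by rewrite cRs; apply: leq_trans s0m _; move: M_lt; clear; lia.
- by rewrite bE.
- by rewrite /round_size -/rl card_rl bE; apply: round_bound E100 kE nk nEm mn.
- move=> f fr; move: (card_edge_reps_reflection a fr); rewrite cK.
  move: #|edge_reps a f| => x; rewrite bE.
  exact: (reflection_bound E100 kE nk nEm mn).
- by rewrite bE.
- move=> i j; rewrite bE; apply: leq_trans (w_pair E100 kE nk).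
  by rewrite leq_mul2l rcp orbT.
rewrite -/rl card_rl cRs bE; apply: reserve_light E100 kE nk nEm mn _ np_le.
Qed.

Theorem theorem6p1 (R : realType) :
  exists f g h : R -> R,
    [/\ hierarchy_fun f, hierarchy_fun g & hierarchy_fun h] /\
    forall n0 C eps : R,
      0 < n0^-1 <= 1 -> 0 < C^-1 <= 1 -> 0 < eps <= 1 ->
      n0^-1 <= f C^-1 -> C^-1 <= g eps -> eps <= h 1 ->
    forall n : nat, n0 <= n%:R ->
    forall V1 V2 C1 C2 : {set 'I_(4 * n - 1)},
      uniq [:: V1; V2; C1; C2] ->
      equitable_partition [set V1; V2; C1; C2] ->
      #|C1| = (n - 1)%N ->
    forall C2' : {set 'I_(4 * n - 1)},
      C2' \subset C2 ->
      #|C2'|%:Z = Num.floor (eps * n%:R) ->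
    forall p : R,
      0 <= p <= 1 ->
      C * ln n%:R / n%:R <= p ->
    let G := edges_meeting (V1 :|: V2) in
    1 - n%:R^-1 <=
      Pr_triangles p G (fun S : {set {set 'I_(4 * n - 1)}} =>
        [exists TT : {set {set 'I_(4 * n - 1)}},
          let H := remove_triangles G TT in
          [&& TT \subset S,
              edge_disjoint TT,
              tripartite H V1 V2 (C1 :|: C2),
              [forall c in C1 :|: C2', degree H c == 0%N],
              [forall c in C2 :\: C2', neighbours H c == V1 :|: V2] &
              regular_on (V1 :|: V2) (induced H (V1 :|: V2))
                (#|C2| - #|C2'|)]]).
Proof.
(* With [t = 200 / eps] the choice of [g] means [C >= t ^+ 9]. The number [k] of blocks will be at
   most [t ^+ 2], so that [200 * k ^ 4 <= t * t ^+ 8 <= C <= n]. *)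
exists (fun x => x), (fun x => (x / 200) ^+ 9), (fun=> 100^-1); split.
  split; split=> //.
  - move=> x /andP[x0 x1]; rewrite exprn_gt0 ?exprn_ile1 ?divr_gt0 //; first lra.
    by rewrite ler_pdivrMr //; lra.
  - move=> x y x0 xy y1; apply: lerXn2r; rewrite ?nnegrE; lra.
  - by move=> x _; apply/andP; split; lra.
move=> n0 C eps /andP[n0_gt0 _] /andP[C_gt0 _] /andP[eps0 _] n0C Ceps eps100 n n0n.
move=> V1 V2 C1 C2 uq eqp cC1 C2' sC floorE p p01 Cp.
rewrite invr_gt0 in n0_gt0; rewrite invr_gt0 in C_gt0.
have Cn : C <= n%:R by apply: le_trans n0n; rewrite -lef_pV2 ?posrE.
pose v := eps^-1; have v0 : 0 < v by rewrite invr_gt0.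
have v100 : 100 <= v by rewrite -[100]invrK lef_pV2 ?posrE ?invr_gt0.
pose t := 10 * (20 * v); have t0 : 0 < t by rewrite !mulr_gt0.
have tC : t ^+ 9 <= C.
  rewrite -lef_pV2 ?posrE ?exprn_gt0 //; apply: le_trans Ceps _.
  have tV : t^-1 = eps / 200 by rewrite /t mulrA -natrM invfM invrK mulrC.
  by rewrite -exprVn tV.
have tv : v <= t by rewrite /t; move: v0; clear; lra.
have n_gt0 : (0 < n)%N by rewrite -(ltr0n R); apply: lt_le_trans Cn.
pose E := (Num.truncn v).+1; have /andP[E1 E2] := truncn_itv (ltW v0); rewrite -/E in E2.
have E100 : (100 <= E)%N by rewrite -(ler_nat R); apply: le_trans v100 (ltW E2).
have Ev : E%:R <= 2 * v.
  have : E%:R <= v + 1 by rewrite -natr1 lerD2r.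
  by move: v100; clear; lra.
(* The square of 70 is just above 4800, and rounding up to a power of two costs a factor 2. With
   [E <= 2 * v] this gives [k <= 98 * (20 * v) ^ 2], below [t ^ 2 = 100 * (20 * v) ^ 2]. *)
pose q := up_log 2 ((70 * E) ^ 2); pose k1 := (2 ^ q).-1.
have gt1 : (1 < (70 * E) ^ 2)%N by move: E100; clear; nia.
have /andP[q1 q2] := up_log_bounds (isT : (1 < 2)%N) gt1.
rewrite -/q in q1 q2.
have q_gt0 : (0 < q)%N by rewrite lt0n; apply: contraTneq q2 => ->; rewrite expn0 -ltnNge.
have kq : (k1.+1 = 2 ^ q)%N by rewrite /k1 prednK // expn_gt0.
have kE : (4800 * E ^ 2 <= k1.+1)%N by rewrite kq; apply: leq_trans q2; clear; nia.
have k_lt : (k1.+1 <= 2 * (70 * E) ^ 2)%N.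
  by rewrite kq -(prednK q_gt0) expnS leq_mul2l ltnW.
have kt : (k1.+1%:R : R) <= t ^+ 2.
  have : (k1.+1%:R : R) <= 2 * (70 * E%:R) ^+ 2 by rewrite -!natrM -natrX -natrM ler_nat.
  have : 70 * E%:R <= 7 * (20 * v) by move: Ev; clear; lra.
  have : 0 <= 70 * (E%:R : R) by rewrite mulr_ge0.
  rewrite /t; move: (70 * _) (20 * v) => y x; clear; nra.
have kC : (200 * k1.+1 ^ 4)%:R <= C.
  apply: le_trans tC; rewrite natrM natrX.
  apply: (@le_trans _ _ (t * t ^+ 8)); last by rewrite -exprS.
  apply: ler_pM; rewrite ?exprn_ge0 //; first by rewrite /t; move: v100; clear; lra.
  by rewrite (exprM t 2 4); apply: lerXn2r; rewrite ?nnegrE ?exprn_ge0 // ltW.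
have nk : (200 * k1.+1 ^ 4 <= n)%N by rewrite -(ler_nat R); apply: le_trans Cn.
set m := #|C2'| in floorE.
have /andP[m1 m2] := floor_itv (eps * n%:R); rewrite -floorE in m1 m2.
have {}m1 : m%:R <= eps * n%:R by [].
have {}m2 : eps * n%:R < m%:R + 1 by move: m2; rewrite intrD.
have nR : (0 : R) < n%:R by rewrite ltr0n.
have mn : (100 * m <= n)%N.
  by rewrite -(ler_nat R) natrM; move: m1 eps100 nR; clear; nra.
have epsE : 1 <= eps * E%:R by rewrite mulrC -ler_pdivrMr // div1r ltW.
(* Since [n >= C >= t >= 1 / eps], the floor of [eps * n] is at least 1; then [m + 1 <= 2 * m]
   absorbs the rounding in [nEm]. *)
have m_gt0 : (0 < m)%N.
  rewrite lt0n; apply/eqP=> m0; rewrite m0 in m2.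
  have : t <= n%:R.
    apply: le_trans (le_trans tC Cn); apply: ler_eXnr => //.
    by apply: le_trans tv; apply: le_trans v100; rewrite ler1n.
  move/(le_trans tv); rewrite /v -[eps^-1]mul1r ler_pdivrMr // mulrC.
  by move: m2; clear; lra.
have nEm : (n <= 2 * E * m)%N.
  rewrite -(ler_nat R) !natrM.
  have : (1 : R) <= m%:R by rewrite ler1n.
  have : (1 : R) <= E%:R by rewrite ler1n.
  by move: m2 epsE nR eps0; clear; nra.
have cardV : #|'I_(4 * n - 1)| = (4 * n - 1)%N by rewrite card_ord.
have [cV1 cV2 cC2 /and3P[d1 d2 d3] cov] := equitable_cards n_gt0 cardV uq eqp cC1.
exact: (decomposition_probability E100 kE nk nEm mn kq p01 Cp kC cardV cV1 cV2 cC1 cC2 erefl d1 d2 d3 cov sC).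
Qed.
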